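(* Let $\zeta=\{z_n\}_{n\in N}$, $\delta,\lambda,r,M_\zeta,B_\zeta$ be as in the context and let $X$ be a complex Banach space. Set $A:=\mathbb D_{r/(3M_\zeta)}\setminus\bar{\mathbb D}_{r/(6M_\zeta)}$, $A_\zeta:=B_\zeta^{-1}(A)\subset\mathbb D$, $S_{\zeta1}:=B_\zeta^{-1}(\mathbb D\setminus\bar{\mathbb D}_{r/(6M_\zeta)})$, $S_{\zeta2}:=B_\zeta^{-1}(\mathbb D_{r/(3M_\zeta)})$. Then there exist bounded linear operators $T_i:H^\infty(A_\zeta,X)\to H^\infty(S_{\zeta i},X)$, $i=1,2$, with $\|T_1\|\le6M_\zeta$ and $\|T_2\|\le4M_\zeta$, such that $$(T_1f)|_{A_\zeta}+(T_2f)|_{A_\zeta}=f\quad\text{for all }f\in H^\infty(A_\zeta,X).$$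
   Context: $\mathbb D$ open unit disk, $\mathbb D_t=\{|z|<t\}$, $\bar{\mathbb D}_t$ its closure, $\rho(z,w)=|z-w|/|1-\bar wz|$. $\zeta=\{z_n\}_{n\in N}\subset\mathbb D$ is an interpolating sequence for $H^\infty$ (every bounded data $\{a_n\}$ equals $\{g(z_n)\}$ for some bounded holomorphic $g$ on $\mathbb D$) with $\delta(\zeta):=\inf_k\prod_{j\ne k}\rho(z_j,z_k)\ge\delta>0$, and $M_\zeta$ is its constant of interpolation (least $M$ such that solutions $g$ with $\sup|g|\le M\sup|a_n|$ always exist). $\lambda\in(0,1)$ satisfies $\frac{2\lambda}{1+\lambda^2}<\delta$ and $r=\frac{\delta-\lambda}{1-\lambda\delta}\lambda$. $B_\zeta$ is the Blaschke product with simple zeros at the points of $\zeta$. For an open set $U$, $H^\infty(U,X)$ is the Banach space of bounded $X$-valued holomorphic functions on $U$ with sup norm. *)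

(* Defs.v *)
(* mathcomp-analysis over R : realType, complex numbers R[i]
   from mathcomp-real-closed (used through the regular copy R[i]^o, which
   carries the normed-module / filter structure of mathcomp-analysis). *)
From HB Require Import structures.
From mathcomp Require Import all_boot all_order all_algebra.
From mathcomp Require Import complex.
From mathcomp Require Import all_classical all_reals all_analysis.
Set Implicit Arguments.
Unset Strict Implicit.
Unset Printing Implicit Defensive.
Import Order.TTheory GRing.Theory Num.Theory.
Import numFieldNormedType.Exports.
Local Open Scope ring_scope.
Local Open Scope complex_scope.
Local Open Scope classical_set_scope.

Notation cplx R := (R[i])^o.

Definition cmod (R : realType) (z : cplx R) : R := ComplexField.Normc.normc z.

Definition odisk (R : realType) (t : R) : set (cplx R) := [set z | cmod z < t].
Definition cdisk (R : realType) (t : R) : set (cplx R) := [set z | cmod z <= t].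

Definition rho (R : realType) (z w : cplx R) : R :=
  cmod (z - w) / cmod (1 - conjc w * z).

Definition holomorphic_on (R : realType) (X : normedModType R[i])
  (U : set (cplx R)) (f : cplx R -> X) := forall z, U z -> derivable f z 1.

Definition bounded_on (R : realType) (X : normedModType R[i])
  (U : set (cplx R)) (f : cplx R -> X) :=
  exists B : R, forall z, U z -> `|f z| <= B%:C.

Definition Hinf (R : realType) (X : normedModType R[i])
  (U : set (cplx R)) (f : cplx R -> X) :=
  holomorphic_on U f /\ bounded_on U f.

(* T is a (well-defined) linear operator H^oo(U,X) -> H^oo(V,X):
   it maps H^oo(U,X) into H^oo(V,X), only depends on f|_U, and is C-linear. *)
Definition Hinf_linop (R : realType) (X : normedModType R[i])
  (U V : set (cplx R)) (T : (cplx R -> X) -> (cplx R -> X)) :=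
  [/\ (forall f, Hinf U f -> Hinf V (T f)),
      (forall f g, Hinf U f -> Hinf U g -> (forall z, U z -> f z = g z) ->
         forall z, V z -> T f z = T g z) &
      (forall (a b : R[i]) f g, Hinf U f -> Hinf U g -> forall z, V z ->
         T (fun w => a *: f w + b *: g w) z = a *: T f z + b *: T g z)].

Definition opnorm_le (R : realType) (X : normedModType R[i])
  (U V : set (cplx R)) (T : (cplx R -> X) -> (cplx R -> X)) (K : R) :=
  forall f (B : R), Hinf U f -> (forall z, U z -> `|f z| <= B%:C) ->
    forall z, V z -> `|T f z| <= (K * B)%:C.

Definition interpolating (R : realType) (z : nat -> cplx R) :=
  forall a : nat -> cplx R, (exists B : R, forall n, cmod (a n) <= B) ->
    exists g : cplx R -> cplx R, Hinf (odisk 1) g /\ forall n, g (z n) = a n.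

Definition interp_const (R : realType) (z : nat -> cplx R) : R :=
  inf [set M : R | 0 <= M /\
    forall (a : nat -> cplx R) (B : R), (forall n, cmod (a n) <= B) ->
      exists g : cplx R -> cplx R, [/\ Hinf (odisk 1) g,
        (forall n, g (z n) = a n) &
        (forall w, odisk 1 w -> cmod (g w) <= M * B)]].

Definition sep_const (R : realType) (z : nat -> cplx R) : R :=
  inf [set limn (fun N : nat => \prod_(j < N | (j : nat) != k) rho (z j) (z k))
      | k in [set: nat]].

Definition bfactor (R : realType) (a w : cplx R) : cplx R :=
  if a == 0 then w else ((cmod a)%:C / a) * (a - w) / (1 - conjc a * w).

Definition blaschke (R : realType) (z : nat -> cplx R) (w : cplx R) : cplx R :=
  limn (fun N : nat => \prod_(n < N) bfactor (z n) w).

(* Main.v *)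
(* Write M for the constant of interpolation.  There are Beurling functions: f_m
   holomorphic in the disk with f_m(z_k) = delta_mk and sum_m |f_m| <= M.  For
   finitely many points they are built from the top eigenvector of the matrix of
   weighted Szego kernels K(z_j, z_k): the eigenfunction Q has no zeros in the
   closed disk, the sum of the |f_m| is constant on the unit circle, equal to the
   eigenvalue, and pairing Q^2 g / B with the Szego kernels shows that no smaller
   constant can serve for interpolation; the infinite case is an ultrafilter limit.
   Over |w| < r the equation B(z) = w is solved by holomorphic branches
   z = b_m(w) with b_m(0) = z_m.  A function g on A_zeta is pulled back to the
   annulus A along each b_m, split there by Laurent decomposition (with norms at
   most 3 and 2, the outer radius being twice the inner one), composed with B, and
   glued by the f_m.  The two parts add up to P g = sum_m f_m (g o b_m o B), and
   Schwarz's lemma gives |1 - P| <= 1/2, so it suffices to replace g by P^-1 g,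
   which costs a factor 2: 2 * 3 * M = 6 M and 2 * 2 * M = 4 M. *)
Require Import Defs.
From HB Require Import structures.
From mathcomp Require Import all_boot all_order all_algebra.
From mathcomp Require Import complex.
From mathcomp Require Import all_classical all_reals all_analysis.
From mathcomp Require Import ring lra.
Import Order.TTheory GRing.Theory Num.Theory.
Import numFieldNormedType.Exports.
Local Open Scope ring_scope.
Local Open Scope complex_scope.
Local Open Scope classical_set_scope.

Set Implicit Arguments.
Unset Strict Implicit.
Unset Printing Implicit Defensive.

(** No constant may be wasted, and this shapes the proof. Beurling's functions are needed with the
    exact bound [M], hence the eigenvalue construction. The norms 2 and 3 come from the maximum
    principle: near the outer circle of the annulus [a < |w| < b] the inner Laurent part is the
    function minus the outer part, whose kernel estimate tends to [a / (b - a) = 1]; near the inner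
    circle the roles are exchanged and the estimate tends to [b / (b - a) = 2]. The bound 1/2 is
    Schwarz-Pick at a point of modulus at most [1 / (3 * M)]. That the branches exhaust the preimage
    of [|w| < r] is a count of polynomial roots for finite products, carried to the limit because
    the regions that contain the branches do not depend on the number of factors. The functions are
    Banach-valued and no integral is used: a circle mean is a trapezoidal sum over [2 ^ n] points,
    and Cauchy's theorem says that the means over two circles differ by a null sequence. Holomorphy
    amounts to an inequality between three values, so it survives pointwise limits of locally
    bounded families, ultrafilter limits included. *)

Arguments cmod : simpl never.

(** * Real-valued norms of scalars and vectors *)

Section Norms.
Variable R : realType.
Local Notation C := R[i].
Implicit Types z w a b : C.

Lemma cmodE z : `|z| = (cmod z)%:C.
Proof. by []. Qed.

Lemma cmod_ge0 z : 0 <= cmod z.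
Proof. by rewrite -lecR -cmodE normr_ge0. Qed.

Lemma cmod0 : cmod (0 : C) = 0.
Proof. exact: ComplexField.Normc.normc0. Qed.

Lemma cmod1 : cmod (1 : C) = 1.
Proof. exact: ComplexField.Normc.normc1. Qed.

Lemma cmodM z w : cmod (z * w) = cmod z * cmod w.
Proof. exact: ComplexField.Normc.normcM. Qed.

Lemma cmodV z : cmod z^-1 = (cmod z)^-1.
Proof. exact: ComplexField.Normc.normcV. Qed.

Lemma cmodf z w : cmod (z / w) = cmod z / cmod w.
Proof. by rewrite cmodM cmodV. Qed.

Lemma cmodN z : cmod (- z) = cmod z.
Proof. by apply: complexI; rewrite -!cmodE normrN. Qed.

Lemma cmodC z w : cmod (z - w) = cmod (w - z).
Proof. by rewrite -cmodN opprB. Qed.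

Lemma cmodD z w : cmod (z + w) <= cmod z + cmod w.
Proof. by rewrite -lecR rmorphD /= -!cmodE ler_normD. Qed.

Lemma cmodB z w : cmod (z - w) <= cmod z + cmod w.
Proof. by rewrite -(cmodN w) cmodD. Qed.

Lemma cmod_lbD z w : cmod z - cmod w <= cmod (z + w).
Proof. by have := cmodB (z + w) w; rewrite addrK; lra. Qed.

Lemma cmod_lbB z w : cmod z - cmod w <= cmod (z - w).
Proof. by rewrite -(cmodN w) cmod_lbD. Qed.

Lemma cmodX z n : cmod (z ^+ n) = cmod z ^+ n.
Proof. by elim: n => [|n IH]; rewrite ?expr0 ?cmod1 // !exprS cmodM IH. Qed.

Lemma cmodR (x : R) : cmod x%:C = `|x|.
Proof. by rewrite /cmod /= expr0n addr0 sqrtr_sqr. Qed.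

Lemma cmodRp (x : R) : 0 <= x -> cmod x%:C = x.
Proof. by move=> x0; rewrite cmodR ger0_norm. Qed.

Lemma cmodJ z : cmod (conjc z) = cmod z.
Proof. by apply: complexI; rewrite -!cmodE normcJ. Qed.

Lemma cmod_eq0 z : (cmod z == 0) = (z == 0).
Proof. by rewrite -(inj_eq (@complexI R)) -cmodE normr_eq0. Qed.

Lemma cmod_gt0 z : (0 < cmod z) = (z != 0).
Proof. by rewrite lt0r cmod_ge0 andbT cmod_eq0. Qed.

Lemma sqr_cmod z : ((cmod z) ^+ 2)%:C = z * conjc z.
Proof. by rewrite rmorphXn /= -cmodE sqr_normc. Qed.

Lemma cmod_sum (I : Type) (r : seq I) (P : pred I) (F : I -> C) :
  cmod (\sum_(i <- r | P i) F i) <= \sum_(i <- r | P i) cmod (F i).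
Proof.
elim/big_rec2: _ => [|i x y _ IH]; first by rewrite cmod0.
by apply: le_trans (cmodD _ _) _; rewrite lerD2l.
Qed.

Lemma cmod_prod (I : Type) (r : seq I) (P : pred I) (F : I -> C) :
  cmod (\prod_(i <- r | P i) F i) = \prod_(i <- r | P i) cmod (F i).
Proof. by elim/big_rec2: _ => [|i x y _ <-]; rewrite ?cmod1 ?cmodM. Qed.

Lemma normReIm z : `|complex.Re z| <= cmod z /\ `|complex.Im z| <= cmod z.
Proof.
case: z => x y; rewrite /cmod /= -!sqrtr_sqr !ler_sqrt ?addr_ge0 ?sqr_ge0//.
by rewrite lerDl lerDr !sqr_ge0.
Qed.

Lemma cmod_ReIm z : cmod z <= `|complex.Re z| + `|complex.Im z|.
Proof.
rewrite [in leLHS](complexE z); apply: le_trans (cmodD _ _) _.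
rewrite cmodM !cmodR (_ : cmod 'i = 1) ?mul1r//.
by rewrite /cmod /= expr0n expr1n add0r sqrtr1.
Qed.

Variable X : normedModType R[i].
Implicit Types x y : X.

(** The norm of [X] takes its values in [R[i]]; its real part is open to [lra] and [nra]. *)
Definition vnorm x : R := complex.Re `|x|.

Lemma vnormE x : `|x| = (vnorm x)%:C.
Proof. by rewrite /vnorm RRe_real// normr_real. Qed.

Lemma vnorm_ge0 x : 0 <= vnorm x.
Proof. by rewrite -lecR -vnormE normr_ge0. Qed.

Lemma vnorm0 : vnorm 0 = 0.
Proof. by apply: complexI; rewrite -vnormE normr0. Qed.

Lemma vnorm_eq0 x : (vnorm x == 0) = (x == 0).
Proof. by rewrite -(inj_eq (@complexI R)) -vnormE normr_eq0. Qed.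

Lemma vnormN x : vnorm (- x) = vnorm x.
Proof. by apply: complexI; rewrite -!vnormE normrN. Qed.

Lemma vnormC x y : vnorm (x - y) = vnorm (y - x).
Proof. by rewrite -vnormN opprB. Qed.

Lemma vnormD x y : vnorm (x + y) <= vnorm x + vnorm y.
Proof. by rewrite -lecR rmorphD /= -!vnormE ler_normD. Qed.

Lemma vnormB x y : vnorm (x - y) <= vnorm x + vnorm y.
Proof. by rewrite -(vnormN y) vnormD. Qed.

Lemma vnorm_tri x y t : vnorm (x - t) <= vnorm (x - y) + vnorm (y - t).
Proof. by rewrite -[x in leLHS](subrK y) -addrA vnormD. Qed.

Lemma vnormZ a x : vnorm (a *: x) = cmod a * vnorm x.
Proof. by apply: complexI; rewrite rmorphM /= -!vnormE normrZ. Qed.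

Lemma vnorm_sum (I : Type) (r : seq I) (P : pred I) (F : I -> X) :
  vnorm (\sum_(i <- r | P i) F i) <= \sum_(i <- r | P i) vnorm (F i).
Proof.
elim/big_rec2: _ => [|i x y _ IH]; first by rewrite vnorm0.
by apply: le_trans (vnormD _ _) _; rewrite lerD2l.
Qed.

Lemma vnorm_le x (B : R) : (`|x| <= B%:C) = (vnorm x <= B).
Proof. by rewrite vnormE lecR. Qed.

Lemma vnorm_small x : (forall e : R, 0 < e -> vnorm x <= e) -> x = 0.
Proof.
move=> H; apply/eqP; rewrite -vnorm_eq0 eq_le vnorm_ge0 andbT.
by apply/ler_addgt0Pr => e e0; rewrite add0r H.
Qed.

End Norms.

Lemma vnorm_scal (R : realType) (z : (R[i])^o) : vnorm z = cmod z.
Proof. by []. Qed.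

(** * Limits of sequences of vectors *)

Section Limits.
Variables (R : realType) (X : normedModType R[i]).
Local Notation C := R[i].
Implicit Types u v : nat -> X.

Definition vlim u (l : X) :=
  forall e : R, 0 < e -> exists N, forall n, (N <= n)%N -> vnorm (u n - l) <= e.

Definition vcauchy u := forall e : R, 0 < e ->
  exists N, forall n m, (N <= n)%N -> (N <= m)%N -> vnorm (u n - u m) <= e.

Lemma nbhs_vnorm (l : X) (A : set X) :
  nbhs l A <-> exists2 e : R, 0 < e & forall y, vnorm (l - y) < e -> A y.
Proof.
split=> [/nbhs_normP[e /= e0 H]|[e e0 H]].
  have er : (complex.Re e)%:C = e :> C by rewrite RRe_real// ger0_real// ltW.
  exists (complex.Re e); first by rewrite -ltcR er.
  by move=> y hy; apply: H; rewrite /= vnormE -er ltcR.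
apply/nbhs_normP; exists e%:C; first by rewrite /= ltcR.
by move=> y /=; rewrite vnormE ltcR; exact: H.
Qed.

Lemma vlimP u l : vlim u l <-> u @ \oo --> l.
Proof.
split=> [H A /nbhs_vnorm[e e0 HA]|H e e0].
  have [N HN] := H _ (divr_gt0 e0 (ltr0Sn _ 1)); exists N => // n /= Nn.
  by apply: HA; rewrite vnormC; apply: le_lt_trans (HN n Nn) _; lra.
have /H[N _ HN] : nbhs l [set y | vnorm (l - y) < e].
  by apply/nbhs_vnorm; exists e.
by exists N => n Nn; rewrite vnormC ltW// HN.
Qed.

Lemma vlim_unique u l l' : vlim u l -> vlim u l' -> l = l'.
Proof.
move=> H H'; apply/eqP; rewrite -subr_eq0; apply/eqP/vnorm_small => e e0.
have e2 : 0 < e / 2 by lra.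
have [N HN] := H _ e2; have [N' HN'] := H' _ e2.
have := HN (maxn N N') (leq_maxl _ _); have := HN' (maxn N N') (leq_maxr _ _).
move: (u _) => x; rewrite (vnormC x l); have := vnorm_tri l x l'; lra.
Qed.

Lemma vlim_limn u l : vlim u l -> limn u = l.
Proof. by move=> /vlimP /cvg_lim; apply; exact: norm_hausdorff. Qed.

Lemma vlim_cst (l : X) : vlim (fun=> l) l.
Proof. by move=> e e0; exists 0%N => n _; rewrite subrr vnorm0 ltW. Qed.

Lemma vlimD u v l l' : vlim u l -> vlim v l' -> vlim (fun n => u n + v n) (l + l').
Proof.
move=> H H' e e0; have e2 : 0 < e / 2 by lra.
have [N HN] := H _ e2; have [N' HN'] := H' _ e2.
exists (maxn N N') => n; rewrite geq_max => /andP[/HN a /HN' b].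
by rewrite opprD addrACA; apply: le_trans (vnormD _ _) _; lra.
Qed.

Lemma vlimN u l : vlim u l -> vlim (fun n => - u n) (- l).
Proof.
move=> H e e0; have [N HN] := H _ e0.
by exists N => n /HN; rewrite -opprD vnormN.
Qed.

Lemma vlimB u v l l' : vlim u l -> vlim v l' -> vlim (fun n => u n - v n) (l - l').
Proof. by move=> ? /vlimN; exact: vlimD. Qed.

Lemma vlimZ (a : C) u l : vlim u l -> vlim (fun n => a *: u n) (a *: l).
Proof.
move=> H e e0; have a0 := cmod_ge0 a.
have [N HN] : exists N, forall n, (N <= n)%N -> vnorm (u n - l) <= e / (cmod a + 1).
  by apply: H; rewrite divr_gt0//; lra.
exists N => n /HN; rewrite -scalerBr vnormZ ler_pdivlMr; last by lra.
have := vnorm_ge0 (u n - l); nra.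
Qed.

Lemma vlim_le u l (B : R) N : (forall n, (N <= n)%N -> vnorm (u n) <= B) -> vlim u l -> vnorm l <= B.
Proof.
move=> H Hl; apply/ler_addgt0Pr => e e0; have [N' HN] := Hl _ e0.
have := HN (maxn N N') (leq_maxr _ _); have := H (maxn N N') (leq_maxl _ _).
move: (u _) => x; have := vnorm_tri l x 0; rewrite !subr0 (vnormC l x); lra.
Qed.

Lemma vlim_ext u v l : (forall n, u n = v n) -> vlim u l -> vlim v l.
Proof. by move=> /funext ->. Qed.

End Limits.

(** A predicate rather than a structure, so that the same lemmas serve for the scalars
    ([scalar_complete]) and for a complete [X]. *)
Definition seqcomplete (R : realType) (X : normedModType R[i]) :=
  forall u : nat -> X, vcauchy u -> exists l, vlim u l.

Lemma complete_seqcomplete (R : realType) (X : completeNormedModType R[i]) :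
  seqcomplete X.
Proof.
move=> u H.
have /cauchy_cvg : cauchy (u @ \oo).
  apply/cauchy_ballP => e e0.
  have er : (complex.Re e)%:C = e :> R[i] by rewrite RRe_real// ger0_real// ltW.
  have re0 : 0 < complex.Re e by rewrite -ltcR er.
  have re2 : 0 < complex.Re e / 2 by lra.
  have [N HN] := H _ re2.
  exists ([set u n | n in [set n | (N <= n)%N]], [set u n | n in [set n | (N <= n)%N]]).
    by split; exists N => // n /= Nn; exists n.
  move=> [x y] /= [[n Nn <-] [m Nm <-]].
  by rewrite -ball_normE /= vnormE -er ltcR; apply: le_lt_trans (HN _ _ Nn Nm) _; lra.
by move=> Hu; exists (lim (u @ \oo)); apply/vlimP.
Qed.

(** * Linear identities in modules by reflection *)

Section LinearReflection.
Variables (K : comNzRingType) (V : lmodType K).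

Inductive lexpr :=
  | LAtom of nat | LZero | LAdd of lexpr & lexpr | LOpp of lexpr | LScale of K & lexpr.

Fixpoint leval (env : seq V) e : V :=
  match e with
  | LAtom i => nth 0 env i
  | LZero => 0
  | LAdd a b => leval env a + leval env b
  | LOpp a => - leval env a
  | LScale k a => k *: leval env a
  end.

(** [PeanoNat.Nat.eqb] reduces on numerals, so [/=] turns the conditions of [lcheck] into plain ring
    identities. *)
Fixpoint lcoef e (i : nat) : K :=
  match e with
  | LAtom j => if PeanoNat.Nat.eqb j i then 1 else 0
  | LZero => 0
  | LAdd a b => lcoef a i + lcoef b i
  | LOpp a => - lcoef a i
  | LScale k a => k * lcoef a i
  end.

Fixpoint lcomb (env : seq V) (c : nat -> K) : V :=
  if env is x :: env' then c 0%N *: x + lcomb env' (fun i => c i.+1) else 0.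

Lemma lcombE env c : lcomb env c = \sum_(i < size env) c i *: nth 0 env i.
Proof.
elim: env c => [|x env IH] c /=; first by rewrite big_ord0.
by rewrite big_ord_recl IH.
Qed.

Lemma leval_lcomb env e : leval env e = lcomb env (lcoef e).
Proof.
rewrite lcombE; elim: e => [j||a IHa b IHb|a IHa|k a IHa] /=.
- have [jn|jn] := ltnP j (size env); last first.
    rewrite nth_default// big1// => i _; case: (PeanoNat.Nat.eqb_spec j i) => [ji|]; last by rewrite scale0r.
    by move: jn; rewrite ji leqNgt ltn_ord.
  rewrite (bigD1 (Ordinal jn))//= PeanoNat.Nat.eqb_refl scale1r big1 ?addr0// => i.
  move=> /eqP ij; case: (PeanoNat.Nat.eqb_spec j i) => [ji|]; last by rewrite scale0r.
  by case: ij; apply/val_inj.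
- by rewrite big1// => i _; rewrite scale0r.
- by rewrite IHa IHb -big_split; apply: eq_bigr => i _; rewrite scalerDl.
- by rewrite IHa -sumrN; apply: eq_bigr => i _; rewrite scaleNr.
- by rewrite IHa scaler_sumr; apply: eq_bigr => i _; rewrite scalerA.
Qed.

Fixpoint lcheck (n : nat) (c d : nat -> K) : Prop :=
  if n is n'.+1 then c n' = d n' /\ lcheck n' c d else True.

Lemma lcheckP env a b :
  lcheck (size env) (lcoef a) (lcoef b) -> leval env a = leval env b.
Proof.
rewrite !leval_lcomb !lcombE => H; apply: eq_bigr => i _; congr (_ *: _).
move: (size env) H i => n; elim: n => [|n IH] /= => [_ []//|[E H] i].
by case: (unliftP ord_max i) => [j ->|->//]; rewrite lift_max; apply: IH.
Qed.

End LinearReflection.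

Ltac lmod_index x env :=
  lazymatch env with
  | cons ?y ?env' =>
    match constr:(tt) with
    | _ => let _ := match constr:(tt) with _ => unify x y end in constr:(0%N)
    | _ => let n := lmod_index x env' in constr:(S n)
    end
  end.

Ltac lmod_atoms t env :=
  lazymatch t with
  | (0)%R => env
  | (?a + ?b)%R => let env' := lmod_atoms a env in lmod_atoms b env'
  | (- ?a)%R => lmod_atoms a env
  | (?k *: ?a)%R => lmod_atoms a env
  | _ => let b := match constr:(true) with
         | _ => let n := lmod_index t env in constr:(true)
         | _ => constr:(false) end in
         lazymatch b with true => env | _ => constr:(cons t env) end
  end.

Ltac lmod_reify K t env :=
  lazymatch t with
  | (0)%R => constr:(@LZero K)
  | (?a + ?b)%R => let a' := lmod_reify K a env in let b' := lmod_reify K b env in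
      constr:(@LAdd K a' b')
  | (- ?a)%R => let a' := lmod_reify K a env in constr:(@LOpp K a')
  | (?k *: ?a)%R => let a' := lmod_reify K a env in constr:(@LScale K k a')
  | _ => let n := lmod_index t env in constr:(@LAtom K n)
  end.

(* Decides linear identities between vectors, up to [ring] on the scalars. *)
Ltac lmodule K V :=
  lazymatch goal with
  | |- ?a = ?b =>
    let e0 := lmod_atoms a constr:(@nil V) in
    let env := lmod_atoms b e0 in
    let a' := lmod_reify K a env in
    let b' := lmod_reify K b env in
    change (leval (V := V) env a' = leval (V := V) env b');
    apply: lcheckP; rewrite /=; repeat split; try ring
  end.

(** * Complex differentiability *)

Section Conjugation.
Variable R : realType.
Implicit Types z w : R[i].

Lemma conjcM z w : conjc (z * w) = conjc z * conjc w.
Proof. exact: rmorphM. Qed.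
Lemma conjcD z w : conjc (z + w) = conjc z + conjc w.
Proof. exact: rmorphD. Qed.
Lemma conjcB z w : conjc (z - w) = conjc z - conjc w.
Proof. exact: rmorphB. Qed.
Lemma conjcN z : conjc (- z) = - conjc z.
Proof. exact: rmorphN. Qed.
Lemma conjcV z : conjc z^-1 = (conjc z)^-1.
Proof. exact: fmorphV. Qed.
Lemma conjc_sum (I : Type) (r : seq I) (P : pred I) (F : I -> R[i]) :
  conjc (\sum_(i <- r | P i) F i) = \sum_(i <- r | P i) conjc (F i).
Proof. exact: rmorph_sum. Qed.

End Conjugation.

Section ScalarLimits.
Variable R : realType.
Local Notation C := R[i].
Notation V := (R[i])^o.

Lemma real_cauchy_cvg (x : nat -> R) :
  (forall e, 0 < e -> exists N, forall n m, (N <= n)%N -> (N <= m)%N -> `|x n - x m| <= e) ->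
  exists l, forall e, 0 < e -> exists N, forall n, (N <= n)%N -> `|x n - l| <= e.
Proof.
move=> H.
have /cauchy_cvg Hx : cauchy (x @ \oo).
  apply/cauchy_ballP => e e0; have e2 : 0 < e / 2 by lra.
  have [N HN] := H _ e2.
  exists ([set x n | n in [set n | (N <= n)%N]], [set x n | n in [set n | (N <= n)%N]]).
    by split; exists N => // n /= Nn; exists n.
  move=> [? ?] /= [[n Nn <-] [m Nm <-]].
  by rewrite -ball_normE /=; apply: le_lt_trans (HN _ _ Nn Nm) _; lra.
exists (lim (x @ \oo)) => e e0.
have /cvgrPdist_le/(_ e e0)[N _ HN] := Hx.
by exists N => n Nn; rewrite distrC; exact: HN.
Qed.

Lemma scalar_complete : seqcomplete V.
Proof.
move=> u H.
have [|x Hx] := @real_cauchy_cvg (fun n => complex.Re (u n)).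
  move=> e /H[N HN]; exists N => n m Nn Nm; apply: le_trans (HN n m Nn Nm).
  by case: (normReIm (u n - u m)); case: (u n) (u m) => ? ? [? ?].
have [|y Hy] := @real_cauchy_cvg (fun n => complex.Im (u n)).
  move=> e /H[N HN]; exists N => n m Nn Nm; apply: le_trans (HN n m Nn Nm).
  by case: (normReIm (u n - u m)); case: (u n) (u m) => ? ? [? ?].
exists (x +i* y)%C => e e0; have e2 : 0 < e / 2 by lra.
have [N HN] := Hx _ e2; have [M HM] := Hy _ e2.
exists (maxn N M) => n; rewrite geq_max => /andP[/HN a /HM b].
rewrite vnorm_scal; apply: le_trans (cmod_ReIm _) _.
by case: (u n) a b => s t /=; lra.
Qed.

Lemma vlimM (X : normedModType R[i]) (a : nat -> V) (u : nat -> X) (k : V) (l : X) :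
  vlim a k -> vlim u l -> vlim (fun n => a n *: u n) (k *: l).
Proof.
move=> Ha Hu e e0; have k0 := cmod_ge0 k; have l0 := vnorm_ge0 l.
pose d := Num.min 1 (e / (cmod k + vnorm l + 1)).
have D0 : 0 < cmod k + vnorm l + 1 by lra.
have d0 : 0 < d by rewrite lt_min ltr01 divr_gt0.
have d1 : d <= 1 by rewrite ge_min lexx.
have de : d * (cmod k + vnorm l + 1) <= e.
  by rewrite -ler_pdivlMr// ge_min lexx orbT.
have [N HN] := Ha _ d0; have [M HM] := Hu _ d0.
exists (maxn N M) => n; rewrite geq_max => /andP[/HN A /HM B].
have -> : a n *: u n - k *: l = (a n - k) *: (u n - l) + k *: (u n - l) + (a n - k) *: l.
  rewrite -scalerDl subrK scalerBr scalerBl.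
  by rewrite addrA subrK.
have := vnormD ((a n - k) *: (u n - l) + k *: (u n - l)) ((a n - k) *: l).
have := vnormD ((a n - k) *: (u n - l)) (k *: (u n - l)).
rewrite !vnormZ; have := cmod_ge0 (a n - k); have := vnorm_ge0 (u n - l).
rewrite vnorm_scal in A; nra.
Qed.

End ScalarLimits.

(** * First-order expansions and the rules of differentiation *)

Section Cder.
Variables (R : realType).
Local Notation C := R[i].
Notation V := (R[i])^o.

Definition near0 (P : C -> Prop) := exists2 e : R, 0 < e & forall h, cmod h < e -> P h.

Lemma near0_and (P Q : C -> Prop) : near0 P -> near0 Q -> near0 (fun h => P h /\ Q h).
Proof.
move=> [e e0 H] [d d0 H']; exists (Num.min e d); first by rewrite lt_min e0.
by move=> h; rewrite lt_min => /andP[/H ? /H' ?].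
Qed.

Lemma near0_imp (P Q : C -> Prop) : (forall h, P h -> Q h) -> near0 P -> near0 Q.
Proof. by move=> H [e e0 He]; exists e => // h /He /H. Qed.

Lemma near0_small (e : R) : 0 < e -> near0 (fun h => cmod h < e).
Proof. by exists e. Qed.

Section Def.
Variable X : normedModType R[i].

Definition cder (f : C -> X) (z : C) (d : X) := forall e, 0 < e ->
  near0 (fun h => vnorm (f (z + h) - f z - h *: d) <= e * cmod h).

Definition cdiff (f : C -> X) z := exists d, cder f z d.

Definition ccont (f : C -> X) (z : C) := forall e, 0 < e ->
  near0 (fun h => vnorm (f (z + h) - f z) <= e).

(** An estimate of the difference quotient, multiplied by [cmod h], is an estimate of [cder]; only
    [h = 0], which the punctured filter leaves out, needs a separate look. *)
Lemma cder_derivable (f : cplx R -> X) z : derivable f z 1 <-> cdiff f z.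
Proof.
pose q (h : C) := h^-1 *: (f (h + z) - f z).
have qE : (fun h : C => h^-1 *: ((f \o shift z) (h *: (1 : cplx R)) - f z)) = q.
  by apply/funext => h; rewrite /q /= /GRing.scale /= mulr1.
have key h d (e : R) : h != 0 ->
    (vnorm (d - q h) <= e) = (vnorm (f (z + h) - f z - h *: d) <= e * cmod h).
  move=> h0; rewrite [in RHS](_ : _ - _ = h *: (q h - d)); last first.
    by rewrite /q scalerBr scalerA divff// scale1r [h + z]addrC.
  by rewrite vnormZ mulrC ler_pM2r ?cmod_gt0// vnormC.
rewrite /derivable qE; split=> [/cvg_ex[d Hd]|[d Hd]].
  exists d => e e0.
  have /Hd : nbhs (d : X) [set y | vnorm (d - y) < e] by apply/nbhs_vnorm; exists e.
  move=> /nbhs_vnorm[eta eta0 H]; exists eta => // h hh.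
  have [->|h0] := eqVneq h 0.
    by rewrite addr0 subrr scale0r subrr vnorm0 cmod0 mulr0.
  by rewrite -key// ltW//; apply: (H h) => //; rewrite vnorm_scal sub0r cmodN.
apply/cvg_ex; exists d => A /nbhs_vnorm[e e0 HA].
have [|eta eta0 H] := Hd (e / 2); first by lra.
apply/nbhs_vnorm; exists eta => // h; rewrite vnorm_scal sub0r cmodN => hh h0.
apply: HA; apply: (@le_lt_trans _ _ (e / 2)); last by lra.
by rewrite key//; exact: H.
Qed.

Lemma cdiff_cont f z : cdiff f z -> ccont f z.
Proof.
move=> [d Hd] e e0; have d0 := vnorm_ge0 d.
have D0 : 0 < vnorm d + 1 by lra.
have := near0_and (Hd _ ltr01) (near0_small (divr_gt0 e0 D0)).
apply: near0_imp => h []; rewrite ltr_pdivlMr// => H1 H2.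
have := vnormD (f (z + h) - f z - h *: d) (h *: d).
by rewrite subrK vnormZ; nra.
Qed.

Lemma cder_ext f g z d : near0 (fun h => f (z + h) = g (z + h)) -> cder f z d -> cder g z d.
Proof.
move=> H Hf e e0; have := near0_and H (Hf e e0); apply: near0_imp => h [<- ].
by case: H => eta eta0 /(_ 0); rewrite cmod0 addr0 => ->.
Qed.

Lemma cdiff_ext f g z : near0 (fun h => f (z + h) = g (z + h)) -> cdiff f z -> cdiff g z.
Proof. by move=> H [d Hd]; exists d; exact: cder_ext Hd. Qed.

Lemma cder_cst (x : X) z : cder (fun=> x) z 0.
Proof.
by move=> e e0; exists 1 => // h _; rewrite subrr scaler0 subrr vnorm0 mulr_ge0 ?cmod_ge0 ?ltW.
Qed.

Lemma cderD f g z d d' : cder f z d -> cder g z d' -> cder (fun w => f w + g w) z (d + d').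
Proof.
move=> Hf Hg e e0; have e2 : 0 < e / 2 by lra.
have := near0_and (Hf _ e2) (Hg _ e2); apply: near0_imp => h [H1 H2].
rewrite (_ : _ - _ = (f (z + h) - f z - h *: d) + (g (z + h) - g z - h *: d')).
  by have := vnormD (f (z + h) - f z - h *: d) (g (z + h) - g z - h *: d'); lra.
by lmodule R[i] X.
Qed.

Lemma cderZ (a : C) f z d : cder f z d -> cder (fun w => a *: f w) z (a *: d).
Proof.
move=> Hf e e0; have a0 := cmod_ge0 a; have D0 : 0 < cmod a + 1 by lra.
have := Hf _ (divr_gt0 e0 D0); apply: near0_imp => h.
rewrite [in X in _ -> X](_ : _ - _ = a *: (f (z + h) - f z - h *: d)); last by lmodule R[i] X.
rewrite vnormZ mulrAC ler_pdivlMr//.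
by have := vnorm_ge0 (f (z + h) - f z - h *: d); nra.
Qed.

End Def.

Lemma cderM (X : normedModType R[i]) (a : C -> V) (f : C -> X) z k d :
  cder a z k -> cder f z d -> cder (fun w => a w *: f w) z (k *: f z + a z *: d).
Proof.
move=> Ha Hf e e0.
have Cf := cdiff_cont (ex_intro _ _ Hf).
set m := cmod (a z) + vnorm (f z) + cmod k.
have m1 := cmod_ge0 (a z); have m2 := vnorm_ge0 (f z); have m3 := cmod_ge0 k.
pose D := Num.min 1 (e / (m + 1)).
have m0 : 0 < m + 1 by rewrite /m; lra.
have d0 : 0 < D by rewrite lt_min ltr01 divr_gt0.
have d1 : D <= 1 by rewrite ge_min lexx.
have de : D * (m + 1) <= e by rewrite -ler_pdivlMr// ge_min lexx orbT.
have := near0_and (near0_and (Ha _ d0) (Hf _ d0)) (Cf _ d0).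
apply: near0_imp => h [[H1 H2] H3].
set A := a (z + h) - a z - h *: k in H1; set F := f (z + h) - f z - h *: d in H2.
have -> : a (z + h) *: f (z + h) - a z *: f z - h *: (k *: f z + a z *: d) =
   A *: (f (z + h) - f z) + A *: f z + (h * k) *: (f (z + h) - f z) + a z *: F.
  by rewrite /A /F -[h *: k]/(h * k); lmodule R[i] X.
have := vnormD (A *: (f (z + h) - f z) + A *: f z + (h * k) *: (f (z + h) - f z)) (a z *: F).
have := vnormD (A *: (f (z + h) - f z) + A *: f z) ((h * k) *: (f (z + h) - f z)).
have := vnormD (A *: (f (z + h) - f z)) (A *: f z).
rewrite !vnormZ cmodM; rewrite vnorm_scal in H1.
have hh := cmod_ge0 h; have hf := vnorm_ge0 (f (z + h) - f z).
move: (cmod h) (cmod A) (vnorm F) (vnorm (f (z + h) - f z)) H1 H2 H3 hh hf (cmod_ge0 A) (vnorm_ge0 F)=> u vA vF w H1 H2 H3 u0 w0 A0 F0 E1 E2 E3.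
have B1 : vA * w <= D * u * 1 by apply: ler_pM => //; lra.
have B2 : vA * vnorm (f z) <= D * u * vnorm (f z) by rewrite ler_wpM2r.
have B3 : u * cmod k * w <= u * cmod k * D by rewrite ler_wpM2l ?mulr_ge0.
have B4 : cmod (a z) * vF <= cmod (a z) * (D * u) by rewrite ler_wpM2l.
have : D * (m + 1) * u <= e * u by rewrite ler_wpM2r.
by rewrite /m; lra.
Qed.

Lemma cder_comp (X : normedModType R[i]) (g : C -> V) (f : C -> X) z k d :
  cder g z k -> cder f (g z) d -> cder (fun w => f (g w)) z (k *: d).
Proof.
move=> Hg Hf e e0.
have Cg := cdiff_cont (ex_intro _ _ Hg).
have k0 := cmod_ge0 k; have dd0 := vnorm_ge0 d.
pose D := Num.min 1 (e / (cmod k + vnorm d + 1)).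
have m0 : 0 < cmod k + vnorm d + 1 by lra.
have d0 : 0 < D by rewrite lt_min ltr01 divr_gt0.
have d1 : D <= 1 by rewrite ge_min lexx.
have de : D * (cmod k + vnorm d + 1) <= e by rewrite -ler_pdivlMr// ge_min lexx orbT.
have [eta eta0 He] := Hf _ d0.
have eta2 : 0 < eta / 2 by lra.
have := near0_and (Hg _ d0) (Cg _ eta2); apply: near0_imp => h [H1 H2].
set gh := g (z + h) - g z in H2.
have {H2}/He : cmod gh < eta by rewrite -vnorm_scal; apply: le_lt_trans H2 _; lra.
rewrite (_ : g z + gh = g (z + h)); last by rewrite /gh addrC subrK.
move=> H2.
rewrite (_ : _ - _ = (f (g (z + h)) - f (g z) - gh *: d) + (gh - h *: k) *: d); last first.
  by rewrite -[h *: k]/(h * k); lmodule R[i] X.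
have := vnormD (f (g (z + h)) - f (g z) - gh *: d) ((gh - h *: k) *: d).
rewrite vnormZ; rewrite vnorm_scal -/gh in H1.
have : cmod gh <= cmod (gh - h *: k) + cmod h * cmod k.
  by rewrite -cmodM; apply: le_trans (cmodD _ _); rewrite /GRing.scale /= subrK.
have := cmod_ge0 h; have := cmod_ge0 (gh - h *: k).
move: (cmod gh) (cmod (gh - h *: k)) (cmod h) (vnorm (f (g (z + h)) - f (g z) - gh *: d)) H1 H2.
move=> a b u v H1 H2 b0 u0 E1 E2.
have B1 : D * a <= D * (D * u + u * cmod k) by apply: ler_wpM2l; [exact: ltW|lra].
have B2 : b * vnorm d <= D * u * vnorm d by rewrite ler_wpM2r.
have B3 : D * D * u <= D * 1 * u by rewrite ler_wpM2r// ler_wpM2l// ltW.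
have : D * (cmod k + vnorm d + 1) * u <= e * u by rewrite ler_wpM2r.
by lra.
Qed.

Lemma cder_id z : @cder V id z 1.
Proof.
move=> e e0; exists 1 => // h _; rewrite /GRing.scale /= mulr1.
rewrite (_ : _ - _ = 0); last by rewrite /=; ring.
by rewrite vnorm0 mulr_ge0 ?cmod_ge0 ?ltW.
Qed.

Lemma cder_inv (z : C) : z != 0 -> @cder V (fun w => w^-1) z (- (z^-1 ^+ 2)).
Proof.
move=> z0 e e0; have m0 : 0 < cmod z by rewrite cmod_gt0.
have m2 : 0 < cmod z / 2 by lra.
have m3 : 0 < e * (cmod z) ^+ 3 / 2 by rewrite !mulr_gt0 ?exprn_gt0 ?invr_gt0.
have := near0_and (near0_small m2) (near0_small m3).
apply: near0_imp => h [h1 h2].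
have zh : cmod z / 2 <= cmod (z + h) by have := cmod_lbD z h; lra.
have zh0 : z + h != 0 by rewrite -cmod_gt0; lra.
rewrite (_ : _ - _ = h ^+ 2 / ((z + h) * z ^+ 2)); last first.
  by rewrite /GRing.scale /=; field; apply/andP.
rewrite vnorm_scal (cmodf (h ^+ 2)) (cmodM (z + h)) !cmodX.
have zp : 0 < cmod (z + h) by lra.
rewrite ler_pdivrMr ?mulr_gt0 ?exprn_gt0// expr2.
have hh := cmod_ge0 h.
rewrite -subr_ge0 (_ : _ - _ = cmod h * (e * (cmod (z + h) * cmod z ^+ 2) - cmod h)); last by ring.
rewrite mulr_ge0// subr_ge0 (le_trans (ltW h2))//.
rewrite -mulrA ler_pM2l// exprS mulrAC ler_wpM2r ?exprn_ge0 ?cmod_ge0//.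
Qed.

Lemma cdiff_cst (X : normedModType R[i]) (x : X) z : cdiff (fun=> x) z.
Proof. by exists 0; exact: cder_cst. Qed.
Lemma cdiff_id z : @cdiff V id z.
Proof. by exists 1; exact: cder_id. Qed.
Lemma cdiffD (X : normedModType R[i]) (f g : C -> X) z : cdiff f z -> cdiff g z -> cdiff (fun w => f w + g w) z.
Proof. by move=> [d Hd] [k Hk]; exists (d + k); exact: cderD. Qed.
Lemma cdiffZ (X : normedModType R[i]) a (f : C -> X) z : cdiff f z -> cdiff (fun w => a *: f w) z.
Proof. by move=> [d Hd]; exists (a *: d); exact: cderZ. Qed.
Lemma cdiffN (X : normedModType R[i]) (f : C -> X) z : cdiff f z -> cdiff (fun w => - f w) z.
Proof. by move=> /(cdiffZ (-1)); apply: cdiff_ext; exists 1 => // h _; rewrite scaleN1r. Qed.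
Lemma cdiffB (X : normedModType R[i]) (f g : C -> X) z : cdiff f z -> cdiff g z -> cdiff (fun w => f w - g w) z.
Proof. by move=> ? /cdiffN; exact: cdiffD. Qed.
Lemma cdiffM (X : normedModType R[i]) (a : C -> V) (f : C -> X) z : cdiff a z -> cdiff f z -> cdiff (fun w => a w *: f w) z.
Proof. by move=> [d Hd] [k Hk]; exists (d *: f z + a z *: k); exact: cderM. Qed.
Lemma cdiffMs (a f : C -> V) z : cdiff a z -> cdiff f z -> @cdiff V (fun w => a w * f w) z.
Proof. exact: cdiffM. Qed.
Lemma cdiff_comp (X : normedModType R[i]) (g : C -> V) (f : C -> X) z : cdiff g z -> cdiff f (g z) -> cdiff (fun w => f (g w)) z.
Proof. by move=> [d Hd] [k Hk]; exists (d *: k); exact: cder_comp. Qed.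
Lemma cdiffV (g : C -> V) z : cdiff g z -> g z != 0 -> @cdiff V (fun w => (g w)^-1) z.
Proof.
move=> [d Hd] g0; exists (d *: (- ((g z)^-1 ^+ 2))).
exact: (cder_comp Hd (cder_inv g0)).
Qed.
Lemma cdiff_div (f g : C -> V) z : cdiff f z -> cdiff g z -> g z != 0 -> @cdiff V (fun w => f w / g w) z.
Proof. by move=> ? ? ?; apply: cdiffMs => //; exact: cdiffV. Qed.
Lemma cdiffX (f : C -> V) n z : cdiff f z -> @cdiff V (fun w => f w ^+ n) z.
Proof.
move=> Hf; elim: n => [|n IH]; first exact: cdiff_cst.
by apply: (@cdiff_ext _ (fun w => f w * f w ^+ n)); [exists 1 => // h _; rewrite exprS|exact: cdiffMs].
Qed.
Lemma cdiff_sum (X : normedModType R[i]) (I : Type) (r : seq I) (F : I -> C -> X) z :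
  (forall i, cdiff (F i) z) -> cdiff (fun w => \sum_(i <- r) F i w) z.
Proof.
move=> H; elim: r => [|i r IH].
  by apply: (@cdiff_ext _ (fun=> 0)); [exists 1 => // h _; rewrite big_nil|exact: cdiff_cst].
apply: (@cdiff_ext _ (fun w => F i w + \sum_(i <- r) F i w)); last exact: cdiffD.
by exists 1 => // h _; rewrite big_cons.
Qed.
Lemma cdiff_prod (I : Type) (r : seq I) (P : pred I) (F : I -> C -> V) z :
  (forall i, P i -> cdiff (F i) z) -> @cdiff V (fun w => \prod_(i <- r | P i) F i w) z.
Proof.
move=> H; elim: r => [|i r IH].
  by apply: (@cdiff_ext V (fun=> 1)); [exists 1 => // h _; rewrite big_nil|exact: cdiff_cst].
case Pi : (P i).
  apply: (@cdiff_ext V (fun w => F i w * \prod_(i <- r | P i) F i w)); last by apply: cdiffMs => //; exact: H.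
  by exists 1 => // h _; rewrite big_cons Pi.
by apply: cdiff_ext IH; exists 1 => // h _; rewrite big_cons Pi.
Qed.

Lemma ccont_comp (X : normedModType R[i]) (g : C -> V) (f : C -> X) z : ccont g z -> ccont f (g z) -> ccont (fun w => f (g w)) z.
Proof.
move=> Hg Hf e e0; have [d d0 H] := Hf _ e0.
have d2 : 0 < d / 2 by lra.
apply: near0_imp (Hg _ d2) => h Hh.
have := H (g (z + h) - g z); rewrite [g z + _]addrC subrK; apply.
by rewrite -vnorm_scal; lra.
Qed.

Lemma ccontM (X : normedModType R[i]) (a : C -> V) (f : C -> X) z :
  ccont a z -> ccont f z -> ccont (fun w => a w *: f w) z.
Proof.
move=> Ha Hf e e0; have k0 := cmod_ge0 (a z); have l0 := vnorm_ge0 (f z).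
pose d := Num.min 1 (e / (cmod (a z) + vnorm (f z) + 1)).
have D0 : 0 < cmod (a z) + vnorm (f z) + 1 by lra.
have d0 : 0 < d by rewrite lt_min ltr01 divr_gt0.
have d1 : d <= 1 by rewrite ge_min lexx.
have de : d * (cmod (a z) + vnorm (f z) + 1) <= e.
  by rewrite -ler_pdivlMr// ge_min lexx orbT.
have := near0_and (Ha _ d0) (Hf _ d0); apply: near0_imp => h [A B].
set k := a z; set l := f z; set an := a _; set un := f (z + h).
have -> : an *: un - k *: l = (an - k) *: (un - l) + k *: (un - l) + (an - k) *: l.
  by rewrite -scalerDl subrK scalerBr scalerBl addrA subrK.
have := vnormD ((an - k) *: (un - l) + k *: (un - l)) ((an - k) *: l).
have := vnormD ((an - k) *: (un - l)) (k *: (un - l)).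
rewrite !vnormZ; have := cmod_ge0 (an - k); have := vnorm_ge0 (un - l).
rewrite vnorm_scal in A; rewrite -/k -/l -/an -/un in A B de D0 k0 l0 *; nra.
Qed.

End Cder.

(** * Cauchy's theorem and circle means *)

Section Bisection.
Variables (R : realType).
Local Notation C := R[i].
Implicit Types (p : C) (a b t u : R).

Definition rpoint p a b t u : C := p + (t * a)%:C + 'i * (u * b)%:C.

(* Cousin's principle: a property that passes from the four quarters of a
   rectangle to the rectangle and holds for all small rectangles around each
   point holds for the whole rectangle. *)
Lemma bisection (P : C -> R -> R -> Prop) p0 a0 b0 :
  0 <= a0 -> 0 <= b0 ->
  (forall p a b, 0 <= a -> 0 <= b -> (0 < a0 -> 0 < a) -> (0 < b0 -> 0 < b) ->
     P p (a / 2) (b / 2) -> P (p + (a / 2)%:C) (a / 2) (b / 2) ->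
     P (p + 'i * (b / 2)%:C) (a / 2) (b / 2) ->
     P (p + (a / 2)%:C + 'i * (b / 2)%:C) (a / 2) (b / 2) -> P p a b) ->
  (forall t u, 0 <= t <= 1 -> 0 <= u <= 1 -> exists2 eta, 0 < eta &
     forall p a b s v, 0 <= a <= eta -> 0 <= b <= eta ->
      (0 < a0 -> 0 < a) -> (0 < b0 -> 0 < b) ->
      0 <= s <= 1 -> 0 <= v <= 1 ->
      rpoint p a b s v = rpoint p0 a0 b0 t u ->
      (forall s' v', 0 <= s' <= 1 -> 0 <= v' <= 1 -> exists t' u',
         [/\ 0 <= t' <= 1, 0 <= u' <= 1 & rpoint p a b s' v' = rpoint p0 a0 b0 t' u']) ->
      P p a b) ->
  P p0 a0 b0.
Proof.
move=> a00 b00 Hs Hl; apply: contrapT => nP.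
pose cell n (x y : R) := rpoint p0 a0 b0 x y.
pose sz n : R := (2 ^+ n)^-1.
have sz0 n : 0 < sz n by rewrite invr_gt0 exprn_gt0.
have szS n : sz n.+1 = sz n / 2 by rewrite /sz exprS invfM mulrC.
(* [q] holds the relative coordinates, in the original rectangle, of the corner of a dyadic cell of
   relative size [sz n] on which [P] fails. The nested bad cells shrink to a point, where the local
   hypothesis is contradicted. *)
pose bad n (q : R * R) := [/\ 0 <= q.1, q.1 + sz n <= 1, 0 <= q.2, q.2 + sz n <= 1 &
  ~ P (rpoint p0 a0 b0 q.1 q.2) (a0 * sz n) (b0 * sz n)].
have step n q : bad n q -> { q' | bad n.+1 q' /\ (q.1 <= q'.1 <= q.1 + sz n.+1) /\ (q.2 <= q'.2 <= q.2 + sz n.+1)}.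
  case: q => x y [/= x0 x1 y0 y1 nPq]; apply: cid; apply: contrapT => Hn.
  apply: nPq; have s0 := sz0 n; have s1 := sz0 n.+1; have ss := szS n.
  have e1 : a0 * sz n / 2 = a0 * sz n.+1 by rewrite ss mulrA.
  have e2 : b0 * sz n / 2 = b0 * sz n.+1 by rewrite ss mulrA.
  have aux x' y' p : p = rpoint p0 a0 b0 x' y' -> x <= x' <= x + sz n.+1 -> y <= y' <= y + sz n.+1 ->
     P p (a0 * sz n / 2) (b0 * sz n / 2).
    move=> -> hx hy; rewrite e1 e2; apply: contrapT => H; apply: Hn.
    case/andP: (hx) => ? ?; case/andP: (hy) => ? ?.
    by exists (x', y'); split; [clear - x0 x1 y0 y1 s1 ss hx hy H; split => //=; lra|split].
  have s1' := ltW s1.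
  apply: Hs; rewrite ?mulr_ge0 ?(ltW s0)//; try by move=> ?; rewrite mulr_gt0.
  - by apply: (aux x y) => //; rewrite lexx /= lerDl s1'.
  - apply: (aux (x + sz n.+1) y); rewrite ?lexx ?lerDl ?s1' //=.
    by rewrite e1 /rpoint !(rmorphD, rmorphM) /=; ring.
  - apply: (aux x (y + sz n.+1)); rewrite ?lexx ?lerDl ?s1' //=.
    by rewrite e2 /rpoint !(rmorphD, rmorphM) /=; ring.
  - apply: (aux (x + sz n.+1) (y + sz n.+1)); rewrite ?lexx ?lerDl ?s1' //=.
    by rewrite e1 e2 /rpoint !(rmorphD, rmorphM) /=; ring.
have bad0 : bad 0%N (0, 0).
  rewrite /bad /sz /= expr0 invr1 !mulr1 add0r /rpoint !mul0r mulr0 !addr0.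
  by split.
pose Q := fix Q n : { q | bad n q} := match n with
   | 0%N => exist _ (0, 0) bad0
   | n'.+1 => let: exist q Hq := Q n' in let: exist q' Hq' := step n' q Hq in exist _ q' Hq'.1
   end.
pose X n := (sval (Q n)).1; pose Y n := (sval (Q n)).2.
have XYS n : (X n <= X n.+1 <= X n + sz n.+1) /\ (Y n <= Y n.+1 <= Y n + sz n.+1).
  by rewrite /X /Y /=; case: (Q n) => q Hq /=; case: (step n q Hq) => q' [? []] /=.
have Xm n m : X n <= X (n + m)%N <= X n + sz n - sz (n + m)%N.
  elim: m => [|m IH]; first by rewrite addn0; lra.
  rewrite addnS; have [/andP[A B] _] := XYS (n + m)%N; have := szS (n + m)%N; lra.
have Ym n m : Y n <= Y (n + m)%N <= Y n + sz n - sz (n + m)%N.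
  elim: m => [|m IH]; first by rewrite addn0; lra.
  rewrite addnS; have [_ /andP[A B]] := XYS (n + m)%N; have := szS (n + m)%N; lra.
have lim1 (Z : nat -> R) : (forall n m, Z n <= Z (n + m)%N <= Z n + sz n - sz (n + m)%N) ->
    exists l, forall n, Z n <= l <= Z n + sz n.
  move=> H; pose S := [set Z n | n in setT].
  have hs n : has_sup S /\ (sup S <= Z n + sz n).
    have ub : ubound S (Z n + sz n).
      move=> _ [m _ <-]; have [nm|mn] := leqP n m.
        by have := H n (m - n)%N; rewrite subnKC//; have := sz0 m; lra.
      by have := H m (n - m)%N; rewrite subnKC ?(ltnW mn)//; have := sz0 n; lra.
    have ne : S !=set0 by exists (Z 0%N); exists 0%N.
    by split; [split => //; exists (Z n + sz n)|apply: ge_sup].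
  exists (sup S) => n; rewrite (hs n).2 andbT; apply: ub_le_sup; first by case: (hs n) => -[].
  by exists n.
have [lx Hx] := lim1 _ Xm; have [ly Hy] := lim1 _ Ym.
have sz00 : sz 0%N = 1 by rewrite /sz expr0 invr1.
have X0 : X 0%N = 0 by []. have Y0 : Y 0%N = 0 by [].
have [||eta eta0 He] := Hl lx ly.
  by have := Hx 0%N; rewrite X0 sz00 add0r.
  by have := Hy 0%N; rewrite Y0 sz00 add0r.
have small : exists n, (a0 + b0) * sz n <= eta.
  have [n Hn] : exists n : nat, (a0 + b0) / eta < n%:R.
    by exists (Num.truncn ((a0 + b0) / eta)).+1; rewrite truncnS_gt.
  exists n; rewrite /sz ler_pdivrMr ?exprn_gt0// mulrC -ler_pdivrMr//.
  apply: le_trans (ltW Hn) _; rewrite -natrX ler_nat ltnW// ltn_expl//.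
have [n Hn] := small.
have s0 := sz0 n.
have [x0 x1 y0 y1] := svalP (Q n); rewrite -/(X n) -/(Y n) in x0 x1 y0 y1 *; case.
have rE s v : rpoint (rpoint p0 a0 b0 (X n) (Y n)) (a0 * sz n) (b0 * sz n) s v =
    rpoint p0 a0 b0 (X n + s * sz n) (Y n + v * sz n).
  by rewrite /rpoint !rmorphM !rmorphD !rmorphM /=; ring.
have A0 : 0 <= a0 * sz n by rewrite mulr_ge0// ltW.
have B0 : 0 <= b0 * sz n by rewrite mulr_ge0// ltW.
have div01 z x : x <= z <= x + sz n -> 0 <= (z - x) / sz n <= 1.
  by move=> h; rewrite divr_ge0 ?ler_pdivrMr// ?mul1r; clear - h s0; lra.
apply: (He _ _ _ ((lx - X n) / sz n) ((ly - Y n) / sz n)).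
- by rewrite A0 /=; clear - Hn B0; lra.
- by rewrite B0 /=; clear - Hn A0; lra.
- by move=> ?; rewrite mulr_gt0.
- by move=> ?; rewrite mulr_gt0.
- exact: div01.
- exact: div01.
- by rewrite rE !divfK ?gt_eqF// ![_ + (_ - _)]addrC !subrK.
move=> s v hs hv; exists (X n + s * sz n), (Y n + v * sz n); rewrite rE.
have sc x : 0 <= x <= 1 -> 0 <= x * sz n <= sz n.
  by move=> /andP[? ?]; rewrite mulr_ge0 ?(ltW s0)//= ler_piMl// ltW.
have := sc _ hs; have := sc _ hv.
by clear - x0 x1 y0 y1 rE; split => //; lra.
Qed.

End Bisection.

(** * Trapezoidal sums and Goursat's theorem *)

Section Trapezoids.
Variables (R : realType).
Local Notation C := R[i].
Notation V := (R[i])^o.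

Lemma halfC (a : R) : (a / 2)%:C = a%:C / 2 :> C.
Proof. by rewrite rmorphM fmorphV /= rmorph_nat. Qed.

Lemma cmod_half (v : C) : cmod (v / 2) = cmod v / 2.
Proof. by rewrite cmodf -[2 in LHS](rmorph_nat (real_complex R)) cmodRp. Qed.

Section Generic.
Variable X : normedModType R[i].
Implicit Types (f g : C -> X).

(** The trapezoidal rule with [2 ^ n] pieces for the mean of [g] over the segment from [p] to
    [p + v]. The recursion by halving matches the subdivision of rectangles: level [n.+1] on a
    segment is level [n] on its halves. *)
Fixpoint trap n (g : C -> X) (p v : C) : X :=
  if n is n'.+1 then 2^-1 *: (trap n' g p (v / 2) + trap n' g (p + v / 2) (v / 2))
  else 2^-1 *: (g p + g (p + v)).

Lemma seg_left (t : R) (p v : C) : p + t%:C * (v / 2) = p + (t / 2)%:C * v.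
Proof. by rewrite halfC; ring. Qed.

Lemma seg_right (t : R) (p v : C) : p + v / 2 + t%:C * (v / 2) = p + ((1 + t) / 2)%:C * v.
Proof. by rewrite halfC rmorphD /=; ring. Qed.

Lemma trap_ext n f g p v :
  (forall t, 0 <= t <= 1 -> f (p + t%:C * v) = g (p + t%:C * v)) -> trap n f p v = trap n g p v.
Proof.
elim: n p v => [|n IH] p v H /=.
  have := H 0; have := H 1; rewrite !rmorph0 !rmorph1 mul0r mul1r addr0.
  by move=> -> //; [move=> -> //|]; rewrite ?lexx ler01.
congr (_ *: (_ + _)); apply: IH => t t01.
  by rewrite seg_left; apply: H; lra.
by rewrite seg_right; apply: H; lra.
Qed.

Lemma trap_shift n f q p v : trap n (fun w => f (w + q)) p v = trap n f (p + q) v.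
Proof.
elim: n p v => [|n IH] p v /=; first by rewrite [p + v + q]addrAC.
by rewrite (IH p) (IH (p + v / 2)) [p + v / 2 + q]addrAC.
Qed.

Lemma trapD n f g p v : trap n (fun w => f w + g w) p v = trap n f p v + trap n g p v.
Proof.
elim: n p v => [|n IH] p v /=; first by rewrite -scalerDr addrACA.
by rewrite !IH -scalerDr addrACA.
Qed.

Lemma trapZ n (a : C) f p v : trap n (fun w => a *: f w) p v = a *: trap n f p v.
Proof.
elim: n p v => [|n IH] p v /=; first by rewrite -scalerDr !scalerA mulrC.
by rewrite !IH -scalerDr !scalerA mulrC.
Qed.

Lemma trapB n f g p v : trap n (fun w => f w - g w) p v = trap n f p v - trap n g p v.
Proof.
rewrite -scaleN1r -trapZ -trapD; apply: trap_ext => t _; by rewrite scaleN1r.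
Qed.

Lemma half_half (x : X) : 2^-1 *: (x + x) = x.
Proof. by lmodule R[i] X; field. Qed.

Lemma trap_cst n (x : X) p v : trap n (fun=> x) p v = x.
Proof. by elim: n p v => [|n IH] p v /=; rewrite ?IH half_half. Qed.

Lemma trap_le n f p v (B : R) :
  (forall t, 0 <= t <= 1 -> vnorm (f (p + t%:C * v)) <= B) -> vnorm (trap n f p v) <= B.
Proof.
have aux (x y : X) : vnorm x <= B -> vnorm y <= B -> vnorm (2^-1 *: (x + y)) <= B.
  move=> hx hy; rewrite vnormZ -[2^-1]mul1r cmod_half cmod1.
  by have := vnormD x y; lra.
elim: n p v => [|n IH] p v H /=.
  apply: aux; first by have := H 0; rewrite rmorph0 mul0r addr0; apply; rewrite lexx ler01.
  by have := H 1; rewrite rmorph1 mul1r; apply; rewrite lexx ler01.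
apply: aux; apply: IH => t t01.
  by rewrite seg_left; apply: H; lra.
by rewrite seg_right; apply: H; lra.
Qed.

Lemma trap_sum n (I : Type) (r : seq I) (F : I -> C -> X) p v :
  trap n (fun w => \sum_(i <- r) F i w) p v = \sum_(i <- r) trap n (F i) p v.
Proof.
elim: r => [|i r IH].
  by rewrite big_nil -[RHS](trap_cst n 0 p v); apply: trap_ext => t _; rewrite big_nil.
by rewrite big_cons -IH -trapD; apply: trap_ext => t _; rewrite big_cons.
Qed.

End Generic.

Lemma trap_scal (X : normedModType R[i]) n (a : C -> V) (x : X) p v :
  trap n (fun w => a w *: x) p v = (trap n a p v : C) *: x.
Proof.
elim: n p v => [|n IH] p v /=; rewrite ?IH -scalerDl scalerA //.
Qed.

Lemma trap_id n p v : trap n (id : C -> V) p v = p + v / 2.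
Proof.
elim: n p v => [|n IH] p v /=; rewrite ?IH /GRing.scale /=; by field.
Qed.

Section Goursat.
Variable X : normedModType R[i].
Implicit Types (f g : C -> X) (p : C) (a b : R).

(** The discrete contour integral of [g] around the rectangle with corner [p] and sides [a], [b]:
    bottom minus top, right minus left. *)
Definition rsum n g p a b : X :=
  a%:C *: (trap n g p a%:C - trap n g (p + 'i * b%:C) a%:C) +
  ('i * b%:C) *: (trap n g (p + a%:C) ('i * b%:C) - trap n g p ('i * b%:C)).

(** The inner edges of the four quarters cancel in pairs. Once the base points are brought to a
    common form, the identity is linear in the values of [G]. *)
Lemma quarters (G : C -> C -> X) (p h k : C) :
  (h + h) *: (2^-1 *: (G p h + G (p + h) h) - 2^-1 *: (G (p + (k + k)) h + G (p + (k + k) + h) h)) +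
  (k + k) *: (2^-1 *: (G (p + (h + h)) k + G (p + (h + h) + k) k) - 2^-1 *: (G p k + G (p + k) k)) =
  h *: (G p h - G (p + k) h) + k *: (G (p + h) k - G p k) +
  (h *: (G (p + h) h - G (p + h + k) h) + k *: (G (p + h + h) k - G (p + h) k)) +
  (h *: (G (p + k) h - G (p + k + k) h) + k *: (G (p + k + h) k - G (p + k) k)) +
  (h *: (G (p + h + k) h - G (p + h + k + k) h) + k *: (G (p + h + k + h) k - G (p + h + k) k)).
Proof.
rewrite !addrA [p + k + h]addrAC [p + k + k + h]addrAC [p + k + h]addrAC [p + h + k + h]addrAC.
set t1 := G p h; set t2 := G (p + h) h; set t3 := G (p + k + k) h.
by lmodule R[i] X; field.
Qed.

Lemma rsumS n g p a b : rsum n.+1 g p a b =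
  rsum n g p (a / 2) (b / 2) + rsum n g (p + (a / 2)%:C) (a / 2) (b / 2) +
  rsum n g (p + 'i * (b / 2)%:C) (a / 2) (b / 2) +
  rsum n g (p + (a / 2)%:C + 'i * (b / 2)%:C) (a / 2) (b / 2).
Proof.
have iE : 'i * b%:C / 2 = 'i * (b / 2)%:C :> C by rewrite halfC mulrA.
have aE : a%:C = (a / 2)%:C + (a / 2)%:C :> C by rewrite -rmorphD /= -splitr.
have bE : 'i * b%:C = 'i * (b / 2)%:C + 'i * (b / 2)%:C :> C by rewrite -mulrDr -rmorphD /= -splitr.
by rewrite /rsum /= iE -halfC aE bE; exact: (quarters (trap n g)).
Qed.

Lemma rsumD n f g p a b : rsum n (fun w => f w + g w) p a b = rsum n f p a b + rsum n g p a b.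
Proof. by rewrite /rsum !trapD; lmodule R[i] X. Qed.

(** The trapezoidal rule is exact on affine functions, so in Goursat's argument the first-order part
    drops out at every level [n], not only in the limit. *)
Lemma rsum_affine n (x d : X) q p a b : rsum n (fun w => x + (w - q) *: d) p a b = 0.
Proof.
have E p' v : trap n (fun w => x + (w - q) *: d) p' v = x + (p' + v / 2 - q) *: d.
  rewrite trapD trap_cst; congr (_ + _).
  rewrite (trap_scal n (fun w : C => (w - q) : V) d).
  by rewrite (trapB n (id : C -> V) (fun=> q)) trap_cst trap_id.
rewrite /rsum !E; have i2 := sqr_i R; by lmodule R[i] X.
Qed.

Lemma rsum_le n f p a b (B : R) : 0 <= a -> 0 <= b ->
  (forall t u, 0 <= t <= 1 -> 0 <= u <= 1 -> vnorm (f (rpoint p a b t u)) <= B) ->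
  vnorm (rsum n f p a b) <= 2 * (a + b) * B.
Proof.
move=> a0 b0 H.
have z01 : 0 <= (0 : R) <= 1 by rewrite lexx ler01.
have o01 : 0 <= (1 : R) <= 1 by rewrite lexx ler01.
have i1 : cmod ('i * b%:C) = b.
  by rewrite cmodM cmodRp// /cmod /= expr0n expr1n add0r sqrtr1 mul1r.
have H1 : vnorm (trap n f p a%:C) <= B.
  apply: trap_le => t t01; have := H t 0 t01 z01; rewrite /rpoint mul0r rmorph0 mulr0 addr0.
  by rewrite rmorphM.
have H2 : vnorm (trap n f (p + 'i * b%:C) a%:C) <= B.
  apply: trap_le => t t01; have := H t 1 t01 o01; rewrite /rpoint mul1r.
  by rewrite rmorphM addrAC.
have H3 : vnorm (trap n f (p + a%:C) ('i * b%:C)) <= B.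
  apply: trap_le => t t01; have := H 1 t o01 t01; rewrite /rpoint mul1r.
  by rewrite rmorphM mulrCA.
have H4 : vnorm (trap n f p ('i * b%:C)) <= B.
  apply: trap_le => t t01; have := H 0 t z01 t01; rewrite /rpoint mul0r rmorph0 addr0.
  by rewrite rmorphM mulrCA.
rewrite /rsum; apply: le_trans (vnormD _ _) _; rewrite !vnormZ i1 cmodRp//.
have := vnormB (trap n f p a%:C) (trap n f (p + 'i * b%:C) a%:C).
have := vnormB (trap n f (p + a%:C) ('i * b%:C)) (trap n f p ('i * b%:C)).
set u := vnorm (_ - _); set v := vnorm (_ - _) => E1 E2.
have : a * v <= a * (2 * B) by rewrite ler_wpM2l//; lra.
have : b * u <= b * (2 * B) by rewrite ler_wpM2l//; lra.
by lra.
Qed.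

(** A weight for the meeting of [[x, x + a]] with the point [c]: 1 at an end point, 2 in the
    interior. These values make it additive under halving, also when [c] is the midpoint. *)
Definition touch (c x a : R) : R :=
  ((x <= c) && (c <= x + a))%:R + ((x < c) && (c < x + a))%:R.

Lemma touch_split c x a : 0 < a -> touch c x a = touch c x (a / 2) + touch c (x + a / 2) (a / 2).
Proof.
move=> a0; rewrite /touch (_ : x + a / 2 + a / 2 = x + a); last by lra.
have [h1|h1|h1] := ltgtP x c; have [h2|h2|h2] := ltgtP c (x + a);
  have [h3|h3|h3] := ltgtP c (x + a / 2); rewrite /=; lra.
Qed.

Lemma touch_bound c x a : 0 <= touch c x a <= 2.
Proof. by rewrite /touch; case: ((x <= c) && _); case: ((x < c) && _) => /=; lra. Qed.

Lemma rpoint_dist p a b t u s v : 0 <= a -> 0 <= b -> 0 <= t <= 1 -> 0 <= u <= 1 ->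
  0 <= s <= 1 -> 0 <= v <= 1 -> cmod (rpoint p a b t u - rpoint p a b s v) <= a + b.
Proof.
move=> a0 b0 ht hu hs hv.
rewrite (_ : _ - _ = ((t - s) * a)%:C + 'i * ((u - v) * b)%:C); last first.
  by rewrite /rpoint !(rmorphM, rmorphB) /=; ring.
apply: le_trans (cmodD _ _) _; rewrite cmodM !cmodR (_ : cmod 'i = 1) ?mul1r; last first.
  by rewrite /cmod /= expr0n expr1n add0r sqrtr1.
rewrite !normrM (ger0_norm a0) (ger0_norm b0) lerD// ler_piMl// ler_norml; lra.
Qed.

(** On the line [Re = c] only continuity is assumed. A small cell off the line has an error of the
    order of its area, a cell meeting the line one of the order of its perimeter. The bound in [P]
    charges the former to [e * (a + b) ^+ 2] and the latter to [e * (a + b) * touch]; both terms add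
    up exactly when the rectangle is quartered. *)
Lemma goursat g p a b c : 0 < a -> 0 < b ->
  (forall t u, 0 <= t <= 1 -> 0 <= u <= 1 -> complex.Re (rpoint p a b t u) != c ->
    cdiff g (rpoint p a b t u)) ->
  (forall t u, 0 <= t <= 1 -> 0 <= u <= 1 -> complex.Re (rpoint p a b t u) = c ->
    ccont g (rpoint p a b t u)) ->
  vlim (fun n => rsum n g p a b) 0.
Proof.
move=> a0 b0 Hd Hc.
pose P e p a b := exists N, forall n, (N <= n)%N ->
  vnorm (rsum n g p a b) <= e * (a + b) ^+ 2 + e * (a + b) * touch c (complex.Re p) a.
suff H e : 0 < e -> P e p a b.
  move=> e e0; have s0 : 0 < (a + b) ^+ 2 + (a + b) * 2 by nra.
  have [N HN] := H _ (divr_gt0 e0 s0); exists N => n /HN; rewrite subr0 => /le_trans; apply.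
  have /andP[t1 t2] := touch_bound c (complex.Re p) a.
  rewrite -mulrA -mulrDr mulrAC ler_pdivrMr// ler_pM2l// lerD2l ler_pM2l//; lra.
move=> e0; apply: bisection; rewrite ?ltW//.
  move=> q x y x0 y0 /(_ a0) x0' /(_ b0) y0' [N1 H1] [N2 H2] [N3 H3] [N4 H4].
  exists (maxn (maxn N1 N2) (maxn N3 N4)).+1 => -[//|n]; rewrite ltnS !geq_max.
  move=> /andP[/andP[/H1 {}H1 /H2 {}H2] /andP[/H3 {}H3 /H4 {}H4]].
  have rE1 (z : C) (t : R) : complex.Re (z + t%:C) = complex.Re z + t by case: z.
  have rE2 (z : C) (t : R) : complex.Re (z + 'i * t%:C) = complex.Re z by case: z => ? ? /=; ring.
  rewrite !(rE1, rE2) in H1 H2 H3 H4.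
  rewrite rsumS; set r1 := rsum n g q _ _ in H1 *.
  set r2 := rsum n g _ _ _ in H2 *; set r3 := rsum n g _ _ _ in H3 *.
  set r4 := rsum n g _ _ _ in H4 *.
  have := vnormD (r1 + r2 + r3) r4; have := vnormD (r1 + r2) r3; have := vnormD r1 r2.
  rewrite (touch_split _ _ x0'); move: H1 H2 H3 H4.
  set T1 := touch _ _ _; set T2 := touch _ _ _; rewrite !expr2 => *.
  by lra.
move=> t u t01 u01.
have [Re_c|Re_c] := eqVneq (complex.Re (rpoint p a b t u)) c.
  have e2 : 0 < e / 2 by lra.
  have [eta eta0 He] := Hc t u t01 u01 Re_c _ e2.
  exists (eta / 4); first by lra.
  move=> q x y s v hx hy /(_ a0) x0 /(_ b0) y0 s01 v01 Eq _.
  set z := rpoint p a b t u in He Re_c Eq.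
  exists 0%N => n _.
  have T1 : 1 <= touch c (complex.Re q) x.
    have cE : c = complex.Re q + s * x.
      by rewrite -Re_c -Eq /rpoint; case: (q) => ? ? /=; ring.
    have sx0 : 0 <= s * x by rewrite mulr_ge0//; lra.
    have sx1 : s * x <= x by rewrite ler_piMl//; lra.
    by rewrite /touch {1 2}cE lerDl sx0 lerD2l sx1 /=; case: ((_ < _) && _) => /=; lra.
  have -> : rsum n g q x y = rsum n (fun w => g w - g z) q x y.
    rewrite -[RHS]addr0 -(rsum_affine n (g z) 0 0 q x y) -rsumD; congr (rsum _ _ _ _ _).
    by apply/funext => w; rewrite scaler0 addr0 subrK.
  have : vnorm (rsum n (fun w => g w - g z) q x y) <= 2 * (x + y) * (e / 2).
    apply: rsum_le; try lra.
    move=> t' u' ht hu; set w := rpoint q x y t' u'.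
    have D : cmod (w - z) <= x + y by rewrite -Eq; apply: rpoint_dist => //; exact: ltW.
    rewrite -{1}[w](subrK z) [w - z + z]addrC; apply: He.
    by apply: le_lt_trans D _; lra.
  move=> /le_trans; apply; have : e * (x + y) * 1 <= e * (x + y) * touch c (complex.Re q) x.
    by rewrite ler_pM2l// mulr_gt0//; lra.
  have : 0 <= e * (x + y) ^+ 2 by rewrite mulr_ge0 ?sqr_ge0//; lra.
  by lra.
have e2 : 0 < e / 2 by lra.
have [d Hd'] := Hd t u t01 u01 Re_c.
have [eta eta0 He] := Hd' _ e2.
exists (eta / 4); first by lra.
move=> q x y s v hx hy /(_ a0) x0 /(_ b0) y0 s01 v01 Eq _.
set z := rpoint p a b t u in He Re_c Eq.
exists 0%N => n _.
have -> : rsum n g q x y = rsum n (fun w => g w - g z - (w - z) *: d) q x y.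
  rewrite -[RHS]addr0 -(rsum_affine n (g z) d z q x y) -rsumD; congr (rsum _ _ _ _ _).
  by apply/funext => w; lmodule R[i] X.
have : vnorm (rsum n (fun w => g w - g z - (w - z) *: d) q x y) <= 2 * (x + y) * (e / 2 * (x + y)).
  apply: rsum_le; try lra.
  move=> t' u' ht hu; set w := rpoint q x y t' u'.
  have D : cmod (w - z) <= x + y by rewrite -Eq; apply: rpoint_dist => //; exact: ltW.
  rewrite -{1}[w](subrK z) [w - z + z]addrC.
  apply: le_trans (He (w - z) _) _; first by lra.
  by rewrite ler_pM2l.
move=> /le_trans; apply; have /andP[T0 _] := touch_bound c (complex.Re q) x.
have : 0 <= e * (x + y) * touch c (complex.Re q) x by rewrite !mulr_ge0//; lra.
by rewrite expr2; lra.
Qed.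

End Goursat.
End Trapezoids.

(** * The complex exponential *)

Section ComplexExponential.
Variable R : realType.
Local Notation C := R[i].
Notation V := (R[i])^o.

Lemma is_derive_expansion (f : R -> R) (x d : R) : is_derive x (1 : R) f d ->
  forall e, 0 < e -> exists2 eta : R, 0 < eta &
    forall h, `|h| < eta -> `|f (x + h) - f x - h * d| <= e * `|h|.
Proof.
move=> [df <-] e e0; have := df => /cvg_ex[l Hl].
have -> : 'D_1 f x = l by apply/cvg_lim => //; exact: Hl.
have /cvgrPdist_le/(_ e e0) := Hl.
rewrite near_withinE => /nbhs_normP[eta /= eta0 H]; exists eta => // h hh.
have [->|h0] := eqVneq h 0; first by rewrite addr0 subrr mul0r subrr normr0 mulr0.
have /= := H h; rewrite sub0r normrN => /(_ hh h0).
rewrite /GRing.scale /= mulr1 => H1.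
rewrite -[f _ - _ - _]opprB normrN (_ : _ - _ = h * (l - h^-1 * (f (h + x) - f x))).
  by rewrite normrM mulrC ler_wpM2r.
by rewrite mulrBr mulrA divff// mul1r [h + x]addrC.
Qed.

Definition cexp (w : C) : C :=
  (expR (complex.Re w))%:C * (cos (complex.Im w) +i* sin (complex.Im w))%C.

Lemma cexpD w z : cexp (w + z) = cexp w * cexp z.
Proof.
case: w z => x y [s t]; rewrite /cexp /= expRD cosD sinD; simpc.
by apply/eqP; rewrite eq_complex /=; apply/andP; split; apply/eqP; ring.
Qed.

Lemma cexp0 : cexp 0 = 1.
Proof. by rewrite /cexp /= expR0 cos0 sin0; simpc. Qed.

Lemma cmod_cexp w : cmod (cexp w) = expR (complex.Re w).
Proof.
by rewrite /cexp cmodM cmodRp ?expR_ge0// [cmod (_ +i* _)%C]/cmod /= cos2Dsin2 sqrtr1 mulr1.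
Qed.

Lemma cexp_period w : cexp (w + 'i * (2 * pi)%:C) = cexp w.
Proof.
rewrite cexpD (_ : cexp ('i * _) = 1) ?mulr1// /cexp.
rewrite (_ : 'i * (2 * pi)%:C = (0 +i* (2 * pi))%C :> C); last by simpc.
by rewrite /= expR0 mulr_natl cos2pi sin2pi; simpc.
Qed.

Lemma cder_cexp0 : @cder R V cexp 0 1.
Proof.
move=> e e0; pose d := Num.min 1 (e / 8).
have d0 : 0 < d by rewrite lt_min ltr01; lra.
have d1 : d <= 1 by rewrite ge_min lexx.
have d8 : d <= e / 8 by rewrite ge_min lexx orbT.
have [eta1 eta10 H1] := is_derive_expansion (is_derive_expR (0 : R)) d0.
have [eta2 eta20 H2] := is_derive_expansion (is_derive_sin (0 : R)) d0.
have [eta3 eta30 H3] := is_derive_expansion (is_derive_cos (0 : R)) d0.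
have := near0_and (near0_and (near0_small eta10) (near0_small eta20))
  (near0_and (near0_small eta30) (near0_small d0)).
apply: near0_imp => h [[h1 h2] [h3 h4]].
rewrite add0r cexp0 vnorm_scal /GRing.scale /= mulr1.
have [hx hy] := normReIm h; have h0 := cmod_ge0 h.
case: h h1 h2 h3 h4 hx hy h0 => x y.
set H := cmod _ => h1 h2 h3 h4 /= hx hy h0.
have := H1 x; have := H2 y; have := H3 y; rewrite !add0r expR0 cos0 sin0 !subr0 mulr1 oppr0 mulr0 subr0 mulr1.
move=> /(_ (le_lt_trans hy h3)) A3 /(_ (le_lt_trans hy h2)) A2 /(_ (le_lt_trans hx h1)) A1.
apply: le_trans (cmod_ReIm _) _; rewrite /cexp /=.
rewrite !(mul0r, subr0, addr0, add0r, oppr0).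
have B1 : d * `|x| <= d * H by rewrite ler_pM2l.
have B2 : d * `|y| <= d * H by rewrite ler_pM2l.
have cy : `|cos y| <= 1 by rewrite ler_norml cos_geN1 cos_le1.
have C1 : `|(expR x - 1 - x) * cos y| <= d * H.
  by rewrite normrM -[d * H]mulr1 ler_pM//; clear - A1 B1; lra.
have C2 : `|(1 + x) * (cos y - 1)| <= 2 * (d * H).
  rewrite normrM ler_pM//; last by clear - A3 B2; lra.
  by apply: le_trans (ler_normD _ _) _; rewrite normr1; clear - hx h4 d1; lra.
have C3 : `|expR x - 1| <= 2 * H.
  rewrite -[_ - 1](subrK x); apply: le_trans (ler_normD _ _) _.
  have : d * H <= 1 * H by rewrite ler_wpM2r.
  by clear - A1 B1 hx; lra.
have C4 : `|sin y| <= 2 * H.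
  rewrite -[sin y](subrK y); apply: le_trans (ler_normD _ _) _.
  have : d * H <= 1 * H by rewrite ler_wpM2r.
  by clear - A2 B2 hy; lra.
have C5 : `|(expR x - 1) * sin y| <= (2 * H) * (2 * H) by rewrite normrM ler_pM.
have D1 : `|expR x * cos y - 1 - x| <= 3 * (d * H).
  rewrite (_ : _ - _ = (expR x - 1 - x) * cos y + (1 + x) * (cos y - 1)); last by ring.
  by apply: le_trans (ler_normD _ _) _; clear - C1 C2; lra.
have D2 : `|expR x * sin y - y| <= (2 * H) * (2 * H) + d * H.
  rewrite (_ : _ - _ = (expR x - 1) * sin y + (sin y - y)); last by ring.
  by apply: le_trans (ler_normD _ _) _; clear - C5 A2 B2; lra.
have : H * H <= d * H by rewrite ler_wpM2r// ltW.
have : d * H <= e / 8 * H by rewrite ler_wpM2r.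
by clear - D1 D2 h0 e0; lra.
Qed.

Lemma cdiff_cexp w : @cdiff R V cexp w.
Proof.
apply: (@cdiff_ext _ V (fun z => cexp w * cexp (z - w))).
  by exists 1 => // h _; rewrite -cexpD addrC subrK.
apply: cdiffMs; first exact: cdiff_cst.
apply: (@cdiff_comp _ V (fun z => z - w) cexp).
  by apply: cdiffB; [exact: cdiff_id|exact: cdiff_cst].
by rewrite subrr; exists 1; exact: cder_cexp0.
Qed.

End ComplexExponential.

(** * Circle means and the mean value property *)

Section CircleMeans.
Variable R : realType.
Local Notation C := R[i].
Notation V := (R[i])^o.

Section Generic.
Variable X : normedModType R[i].
Implicit Types (f g : C -> X).

(* The average of [f] over (essentially) the [2 ^ n] equidistant points of the
   circle of radius [s]. *)
Definition cmean n f (s : R) : X :=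
  trap n (fun w => f (cexp w)) (ln s)%:C ('i * (2 * pi)%:C).

Lemma circle_pt (s t : R) : 0 < s -> cmod (cexp ((ln s)%:C + t%:C * ('i * (2 * pi)%:C))) = s.
Proof.
move=> s0; rewrite cmod_cexp (_ : complex.Re _ = ln s) ?lnK ?posrE//.
by rewrite mulrCA -rmorphM /=; ring.
Qed.

Lemma cmean_ext n f g s : 0 < s -> (forall z, cmod z = s -> f z = g z) -> cmean n f s = cmean n g s.
Proof. by move=> s0 H; apply: trap_ext => t _; apply: H; exact: circle_pt. Qed.

Lemma cmean_le n f s B : 0 < s -> (forall z, cmod z = s -> vnorm (f z) <= B) -> vnorm (cmean n f s) <= B.
Proof. by move=> s0 H; apply: trap_le => t _; apply: H; exact: circle_pt. Qed.

Lemma cmeanD n f g s : cmean n (fun z => f z + g z) s = cmean n f s + cmean n g s.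
Proof. exact: trapD. Qed.
Lemma cmeanB n f g s : cmean n (fun z => f z - g z) s = cmean n f s - cmean n g s.
Proof. exact: trapB. Qed.
Lemma cmeanZ n a f s : cmean n (fun z => a *: f z) s = a *: cmean n f s.
Proof. exact: trapZ. Qed.
Lemma cmean_cst n x s : cmean n (fun=> x) s = x.
Proof. exact: trap_cst. Qed.
Lemma cmean_sum n (I : Type) (r : seq I) (F : I -> C -> X) s :
  cmean n (fun z => \sum_(i <- r) F i z) s = \sum_(i <- r) cmean n (F i) s.
Proof. exact: trap_sum. Qed.

(** The exponential maps the rectangle [[ln s1, ln s2] x [0, 2 pi]] onto the annulus; the horizontal
    edges cancel by periodicity and the vertical ones are the two circles. The line of mere
    continuity in [goursat] becomes the circle [cmod z = t]; a value of [t] outside [[s1, s2]] means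
    that there is no such circle. *)
Lemma cmean_annulus f s1 s2 t : 0 < s1 -> s1 < s2 -> 0 < t ->
  (forall z, s1 <= cmod z <= s2 -> cmod z != t -> cdiff f z) ->
  (forall z, s1 <= cmod z <= s2 -> cmod z = t -> ccont f z) ->
  vlim (fun n => cmean n f s2 - cmean n f s1) 0.
Proof.
move=> s10 s12 t0 Hd Hc; have s20 : 0 < s2 by lra.
pose a := ln s2 - ln s1; pose b : R := 2 * pi.
have a0 : 0 < a by rewrite subr_gt0 ltr_ln ?posrE.
have b0 : 0 < b by rewrite mulr_gt0 ?pi_gt0.
have pt u v : complex.Re (rpoint (ln s1)%:C a b u v) = ln s1 + u * a.
  by rewrite /rpoint /=; ring.
have L1 : expR (ln s1) = s1 by rewrite lnK ?posrE.
have L2 : expR (ln s2) = s2 by rewrite lnK ?posrE.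
have bd u v : 0 <= u <= 1 -> s1 <= cmod (cexp (rpoint (ln s1)%:C a b u v)) <= s2.
  move=> /andP[u0 u1]; rewrite cmod_cexp pt.
  have : 0 <= u * a by rewrite mulr_ge0// ltW.
  have : u * a <= a by rewrite ler_piMl// ltW.
  move=> ua1 ua0; apply/andP; split; [rewrite -[leLHS]L1|rewrite -[leRHS]L2]; rewrite ler_expR /a in ua1 ua0 *; lra.
have Re_t w : complex.Re w = ln t <-> cmod (cexp w) = t.
  rewrite cmod_cexp; split=> [->|<-]; first by rewrite lnK ?posrE.
  by rewrite expRK.
have G : vlim (fun n => rsum n (fun w => f (cexp w)) (ln s1)%:C a b) 0.
  apply: (@goursat R X (fun w => f (cexp w)) _ a b (ln t)) => // u v hu hv.
    move=> /eqP Hne; apply: (@cdiff_comp R X (@cexp R) f); first exact: cdiff_cexp.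
    by apply: Hd; [exact: bd|apply/eqP => /Re_t].
  move=> Heq; apply: (@ccont_comp R X (@cexp R) f); first by apply: cdiff_cont; exact: cdiff_cexp.
  by apply: Hc; [exact: bd|apply/Re_t].
have ib0 : 'i * b%:C != 0 :> C.
  by rewrite -cmod_gt0 cmodM cmodRp ?ltW// (_ : cmod 'i = 1) ?mul1r// /cmod /= expr0n expr1n add0r sqrtr1.
move: G => /(vlimZ ('i * b%:C)^-1).
rewrite scaler0; apply: vlim_ext => n; rewrite /rsum.
have -> : trap n (fun w => f (cexp w)) ((ln s1)%:C + 'i * b%:C) a%:C = trap n (fun w => f (cexp w)) (ln s1)%:C a%:C.
  have := @trap_ext R X n (fun w => f (cexp (w + 'i * b%:C))) (fun w => f (cexp w)) (ln s1)%:C a%:C.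
  move=> <-; last by move=> u _; rewrite cexp_period.
  by rewrite (trap_shift n (fun w => f (cexp w))).
rewrite subrr scaler0 add0r scalerA mulVf// scale1r.
by have -> : (ln s1)%:C + a%:C = (ln s2)%:C :> C by rewrite /a rmorphB /= addrC subrK.
Qed.

(** Closeness of the sums at all high levels passes from two halves of an arc to the arc, and holds
    on short arcs by continuity; bisection replaces uniform continuity. *)
Lemma cmean_cvg f s : seqcomplete X -> 0 < s -> (forall z, cmod z = s -> ccont f z) ->
  exists l, vlim (fun n => cmean n f s) l.
Proof.
move=> cX s0 Hc; apply: cX => e e0.
pose g w := f (cexp w); pose b : R := 2 * pi.
have b0 : 0 <= b by rewrite mulr_ge0 ?pi_ge0.
pose P p (a b : R) := exists N, forall n m, (N <= n)%N -> (N <= m)%N ->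
  vnorm (trap n g p ('i * b%:C) - trap m g p ('i * b%:C)) <= e.
(* A rectangle of width 0: here the degenerate case of [bisection] subdivides a segment. *)
suff : P (ln s)%:C 0 b by [].
have half2 : cmod (2^-1 : C) = 2^-1 by rewrite -[2^-1]mul1r cmod_half cmod1 mul1r.
apply: bisection => //.
  move=> p a c _ _ _ _ [N1 H1] _ [N2 H2] _; exists (maxn N1 N2).+1 => -[//|n] [//|m].
  rewrite !ltnS !geq_max => /andP[n1 n2] /andP[m1 m2] /=.
  have -> : 'i * c%:C / 2 = 'i * (c / 2)%:C :> C by rewrite halfC mulrA.
  have := H1 n m n1 m1; have := H2 n m n2 m2.
  set x1 := trap n g p _; set x2 := trap m g p _; set y1 := trap n g _ _; set y2 := trap m g _ _.
  rewrite (_ : _ - 2^-1 *: _ = 2^-1 *: ((x1 - x2) + (y1 - y2))); last by lmodule R[i] X.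
  by rewrite vnormZ half2; have := vnormD (x1 - x2) (y1 - y2); lra.
move=> t u t01 u01; set z := rpoint _ _ _ _ _.
have Cz : ccont (fun w => f (cexp w)) z.
  apply: (@ccont_comp R X (@cexp R) f z); first by apply: cdiff_cont; exact: cdiff_cexp.
  apply: Hc; rewrite cmod_cexp (_ : complex.Re z = ln s) ?lnK ?posrE//.
  by rewrite /z /rpoint /=; ring.
have e2 : 0 < e / 2 by lra.
have [eta eta0 He] := Cz _ e2; exists (eta / 4); first by lra.
move=> p a c v w ha hc _ _ hv hw Ez _; exists 0%N.
have key n : vnorm (trap n g p ('i * c%:C) - g z) <= e / 2.
  rewrite -(trap_cst n (g z) p ('i * c%:C)) -trapB; apply: trap_le => x x01.
  set y := p + _.
  have D : cmod (y - z) <= a + c.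
    rewrite -Ez (_ : y = rpoint p a c 0 x); last first.
      by rewrite /y /rpoint mul0r rmorph0 addr0 rmorphM mulrCA.
    by apply: rpoint_dist => //; [lra|lra|rewrite lexx ler01].
  rewrite -{1}[y](subrK z) [y - z + z]addrC; apply: He; apply: le_lt_trans D _; lra.
move=> n m _ _; have := vnorm_tri (trap n g p ('i * c%:C)) (g z) (trap m g p ('i * c%:C)).
have := key n; have := key m; rewrite (vnormC (g z)); lra.
Qed.

(** The mean is moved to a tiny circle, on which [f] is close to [f 0]. Continuity at 0 suffices,
    which is what later removes singularities. *)
Lemma mean_value f s : 0 < s -> (forall z, 0 < cmod z <= s -> cdiff f z) -> ccont f 0 ->
  vlim (fun n => cmean n f s) (f 0).
Proof.
move=> s0 Hd Hc e e0; have e2 : 0 < e / 2 by lra.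
have [eta eta0 He] := Hc _ e2.
pose s1 := Num.min (eta / 2) (s / 2).
have s10 : 0 < s1 by rewrite lt_min; lra.
have s1e : s1 <= eta / 2 by rewrite ge_min lexx.
have s1s : s1 <= s / 2 by rewrite ge_min lexx orbT.
have key n : vnorm (cmean n f s1 - f 0) <= e / 2.
  rewrite -(cmean_cst n (f 0) s1) -cmeanB; apply: cmean_le => // z zs.
  by have := He z; rewrite add0r; apply; lra.
have [||||N HN] := @cmean_annulus f s1 s (s + 1) s10 _ _ _ _ _ e2; try by lra.
- by move=> z hz _; apply: Hd; lra.
- by move=> z hz zt; lra.
exists N => n /HN; rewrite subr0 => A.
by have := vnorm_tri (cmean n f s) (cmean n f s1) (f 0); have := key n; lra.
Qed.

End Generic.

Lemma cmean_scal (X : normedModType R[i]) n (a : C -> V) (x : X) s :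
  cmean n (fun w => a w *: x) s = (cmean n a s : C) *: x.
Proof. exact: trap_scal. Qed.

End CircleMeans.

(** * Cauchy's formula and its consequences *)

Section Cauchy.
Variable R : realType.
Local Notation C := R[i].
Notation V := (R[i])^o.

Lemma near_neq (z w : C) : z != w -> near0 (fun h => z + h != w).
Proof.
move=> zw; exists (cmod (z - w)); first by rewrite cmod_gt0 subr_eq0.
move=> h hh; apply/eqP => E; move: hh; rewrite -E opprD addNKr cmodN ltxx //.
Qed.

Lemma cdiff_kernel (z w : C) : z != w -> @cdiff R V (fun z => z / (z - w)) z.
Proof.
move=> zw; apply: cdiff_div; [exact: cdiff_id|apply: cdiffB; [exact: cdiff_id|exact: cdiff_cst]|].
by rewrite subr_eq0.
Qed.

Lemma cmod_neq (z w : C) : cmod z != cmod w -> z != w.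
Proof. by apply: contraNneq => ->. Qed.

Lemma kernel_bound (z w : C) : cmod w < cmod z -> cmod (z / (z - w)) <= cmod z / (cmod z - cmod w).
Proof.
move=> wz; rewrite cmodf ler_wpM2l ?cmod_ge0// lef_pV2 ?posrE ?subr_gt0 ?cmod_lbB//.
by apply: lt_le_trans (cmod_lbB _ _); rewrite subr_gt0.
Qed.

Lemma kernel_bound_out (z w : C) : cmod z < cmod w -> cmod (z / (z - w)) <= cmod z / (cmod w - cmod z).
Proof.
move=> wz; rewrite cmodf cmodC ler_wpM2l ?cmod_ge0// lef_pV2 ?posrE ?subr_gt0 ?cmod_lbB//.
by apply: lt_le_trans (cmod_lbB _ _); rewrite subr_gt0.
Qed.

Lemma kernel_out (w : C) s : 0 < s -> s < cmod w ->
  vlim (fun n => cmean n (fun z => z / (z - w) : V) s) 0.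
Proof.
move=> s0 sw.
have K z : cmod z <= s -> @cdiff R V (fun z => z / (z - w)) z.
  by move=> zs; apply: cdiff_kernel; apply: cmod_neq; rewrite lt_eqF//; lra.
rewrite [0](_ : _ = 0 / (0 - w)); last by rewrite mul0r.
apply: (@mean_value R V) => // [z /andP[_ ?]|]; first exact: K.
by apply: cdiff_cont; apply: K; rewrite cmod0 ltW.
Qed.

(** The mean is moved to a large circle of radius [S], where the kernel differs from 1 by
    [w / (z - w)], of modulus at most [cmod w / (S - cmod w) <= e / 2]. *)
Lemma kernel_in (w : C) s : 0 < s -> cmod w < s ->
  vlim (fun n => cmean n (fun z => z / (z - w) : V) s) 1.
Proof.
move=> s0 sw e e0; have w0 := cmod_ge0 w.
have e2 : 0 < e / 2 by lra.
pose S := s + 1 + cmod w + cmod w / (e / 2).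
have we0 : 0 <= cmod w / (e / 2) by rewrite divr_ge0// ltW.
have sS : s < S by rewrite /S; lra.
have [||||N HN] := @cmean_annulus R V (fun z => z / (z - w) : V) s S (S + 1) s0 _ _ _ _ _ e2; try by lra.
- move=> z hz _; apply: cdiff_kernel; apply: cmod_neq; rewrite gt_eqF//; lra.
- by move=> z hz ?; lra.
exists N => n /HN; rewrite subr0 => A.
have B : vnorm (cmean n (fun z => z / (z - w) : V) S - (1 : V)) <= e / 2.
  rewrite -(cmean_cst n (1 : V) S) -cmeanB; apply: cmean_le; first by lra.
  move=> z zS; have wz : cmod w < cmod z by rewrite zS; lra.
  have zw : z - w != 0 by rewrite subr_eq0; apply: cmod_neq; rewrite gt_eqF.
  rewrite vnorm_scal (_ : _ - _ = w / (z - w)); last by field.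
  have zw0 : 0 < cmod (z - w) by rewrite cmod_gt0.
  rewrite cmodf ler_pdivrMr// mulrC -ler_pdivrMr//.
  by have := cmod_lbB z w; rewrite zS /S; lra.
have := vnorm_tri (cmean n (fun z => z / (z - w) : V) s) (cmean n (fun z => z / (z - w) : V) S) 1.
by rewrite vnormC in A; lra.
Qed.

Section Generic.
Variable X : normedModType R[i].
Implicit Types (f g : C -> X).

(** The integrand of Cauchy's formula for [f - f w], filled in at [w] by the derivative. It is only
    known to be continuous there, hence the exceptional circle in [cmean_annulus]. *)
Lemma slope_kernel f w : cdiff f w -> exists2 g : C -> X,
  (forall z, z != w -> g z = (z / (z - w)) *: (f z - f w)) &
  (ccont g w /\ forall z, z != w -> cdiff f z -> cdiff g z).
Proof.
move=> [d Hd]; pose k z := (z / (z - w)) *: (f z - f w).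
pose g z := if z == w then w *: d else k z; exists g; first by move=> z /negPf zw; rewrite /g zw.
split=> [e e0|z zw fz]; last first.
  apply: (@cdiff_ext _ X k); first by apply: near0_imp (near_neq zw) => h /negPf zh; rewrite /g zh.
  apply: cdiffM; first exact: cdiff_kernel.
  by apply: cdiffB => //; exact: cdiff_cst.
have w0 := cmod_ge0 w; have d0 := vnorm_ge0 d.
have W0 : 0 < 2 * (cmod w + 1) by lra.
have D0 : 0 < 2 * (vnorm d + 1) by lra.
have := near0_and (near0_and (near0_small ltr01) (near0_small (divr_gt0 e0 D0))) (Hd _ (divr_gt0 e0 W0)).
apply: near0_imp => h [[h1 h2] h3]; rewrite {2}/g eqxx.
have [->|hn0] := eqVneq h 0; first by rewrite addr0 /g eqxx subrr vnorm0 ltW.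
have -> : g (w + h) = ((w + h) / h) *: (f (w + h) - f w).
  rewrite /g /k [w + h]addrC addrK ifN//.
  by apply: contraNneq hn0 => /eqP; rewrite -subr_eq0 addrK.
rewrite (_ : _ - _ = ((w + h) / h) *: (f (w + h) - f w - h *: d) + h *: d); last by lmodule R[i] X; field.
apply: le_trans (vnormD _ _) _; rewrite !vnormZ cmodf.
have hp : 0 < cmod h by rewrite cmod_gt0.
have A : cmod h * vnorm d <= e / 2.
  move: h2; rewrite ltr_pdivlMr//; have := cmod_ge0 h; nra.
have B : cmod (w + h) / cmod h * vnorm (f (w + h) - f w - h *: d) <= e / 2.
  rewrite mulrAC ler_pdivrMr//.
  apply: (@le_trans _ _ ((cmod w + 1) * (e / (2 * (cmod w + 1)) * cmod h))).
    apply: ler_pM; rewrite ?cmod_ge0 ?vnorm_ge0//.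
    by have := cmodD w h; lra.
  by rewrite le_eqVlt; apply/orP; left; apply/eqP; field; rewrite gt_eqF//; lra.
by lra.
Qed.

(** Cauchy's theorem for the function of [slope_kernel], with exceptional circle through [w]; the
    term [f w] survives because the kernel has mean 1 on the outer and 0 on the inner circle. *)
Lemma cauchy_annulus f s1 s2 w : 0 < s1 -> s1 < cmod w -> cmod w < s2 ->
  (forall z, s1 <= cmod z <= s2 -> cdiff f z) ->
  vlim (fun n => cmean n (fun z => (z / (z - w)) *: f z) s2 - cmean n (fun z => (z / (z - w)) *: f z) s1) (f w).
Proof.
move=> s10 s1w ws2 Hd.
have [|g Hg [gw gz]] := @slope_kernel f w; first by apply: Hd; lra.
have s20 : 0 < s2 by lra.
have G : vlim (fun n => cmean n g s2 - cmean n g s1) 0.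
  apply: (@cmean_annulus R X g s1 s2 (cmod w)); rewrite ?cmod_gt0//; try by lra.
  - by rewrite -cmod_gt0; lra.
  - by move=> z hz zw; apply: gz; [exact: cmod_neq|exact: Hd].
  move=> z hz _; have [->//|zw] := eqVneq z w.
  by apply: cdiff_cont; apply: gz => //; exact: Hd.
have E s n : 0 < s -> s != cmod w -> cmean n g s =
    cmean n (fun z => (z / (z - w)) *: f z) s - (cmean n (fun z => z / (z - w) : V) s : C) *: f w.
  move=> s0 sw; rewrite -cmean_scal -cmeanB; apply: cmean_ext => // z zs.
  by rewrite Hg ?scalerBr//; apply: cmod_neq; rewrite zs.
have x0 : f w = 0 + ((1 : V) - (0 : V) : C) *: f w by rewrite subr0 scale1r add0r.
rewrite x0.
apply: vlim_ext (vlimD G (vlimM (vlimB (kernel_in s20 ws2) (kernel_out s10 s1w)) (vlim_cst (f w)))) => n /=.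
rewrite (E s2) ?gt_eqF// (E s1) ?lt_eqF//.
set A := cmean n _ s2; set B := cmean n _ s1; set a := cmean n _ s2; set b := cmean n _ s1.
move: a b => a b; rewrite -[a - b]/((a : C) - (b : C)).
by lmodule R[i] X.
Qed.

Lemma cauchy_disk f s w : (forall z, 0 < cmod z <= s -> cdiff f z) -> ccont f 0 -> cmod w < s ->
  vlim (fun n => cmean n (fun z => (z / (z - w)) *: f z) s) (f w).
Proof.
move=> Hd Hc ws; have w0 := cmod_ge0 w; have s0 : 0 < s by lra.
have [->|wn0] := eqVneq w 0.
  apply: vlim_ext (mean_value s0 Hd Hc) => n; apply: cmean_ext => // z zs.
  by rewrite subr0 divff ?scale1r// -cmod_gt0 zs.
have wp : 0 < cmod w by rewrite cmod_gt0.
move=> e e0; have e2 : 0 < e / 2 by lra.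
have [eta eta0 He] := Hc _ ltr01.
pose K := vnorm (f 0) + 1; have K0 : 0 < K by rewrite /K; have := vnorm_ge0 (f 0); lra.
(* Three demands: [f] is bounded by [K] on the circle of radius [s1], this circle stays at distance
   at least [cmod w / 2] from [w], and kernel times [K] is at most [e / 2]. *)
pose s1 := Num.min (Num.min (eta / 2) (cmod w / 2)) (e / 2 * (cmod w / 2) / K).
have s10 : 0 < s1 by rewrite !lt_min !divr_gt0//= !mulr_gt0 ?invr_gt0.
have s11 : s1 <= eta / 2 by rewrite !ge_min lexx.
have s12 : s1 <= cmod w / 2 by rewrite !ge_min lexx orbT.
have s13 : s1 * K <= e / 2 * (cmod w / 2) by rewrite -ler_pdivlMr// !ge_min lexx !orbT.
have B n : vnorm (cmean n (fun z => (z / (z - w)) *: f z) s1) <= e / 2.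
  apply: cmean_le => // z zs.
  have fz : vnorm (f z) <= K.
    have := He z; rewrite add0r => /(_ _); have := vnorm_tri (f z) (f 0) 0; rewrite !subr0 /K.
    by move=> A /(_ _) B; have := B (_ : cmod z < eta); lra.
  rewrite vnormZ; have zw : cmod z < cmod w by rewrite zs; lra.
  have := kernel_bound_out zw; rewrite zs => kb.
  apply: (@le_trans _ _ (s1 / (cmod w - s1) * K)).
    by apply: ler_pM; rewrite ?cmod_ge0 ?vnorm_ge0.
  rewrite mulrAC ler_pdivrMr; last by lra.
  by apply: le_trans s13 _; rewrite ler_pM2l//; lra.
have [||N HN] := @cauchy_annulus f s1 s w s10 _ ws _ _ e2; try by lra.
  by move=> z hz; apply: Hd; lra.
exists N => n /HN A; have := B n.
set a := cmean n _ s in A *; set b := cmean n _ s1 in A * => Hb.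
have := vnormD (a - b - f w) b; rewrite (_ : a - b - f w + b = a - f w); last by lmodule R[i] X.
by lra.
Qed.

(** By Cauchy's formula the left side is the mean of [h * k * (h - k) / ((z - h) * (z - k)) *: f z],
    and both factors of the denominator have modulus at least [s / 2]. *)
Lemma slope_estimate f s (B : R) h k : (forall z, 0 < cmod z <= s -> cdiff f z) -> ccont f 0 ->
  0 < s -> (forall z, cmod z = s -> vnorm (f z) <= B) -> cmod h <= s / 2 -> cmod k <= s / 2 ->
  vnorm (k *: (f h - f 0) - h *: (f k - f 0)) <= 8 * B / s ^+ 2 * (cmod h * cmod k * cmod (h - k)).
Proof.
move=> Hd Hc s0 HB hs ks; have h0 := cmod_ge0 h; have k0 := cmod_ge0 k.
have L w : cmod w <= s / 2 -> vlim (fun n => cmean n (fun z => (z / (z - w)) *: f z) s) (f w).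
  by move=> ?; apply: cauchy_disk => //; lra.
have L0 : vlim (fun n => cmean n (fun z => (z / (z - 0)) *: f z) s) (f 0).
  by apply: L; rewrite cmod0; lra.
apply: (@vlim_le _ _ _ _ _ 0%N _ (vlimB (vlimZ k (vlimB (L _ hs) L0)) (vlimZ h (vlimB (L _ ks) L0)))) => n _.
rewrite -!cmeanB -!cmeanZ -cmeanB; apply: cmean_le => // z zs.
have n0 : z != 0 by rewrite -cmod_gt0 zs.
have nh : z - h != 0 by rewrite subr_eq0; apply: cmod_neq; rewrite gt_eqF// zs; lra.
have nk : z - k != 0 by rewrite subr_eq0; apply: cmod_neq; rewrite gt_eqF// zs; lra.
rewrite (_ : _ - _ = (h * k * (h - k) / ((z - h) * (z - k))) *: f z); last first.
  by rewrite subr0; lmodule R[i] X; field; rewrite nh nk n0.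
rewrite vnormZ !(cmodM, cmodV).
have zh : s / 2 <= cmod (z - h) by have := cmod_lbB z h; rewrite zs; lra.
have zk : s / 2 <= cmod (z - k) by have := cmod_lbB z k; rewrite zs; lra.
have s2 : 0 < s / 2 by lra.
have i1 : (cmod (z - h) * cmod (z - k))^-1 <= 4 / s ^+ 2.
  rewrite (_ : 4 / s ^+ 2 = (s / 2 * (s / 2))^-1); last by field; rewrite gt_eqF.
  rewrite lef_pV2 ?posrE ?mulr_gt0//; try by lra.
  by apply: ler_pM; lra.
have B0 : 0 <= B by apply: le_trans (HB z zs); exact: vnorm_ge0.
have m0 : 0 <= cmod h * cmod k * cmod (h - k) by rewrite !mulr_ge0 ?cmod_ge0.
rewrite [cmod h * _ * _]mulrC in m0 *; set m := _ * _ in m0 *.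
apply: (@le_trans _ _ (m * (4 / s ^+ 2) * B)).
  apply: ler_pM; rewrite ?vnorm_ge0 ?HB// ?mulr_ge0 ?invr_ge0 ?mulr_ge0 ?cmod_ge0//.
  by rewrite ler_wpM2l.
have : 0 <= m / s ^+ 2 * B by apply: mulr_ge0 => //; apply: divr_ge0 => //; exact: sqr_ge0.
have -> : 8 * B / s ^+ 2 * m = 8 * (m / s ^+ 2 * B) by ring.
have -> : m * (4 / s ^+ 2) * B = 4 * (m / s ^+ 2 * B) by ring.
by move: (_ * B) => x x0; lra.
Qed.

(** Divided by [h * k], the hypothesis says that the difference quotients are Lipschitz in the
    increment. So they form a Cauchy sequence along [eta / n.+1], and its limit is the
    derivative. *)
Lemma slope_cdiff f w (K eta : R) : seqcomplete X -> 0 < eta ->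
  (forall h k, cmod h <= eta -> cmod k <= eta ->
     vnorm (k *: (f (w + h) - f w) - h *: (f (w + k) - f w)) <= K * (cmod h * cmod k * cmod (h - k))) ->
  cdiff f w.
Proof.
move=> cX eta0 H.
have K0 : 0 <= K.
  have := H eta%:C (- eta%:C); rewrite cmodN cmodRp ?(ltW eta0)// => /(_ (lexx _) (lexx _)).
  move=> /(le_trans (vnorm_ge0 _)); rewrite pmulr_lge0//.
  rewrite !mulr_gt0// cmod_gt0 opprK -rmorphD /= -cmod_gt0 cmodRp; lra.
pose a (n : nat) : R := eta / n.+1%:R.
have a0 n : 0 < a n by rewrite divr_gt0.
have aeta n : a n <= eta by rewrite ler_pdivrMr// ler_peMr ?ler1n// ltW.
have alim (e : R) : 0 < e -> exists N, forall n, (N <= n)%N -> a n <= e.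
  move=> e0; exists (Num.truncn (eta / e)).+1 => n Nn.
  rewrite ler_pdivrMr// mulrC -ler_pdivrMr// (le_trans (ltW (truncnS_gt _)))//.
  by rewrite ler_nat; apply: leqW.
pose q n := ((a n)%:C)^-1 *: (f (w + (a n)%:C) - f w).
have an0 n : (a n)%:C != 0 :> C by rewrite -cmod_gt0 cmodRp // ltW.
have ca n : cmod (a n)%:C = a n by rewrite cmodRp// ltW.
have key h n : cmod h <= eta -> vnorm (f (w + h) - f w - h *: q n) <= K * (cmod h * cmod (h - (a n)%:C)).
  move=> hh; have := H h (a n)%:C hh; rewrite ca => /(_ (aeta n)).
  rewrite (_ : _ - _ = (a n)%:C *: (f (w + h) - f w - h *: q n)); last first.
    by rewrite /q; lmodule R[i] X; field; exact: an0.
  rewrite vnormZ ca.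
  by rewrite (_ : K * _ = a n * (K * (cmod h * cmod (h - (a n)%:C)))) ?ler_pM2l//; ring.
have [d Hd] : exists d, vlim q d.
  apply: cX => e e0; have K1 : 0 < 2 * (K + 1) by lra.
  have [N HN] := alim _ (divr_gt0 e0 K1); exists N => n m /HN n1 /HN m1.
  have := key (a m)%:C n; rewrite ca => /(_ (aeta m)).
  rewrite (_ : f (w + (a m)%:C) - f w - _ = (a m)%:C *: (q m - q n)); last first.
    rewrite /q; move: (an0 m) (an0 n); move: (_%:C) (_%:C) => A B A0 B0.
    by lmodule R[i] X; field; rewrite ?A0 ?B0.
  rewrite vnormZ ca mulrCA ler_pM2l// vnormC => /le_trans; apply.
  have := cmodB (a m)%:C (a n)%:C; rewrite !ca => c1.
  move: n1 m1; rewrite !ler_pdivlMr// => n1 m1.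
  have : K * cmod ((a m)%:C - (a n)%:C) <= K * (a m + a n) by rewrite ler_wpM2l.
  have := a0 m; have := a0 n; nra.
have key2 h : cmod h <= eta -> vnorm (f (w + h) - f w - h *: d) <= K * (cmod h * cmod h).
  move=> hh; apply/ler_addgt0Pr => e e0.
  have h0 := cmod_ge0 h; have Kh : 0 <= K * cmod h by rewrite mulr_ge0.
  have E0 : 0 < 2 * (K * cmod h + 1) by lra.
  have [N HN] := alim _ (divr_gt0 e0 E0).
  have E1 : 0 < e / (2 * (cmod h + 1)) by rewrite divr_gt0//; lra.
  have [M HM] := Hd _ E1; pose n := maxn N M.
  have := HN n (leq_maxl _ _); have := HM n (leq_maxr _ _); rewrite vnormC !ler_pdivlMr//; last by lra.
  have := key h n hh; set Q := q n; have := cmodB h (a n)%:C; rewrite ca => c1 k1 q1 a1.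
  rewrite (_ : _ - _ = (f (w + h) - f w - h *: Q) + h *: (Q - d)); last by lmodule R[i] X.
  apply: le_trans (vnormD _ _) _; rewrite vnormZ (vnormC Q).
  have : K * (cmod h * cmod (h - (a n)%:C)) <= K * (cmod h * (cmod h + a n)) by rewrite !ler_wpM2l.
  have := a0 n; have := vnorm_ge0 (d - Q); nra.
exists d => e e0; have K1 : 0 < K + 1 by lra.
have := near0_and (near0_small eta0) (near0_small (divr_gt0 e0 K1)).
apply: near0_imp => h [h1]; rewrite ltr_pdivlMr// => h2.
apply: le_trans (key2 h (ltW h1)) _; rewrite mulrA ler_wpM2r ?cmod_ge0//.
by have := cmod_ge0 h; nra.
Qed.

(** [slope_estimate] needs only continuity at 0, and [slope_cdiff] turns its conclusion into
    differentiability at 0. *)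
Lemma removable f : seqcomplete X -> forall s, 0 < s ->
  (forall z, 0 < cmod z <= s -> cdiff f z) -> ccont f 0 -> cdiff f 0.
Proof.
move=> cX s s0 Hd Hc.
have [eta eta0 He] := Hc _ ltr01.
pose t := Num.min (eta / 2) s; have t0 : 0 < t by rewrite lt_min s0 andbT; lra.
have te : t <= eta / 2 by rewrite ge_min lexx.
have ts : t <= s by rewrite ge_min lexx orbT.
apply: (@slope_cdiff f 0 (8 * (vnorm (f 0) + 1) / t ^+ 2) (t / 2)) => //; first by lra.
move=> h k hh kk; rewrite !add0r; apply: slope_estimate => //.
  by move=> z hz; apply: Hd; lra.
move=> z zt; have := He z; rewrite add0r => He'.
have := vnorm_tri (f z) (f 0) 0; rewrite !subr0; have : cmod z < eta by lra.
by move=> /He'; lra.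
Qed.

Lemma cdiff_translate f w z : cdiff f (w + z) -> cdiff (fun u => f (w + u)) z.
Proof.
move=> H; apply: (@cdiff_comp R X (fun u => w + u) f) => //.
by apply: cdiffD; [exact: cdiff_cst|exact: cdiff_id].
Qed.

(* Holomorphy passes to pointwise limits of locally bounded families, since it
   is equivalent to the three-point inequality of [slope_estimate]. *)
Lemma cdiff_closure (I : Type) (F : I -> C -> X) f w (s B : R) : seqcomplete X -> 0 < s ->
  (forall i z, cmod (z - w) <= s -> cdiff (F i) z) ->
  (forall i z, cmod (z - w) <= s -> vnorm (F i z) <= B) ->
  (forall p q r, cmod (p - w) <= s -> cmod (q - w) <= s -> cmod (r - w) <= s ->
    forall e : R, 0 < e -> exists i, [/\ vnorm (F i p - f p) <= e,
    vnorm (F i q - f q) <= e & vnorm (F i r - f r) <= e]) ->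
  cdiff f w.
Proof.
move=> cX s0 Hd HB Hl.
apply: (@slope_cdiff f w (8 * B / s ^+ 2) (s / 2)) => //; first by lra.
move=> h k hh kk; apply/ler_addgt0Pr => e e0.
have h0 := cmod_ge0 h; have k0 := cmod_ge0 k.
have D0 : 0 < 2 * (cmod h + cmod k + 1) by lra.
have [|||i [p1 p2 p3]] := Hl (w + h) (w + k) w _ _ _ _ (divr_gt0 e0 D0).
- by rewrite addrC addKr; lra.
- by rewrite addrC addKr; lra.
- by rewrite subrr cmod0 ltW.
have := @slope_estimate (fun u => F i (w + u)) s B h k.
rewrite addr0 => /(_ _ _ s0 _ hh kk) => T.
have {}T : vnorm (k *: (F i (w + h) - F i w) - h *: (F i (w + k) - F i w)) <=
    8 * B / s ^+ 2 * (cmod h * cmod k * cmod (h - k)).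
  apply: T => [z /andP[_ hz]||z zs].
  - by apply: cdiff_translate; apply: Hd; rewrite addrC addKr.
  - by apply: cdiff_cont; apply: cdiff_translate; apply: Hd; rewrite addr0 subrr cmod0 ltW.
  - by apply: HB; rewrite addrC addKr zs.
set x := f (w + h) in p1 *; set y := f (w + k) in p2 *; set v := f w in p3 *.
set x' := F i (w + h) in p1 T; set y' := F i (w + k) in p2 T; set v' := F i w in p3 T.
rewrite (_ : _ - _ = (k *: (x' - v') - h *: (y' - v')) +
   ((- k) *: (x' - x) + (k - h) *: (v' - v) + h *: (y' - y))); last by lmodule R[i] X.
apply: le_trans (vnormD _ _) _; rewrite lerD//.
apply: le_trans (vnormD _ _) _; rewrite vnormZ.
apply: le_trans (lerD (vnormD _ _) (lexx _)) _; rewrite !vnormZ cmodN.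
move: p1 p2 p3; rewrite !ler_pdivlMr// => p1 p2 p3.
have := cmodB k h; have := cmod_ge0 (k - h).
move: (vnorm_ge0 (x' - x)) (vnorm_ge0 (y' - y)) (vnorm_ge0 (v' - v)) p1 p2 p3.
move: (vnorm _) (vnorm (y' - y)) (vnorm (v' - v)) (cmod (k - h)) => a b c d.
move=> *; nra.
Qed.

End Generic.
End Cauchy.

(** * Disc automorphisms, maximum principle and Schwarz-Pick *)

Section SchwarzPick.
Variable R : realType.
Local Notation C := R[i].
Notation V := (R[i])^o.
Implicit Types a z w u v : C.

Lemma cmod_sqE z : cmod z ^+ 2 = complex.Re z ^+ 2 + complex.Im z ^+ 2.
Proof. by case: z => x y; rewrite /cmod /= sqr_sqrtr// addr_ge0 ?sqr_ge0. Qed.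

Definition blf a z : C := (z - a) / (1 - conjc a * z).

Lemma rhoE z w : rho z w = cmod (blf w z).
Proof. by rewrite /blf cmodf. Qed.

Lemma blf_den a z : cmod a * cmod z < 1 -> 1 - conjc a * z != 0.
Proof.
move=> h; rewrite subr_eq0; apply/eqP => E; move: h.
by rewrite -[cmod a]cmodJ -cmodM -E cmod1 ltxx.
Qed.

Lemma cmod_mul_lt1 a z : cmod a < 1 -> cmod z <= 1 -> cmod a * cmod z < 1.
Proof. by move=> a1 z1; have := cmod_ge0 a; have := cmod_ge0 z; nra. Qed.

Lemma blf_identity a z : cmod (1 - conjc a * z) ^+ 2 - cmod (z - a) ^+ 2 = (1 - cmod a ^+ 2) * (1 - cmod z ^+ 2).
Proof. by rewrite !cmod_sqE; case: a z => x y [s t] /=; ring. Qed.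

Lemma blf_cmp a z : cmod a < 1 -> cmod z <= 1 ->
  (cmod (blf a z) <= 1) /\ ((cmod z < 1 -> cmod (blf a z) < 1) /\ (cmod z = 1 -> cmod (blf a z) = 1)).
Proof.
move=> a1 z1; have d0 : 0 < cmod (1 - conjc a * z) by rewrite cmod_gt0 blf_den// cmod_mul_lt1.
have I := blf_identity a z; have n0 := cmod_ge0 (z - a).
have a0 := cmod_ge0 a; have z0 := cmod_ge0 z.
have A : 0 < 1 - cmod a ^+ 2 by rewrite expr2; nra.
rewrite /blf cmodf; split; last split.
- rewrite ler_pdivrMr// mul1r -ler_sqr ?nnegrE ?(ltW d0)//.
  have : 0 <= 1 - cmod z ^+ 2 by rewrite expr2; nra.
  by nra.
- move=> z1'; rewrite ltr_pdivrMr// mul1r -ltr_sqr ?nnegrE ?(ltW d0)//.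
  have : 0 < 1 - cmod z ^+ 2 by rewrite expr2; nra.
  by nra.
move=> z1'; rewrite z1' expr1n subrr mulr0 in I.
have E : cmod (z - a) = cmod (1 - conjc a * z).
  by apply/eqP; rewrite -(@eqrXn2 _ 2)// ?ltW//; apply/eqP; lra.
by rewrite E divff// gt_eqF.
Qed.

Lemma blf_le1 a z : cmod a < 1 -> cmod z <= 1 -> cmod (blf a z) <= 1.
Proof. by move=> a1 z1; case: (blf_cmp a1 z1). Qed.
Lemma blf_lt1 a z : cmod a < 1 -> cmod z < 1 -> cmod (blf a z) < 1.
Proof. by move=> a1 z1; case: (blf_cmp a1 (ltW z1)) => _ [/(_ z1)]. Qed.
Lemma blf_eq1 a z : cmod a < 1 -> cmod z = 1 -> cmod (blf a z) = 1.
Proof. by move=> a1 z1; case: (@blf_cmp a z a1 _) => [|_ [_ /(_ z1)]//]; rewrite z1. Qed.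

Lemma one_sub_sq a : cmod a < 1 -> 1 - conjc a * a != 0.
Proof. by move=> a1; apply: blf_den; rewrite cmod_mul_lt1// ltW. Qed.

Lemma blfK a z : cmod a < 1 -> cmod z <= 1 -> blf (- a) (blf a z) = z.
Proof.
move=> a1 z1; have d0 := blf_den (cmod_mul_lt1 a1 z1).
have d1 := one_sub_sq a1.
have d2 : (1 - conjc a * z) + conjc a * (z - a) != 0.
  by rewrite (_ : _ + _ = 1 - conjc a * a)//; ring.
rewrite /blf conjcN; field.
by rewrite d0 mulNr opprK.
Qed.

Lemma blfNK a z : cmod a < 1 -> cmod z <= 1 -> blf a (blf (- a) z) = z.
Proof. by move=> a1 z1; rewrite -{1}[a]opprK blfK// cmodN. Qed.

Lemma blf0 a : blf a 0 = - a.
Proof. by rewrite /blf mulr0 subr0 divr1 sub0r. Qed.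

Lemma blf_self a : blf a a = 0.
Proof. by rewrite /blf subrr mul0r. Qed.

Lemma cdiff_blf a z : cmod a * cmod z < 1 -> @cdiff R V (blf a) z.
Proof.
move=> h; apply: cdiff_div; last exact: blf_den.
  by apply: cdiffB; [exact: cdiff_id|exact: cdiff_cst].
apply: cdiffB; first exact: cdiff_cst.
by apply: cdiffMs; [exact: cdiff_cst|exact: cdiff_id].
Qed.

Section MaxModulus.
Variable X : normedModType R[i].

(** A disc automorphism carries 0 to [u], so [f u] is a genuine mean of values of [f] on the circle;
    the Cauchy kernel, which would cost a factor, is avoided. *)
Lemma max_modulus (f : C -> X) s (B : R) u : (forall z, cmod z <= s -> cdiff f z) ->
  (forall z, cmod z = s -> vnorm (f z) <= B) -> cmod u < s -> vnorm (f u) <= B.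
Proof.
move=> Hd HB us; have u0 := cmod_ge0 u; have s0 : 0 < s by lra.
have s0' : s%:C != 0 :> C by rewrite -cmod_gt0 cmodRp ?ltW.
pose a := u / s%:C; have a1 : cmod a < 1 by rewrite /a cmodf cmodRp ?ltW// ltr_pdivrMr// mul1r.
have Na1 : cmod (- a) < 1 by rewrite cmodN.
pose phi z := s%:C * blf (- a) z.
have cphi z : cmod (phi z) = s * cmod (blf (- a) z) by rewrite /phi cmodM cmodRp ?ltW.
have dphi z : cmod z <= 1 -> @cdiff R V phi z.
  move=> z1; apply: cdiffMs; first exact: cdiff_cst.
  by apply: cdiff_blf; exact: cmod_mul_lt1.
have phi0 : phi 0 = u by rewrite /phi blf0 opprK /a mulrC divfK.
have D z : cmod z <= 1 -> cdiff (fun w => f (phi w)) z.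
  move=> z1; apply: (@cdiff_comp R X phi f); first exact: dphi.
  apply: Hd; rewrite cphi -[leRHS]mulr1 ler_pM2l//; exact: blf_le1.
have := @mean_value R X (fun z => f (phi z)) 1 ltr01; rewrite phi0 => M.
apply: (@vlim_le _ _ _ _ _ 0%N _ (M _ _)); first last.
- by apply: cdiff_cont; apply: D; rewrite cmod0.
- by move=> z /andP[_ ?]; exact: D.
move=> n _; apply: cmean_le => // z z1; apply: HB.
by rewrite cphi blf_eq1// mulr1.
Qed.

End MaxModulus.

(** The quotient by [z - a], completed by the derivative, is continuous at [a] and hence holomorphic
    by [removable]. *)
Lemma factor_root (h : C -> V) a : cmod a < 1 -> (forall z, cmod z < 1 -> cdiff h z) -> h a = 0 ->
  exists2 k : C -> V, (forall z, cmod z < 1 -> cdiff k z) & forall z, h z = (z - a) * k z.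
Proof.
move=> a1 Hd ha; have [d dh] := Hd a a1.
pose k z : V := if z == a then d else (z - a)^-1 * h z.
have kE z : z != a -> k z = (z - a)^-1 * h z by move=> /negPf za; rewrite /k za.
have kd z : z != a -> cmod z < 1 -> cdiff k z.
  move=> za z1; apply: (@cdiff_ext _ V (fun z => (z - a)^-1 * h z)).
    by apply: near0_imp (near_neq za) => u /kE ->.
  apply: cdiffMs; last exact: Hd.
  apply: cdiffV; last by rewrite subr_eq0.
  by apply: cdiffB; [exact: cdiff_id|exact: cdiff_cst].
exists k; last first.
  move=> z; have [->|za] := eqVneq z a; first by rewrite ha subrr mul0r.
  by rewrite kE// mulVKf// subr_eq0.
move=> z z1; have [->|za] := eqVneq z a; last exact: kd.
have ck : ccont k a.
  move=> e e0; apply: near0_imp (dh e e0) => u; rewrite ha subr0.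
  have [->|u0] := eqVneq u 0; first by move=> _; rewrite addr0 subrr vnorm0 ltW.
  rewrite kE; last by apply: contraNneq u0 => /eqP; rewrite -subr_eq0 addrC addKr.
  rewrite {1}/k eqxx [a + u - a]addrC addKr.
  rewrite (_ : h (a + u) - u *: d = u * (u^-1 * h (a + u) - d)); last first.
    by rewrite /GRing.scale /=; field.
  by rewrite !vnorm_scal cmodM mulrC ler_pM2r ?cmod_gt0.
have : cdiff (fun u => k (a + u)) 0.
  apply: (@removable R V _ (@scalar_complete R) ((1 - cmod a) / 2)); first by lra.
    move=> u /andP[u0 u1]; apply: cdiff_translate; apply: kd.
      by apply: contraTneq u0 => /eqP; rewrite -subr_eq0 addrC addKr => /eqP ->; rewrite cmod0 ltxx.
    by apply: le_lt_trans (cmodD _ _) _; lra.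
  by move=> e e0; apply: near0_imp (ck e e0) => u; rewrite add0r addr0.
move=> [d' Hk]; exists d' => e e0; apply: near0_imp (Hk e e0) => u; by rewrite add0r addr0.
Qed.

Lemma schwarz (f : C -> V) u : (forall z, cmod z < 1 -> cdiff f z) ->
  (forall z, cmod z < 1 -> cmod (f z) <= 1) -> f 0 = 0 -> cmod u < 1 -> cmod (f u) <= cmod u.
Proof.
move=> Hd HB f0 u1; have u0 := cmod_ge0 u.
have [|k kd kE] := factor_root _ Hd f0; first by rewrite cmod0.
have key s : cmod u < s -> s < 1 -> s * cmod (k u) <= 1.
  move=> us s1; have s0 : 0 < s by lra.
  rewrite mulrC -ler_pdivlMr// div1r -vnorm_scal.
  apply: (@max_modulus V k s) => // z zs; first by apply: kd; lra.
  have := HB z; rewrite kE subr0 cmodM zs => /(_ s1); rewrite vnorm_scal.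
  by rewrite mulrC -ler_pdivlMr// div1r.
rewrite kE subr0 cmodM -[leRHS]mulr1 ler_wpM2l//.
rewrite leNgt; apply/negP => k1.
(* If [cmod (k u) > 1], this radius lies between [(cmod (k u))^-1] and 1 and above [cmod u], against
   [key]. *)
pose s := (1 + Num.max (cmod u) (cmod (k u))^-1) / 2.
have m1 : Num.max (cmod u) (cmod (k u))^-1 < 1 by rewrite gt_max u1 invf_lt1//; lra.
have mu : cmod u <= Num.max (cmod u) (cmod (k u))^-1 by rewrite le_max lexx.
have mk : (cmod (k u))^-1 <= Num.max (cmod u) (cmod (k u))^-1 by rewrite le_max lexx orbT.
have := key s; rewrite /s -ler_pdivlMr ?div1r; lra.
Qed.

(** Stated without division, since [f] may take values of modulus 1, where the pseudo-hyperbolic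
    distance degenerates. The classical proof is applied to [c * f] with [c < 1], and then [c] tends
    to 1. *)
Lemma schwarz_pick (f : C -> V) u v : (forall z, cmod z < 1 -> cdiff f z) ->
  (forall z, cmod z < 1 -> cmod (f z) <= 1) -> cmod u < 1 -> cmod v < 1 ->
  cmod (f u - f v) * cmod (1 - conjc v * u) <= cmod (u - v) * cmod (1 - conjc (f v) * f u).
Proof.
move=> Hd HB u1 v1.
have L0 := cmod_ge0 (f u - f v); have D0 := cmod_ge0 (u - v).
have key (c : R) : 0 < c -> c < 1 -> c * (cmod (f u - f v) * cmod (1 - conjc v * u)) <=
    cmod (u - v) * cmod (1 - (c ^+ 2)%:C * (conjc (f v) * f u)).
  move=> c0 c1; pose b := c%:C * f v.
  have cf z : cmod z < 1 -> cmod (c%:C * f z) < 1.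
    by move=> z1; rewrite cmodM cmodRp ?ltW//; have := HB z z1; have := cmod_ge0 (f z); nra.
  have b1 : cmod b < 1 by apply: cf.
  have Nv1 : cmod (- v) < 1 by rewrite cmodN.
  pose F z : V := blf b (c%:C * f (blf (- v) z)).
  have Fd z : cmod z < 1 -> cdiff F z.
    move=> z1; have bz := blf_lt1 Nv1 z1.
    apply: (@cdiff_comp R V (fun z => c%:C * f (blf (- v) z)) (blf b)).
      apply: cdiffMs; first exact: cdiff_cst.
      apply: (@cdiff_comp R V (blf (- v)) f); last exact: Hd.
      by apply: cdiff_blf; apply: cmod_mul_lt1 => //; exact: ltW.
    by apply: cdiff_blf; apply: cmod_mul_lt1 => //; apply: ltW; exact: cf.
  have HF z : cmod z < 1 -> cmod (F z) <= 1.
    by move=> z1; apply: blf_le1 => //; apply: ltW; apply: cf; exact: blf_lt1.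
  have H : cmod (F (blf v u)) <= cmod (blf v u).
    by apply: schwarz => //; [rewrite /F blf0 opprK blf_self|exact: blf_lt1].
  rewrite /F blfK// ?(ltW u1)// in H.
  move: H; rewrite /blf !cmodf /b.
  rewrite (_ : c%:C * f u - c%:C * f v = c%:C * (f u - f v)); last by ring.
  rewrite (_ : conjc (c%:C * f v) * (c%:C * f u) = (c ^+ 2)%:C * (conjc (f v) * f u)); last first.
    by rewrite conjcM conjc_real rmorphXn /=; ring.
  rewrite cmodM (cmodRp (ltW c0)).
  have d1 : 0 < cmod (1 - (c ^+ 2)%:C * (conjc (f v) * f u)).
    rewrite cmod_gt0 (_ : (c ^+ 2)%:C * (conjc (f v) * f u) = conjc b * (c%:C * f u)).
      by apply: blf_den; apply: cmod_mul_lt1 => //; apply: ltW; exact: cf.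
    by rewrite /b conjcM conjc_real rmorphXn /=; ring.
  have d2 : 0 < cmod (1 - conjc v * u) by rewrite cmod_gt0 blf_den// cmod_mul_lt1// ltW.
  rewrite ler_pdivrMr// [_ / _ * _]mulrAC ler_pdivlMr//; lra.
set L := _ * cmod (1 - _ * u) in key *; have L1 : 0 <= L by rewrite mulr_ge0 ?cmod_ge0.
apply/ler_addgt0Pr => e e0.
set D := cmod (u - v) in D0 key *.
have T0 : 0 < L + 2 * D + 1 by lra.
pose t := Num.min (1 / 2) (e / (L + 2 * D + 1)).
have t0 : 0 < t by rewrite lt_min; apply/andP; split; [lra|exact: divr_gt0].
have t1 : t <= 1 / 2 by rewrite ge_min lexx.
have te : t * (L + 2 * D + 1) <= e by rewrite -ler_pdivlMr// ge_min lexx orbT.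
have := key (1 - t); set w := conjc (f v) * f u.
have w1 : cmod w <= 1.
  rewrite /w cmodM cmodJ; have := HB u u1; have := HB v v1.
  by have := cmod_ge0 (f u); have := cmod_ge0 (f v); nra.
have : cmod (1 - ((1 - t) ^+ 2)%:C * w) <= cmod (1 - w) + 2 * t.
  rewrite (_ : 1 - _ * w = (1 - w) + (1 - (1 - t) ^+ 2)%:C * w); last first.
    by rewrite rmorphB /=; ring.
  apply: le_trans (cmodD _ _) _; rewrite lerD2l cmodM cmodRp.
    have := cmod_ge0 w; rewrite expr2; nra.
  by rewrite expr2; nra.
have := cmod_ge0 (1 - w); set W := cmod (1 - w) => W0 A.
have : D * cmod (1 - ((1 - t) ^+ 2)%:C * w) <= D * (W + 2 * t) by rewrite ler_wpM2l.
have t1' : 0 < 1 - t by lra.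
have t2' : 1 - t < 1 by lra.
move=> B /(_ t1' t2') K.
have : t * L + 2 * (t * D) <= e by have := te; lra.
by lra.
Qed.

End SchwarzPick.

(** * Bounded operators and Laurent splitting *)

Section BoundedOperators.
Variables (R : realType) (X : completeNormedModType R[i]).
Local Notation C := R[i].
Notation V := (R[i])^o.
Implicit Types (U W : set C) (f g : C -> X) (T : (C -> X) -> (C -> X)).

Definition holo U f := forall z, U z -> cdiff f z.
Definition bounded_by U f (B : R) := forall z, U z -> vnorm (f z) <= B.
Definition bhol U f := holo U f /\ exists B, bounded_by U f B.

Lemma Hinf_bhol U f : Hinf U f <-> bhol U f.
Proof.
split=> -[H1 [B H2]]; (split; [|exists B]) => z Uz.
- by apply/cder_derivable; exact: H1.
- by rewrite -vnorm_le; exact: H2.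
- by apply/cder_derivable; exact: H1.
- by rewrite vnorm_le; exact: H2.
Qed.

Definition copen U := forall z, U z -> near0 (fun h => U (z + h)).

Lemma bhol_lin U f g (a b : C) : bhol U f -> bhol U g -> bhol U (fun w => a *: f w + b *: g w).
Proof.
move=> [Hf [B HB]] [Hg [D HD]]; split=> [z Uz|].
  by apply: cdiffD; apply: cdiffZ; [exact: Hf|exact: Hg].
exists (cmod a * B + cmod b * D) => z Uz; apply: le_trans (vnormD _ _) _.
by rewrite !vnormZ lerD// ler_wpM2l ?cmod_ge0//; [exact: HB|exact: HD].
Qed.

(** Operators act on total functions; [bop_local] makes them operators on restrictions to [U]. The
    bound is required for every bound [B] of [f], so that no supremum has to be formed and constants
    multiply under composition. *)
Record bop U W T (K : R) : Prop := Bop {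
  bop_holo : forall f, bhol U f -> holo W (T f);
  bop_bound : forall f B, bhol U f -> bounded_by U f B -> bounded_by W (T f) (K * B);
  bop_local : forall f g, bhol U f -> bhol U g -> (forall z, U z -> f z = g z) ->
    forall z, W z -> T f z = T g z;
  bop_linear : forall (a b : C) f g, bhol U f -> bhol U g -> forall z, W z ->
    T (fun w => a *: f w + b *: g w) z = a *: T f z + b *: T g z }.

Lemma bop_bhol U W T K f : bop U W T K -> bhol U f -> bhol W (T f).
Proof.
move=> HT Hf; split; first exact: bop_holo HT _ Hf.
by case: (Hf) => _ [B HB]; exists (K * B); exact: bop_bound HT _ _ Hf HB.
Qed.

Lemma bop_Hinf U W T K : bop U W T K -> Hinf_linop U W T /\ opnorm_le U W T K.
Proof.
move=> HT; split; first split.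
- by move=> f /Hinf_bhol Hf; apply/Hinf_bhol; exact: bop_bhol HT Hf.
- by move=> f g /Hinf_bhol Hf /Hinf_bhol Hg; exact: bop_local HT _ _ Hf Hg.
- by move=> a b f g /Hinf_bhol Hf /Hinf_bhol Hg; exact: bop_linear HT _ _ _ _ Hf Hg.
move=> f B /Hinf_bhol Hf HB z Wz; rewrite vnorm_le.
by apply: (bop_bound HT) => // w Uw; rewrite -vnorm_le; exact: HB.
Qed.

Lemma bop_comp U W Z T T' K K' : bop U W T K -> bop W Z T' K' -> bop U Z (fun f => T' (T f)) (K' * K).
Proof.
move=> HT HT'; split=> [f Hf|f B Hf HB|f g Hf Hg fg|a b f g Hf Hg z Zz].
- by apply: (bop_holo HT'); exact: bop_bhol HT Hf.
- rewrite -mulrA; apply: (bop_bound HT'); first exact: bop_bhol HT Hf.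
  exact: (bop_bound HT).
- apply: (bop_local HT'); [exact: bop_bhol HT Hf|exact: bop_bhol HT Hg|].
  exact: (bop_local HT).
rewrite -(bop_linear HT')//; try exact: bop_bhol HT _.
apply: (bop_local HT') => //.
- by apply: (bop_bhol HT); exact: bhol_lin.
- by apply: bhol_lin; exact: bop_bhol HT _.
- by move=> w Ww; exact: (bop_linear HT).
Qed.

(** Pointwise convergence with a common bound suffices: holomorphy of the limit is [cdiff_closure]
    on a small disc inside [W]. *)
Lemma bop_lim U W (T : nat -> (C -> X) -> (C -> X)) K : copen W ->
  (forall n, bop U W (T n) K) ->
  (forall f z, bhol U f -> W z -> exists l, vlim (fun n => T n f z) l) ->
  bop U W (fun f z => limn (fun n => T n f z)) K.
Proof.
move=> oW HT Hl.
have L f z : bhol U f -> W z -> vlim (fun n => T n f z) (limn (fun n => T n f z)).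
  by move=> Hf Wz; have [l H] := Hl f z Hf Wz; rewrite (vlim_limn H).
split=> [f Hf z Wz|f B Hf HB z Wz|f g Hf Hg fg z Wz|a b f g Hf Hg z Wz].
- have [rho rho0 Hr] := oW z Wz.
  have [_ [B HB]] := Hf.
  have r2 : 0 < rho / 2 by lra.
  have Wp p : cmod (p - z) <= rho / 2 -> W p.
    by move=> hp; have := Hr (p - z); rewrite [z + _]addrC subrK; apply; lra.
  apply: (@cdiff_closure R X nat (fun n => T n f) _ z (rho / 2) (K * B)) => //.
  + exact: complete_seqcomplete.
  + by move=> n p /Wp; exact: (bop_holo (HT n)).
  + by move=> n p /Wp; exact: (bop_bound (HT n)).
  move=> p q r /Wp Wp' /Wp Wq /Wp Wr e e0.
  have [N1 H1] := L f p Hf Wp' e e0; have [N2 H2] := L f q Hf Wq e e0.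
  have [N3 H3] := L f r Hf Wr e e0.
  exists (maxn N1 (maxn N2 N3)); split; [apply: H1|apply: H2|apply: H3].
  + by rewrite leq_maxl.
  + by rewrite leq_max leq_maxl orbT.
  + by rewrite leq_max leq_maxr orbT.
- apply: (@vlim_le _ _ _ _ _ 0%N _ (L f z Hf Wz)) => n _.
  exact: (bop_bound (HT n)).
- congr (limn _); apply/funext => n; exact: (bop_local (HT n)).
- apply: vlim_limn; apply: vlim_ext (vlimD (vlimZ a (L f z Hf Wz)) (vlimZ b (L g z Hg Wz))) => n.
  by rewrite (bop_linear (HT n)).
Qed.

End BoundedOperators.

(** * Laurent decomposition on an annulus *)

Section Laurent.
Variables (R : realType) (X : completeNormedModType R[i]).
Local Notation C := R[i].
Notation V := (R[i])^o.
Implicit Types (f g H : C -> X).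

Lemma trap_cdiff n (G : C -> C -> X) p v w : (forall t, 0 <= t <= 1 -> cdiff (G (p + t%:C * v)) w) ->
  cdiff (fun u => trap n (fun z => G z u) p v) w.
Proof.
elim: n p v => [|n IH] p v HG /=.
  apply: cdiffZ; apply: cdiffD.
    by have := HG 0; rewrite rmorph0 mul0r addr0; apply; rewrite lexx ler01.
  by have := HG 1; rewrite rmorph1 mul1r; apply; rewrite lexx ler01.
apply: cdiffZ; apply: cdiffD; apply: IH => t t01.
  by rewrite seg_left; apply: HG; lra.
by rewrite seg_right; apply: HG; lra.
Qed.

Lemma cmean_cdiff n (G : C -> C -> X) s w : 0 < s -> (forall z, cmod z = s -> cdiff (G z) w) ->
  cdiff (fun u => cmean n (fun z => G z u) s) w.
Proof.
move=> s0 HG; apply: (@trap_cdiff n (fun z => G (cexp z))) => t _; apply: HG; exact: circle_pt.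
Qed.

Lemma limn_cmean f s : 0 < s -> (forall z, cmod z = s -> ccont f z) ->
  vlim (fun n => cmean n f s) (limn (fun n => cmean n f s)).
Proof.
move=> s0 Hc; have [l Hl] := cmean_cvg (@complete_seqcomplete R X) s0 Hc.
by rewrite (vlim_limn Hl).
Qed.

Lemma limn_cmean_cdiff (G : C -> C -> X) s (w0 : C) (rho B : R) : 0 < s -> 0 < rho ->
  (forall u z, cmod (u - w0) <= rho -> cmod z = s ->
    [/\ ccont (G^~ u) z, cdiff (G z) u & vnorm (G z u) <= B]) ->
  cdiff (fun u => limn (fun n => cmean n (G^~ u) s)) w0.
Proof.
move=> s0 rho0 HG.
have L u : cmod (u - w0) <= rho -> vlim (fun n => cmean n (G^~ u) s) (limn (fun n => cmean n (G^~ u) s)).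
  by move=> hu; apply: limn_cmean => // z zs; case: (HG u z hu zs).
apply: (@cdiff_closure R X nat (fun n u => cmean n (G^~ u) s) _ w0 rho B) => //.
- exact: complete_seqcomplete.
- by move=> n u hu; apply: cmean_cdiff => // z zs; case: (HG u z hu zs).
- by move=> n u hu; apply: cmean_le => // z zs; case: (HG u z hu zs).
move=> p q r hp hq hr e e0.
have [N1 H1] := L p hp e e0; have [N2 H2] := L q hq e e0; have [N3 H3] := L r hr e e0.
exists (maxn N1 (maxn N2 N3)); split; [apply: H1|apply: H2|apply: H3].
+ by rewrite leq_maxl.
+ by rewrite leq_max leq_maxl orbT.
+ by rewrite leq_max leq_maxr orbT.
Qed.

Definition cauchy_transform s H (w : C) : X := limn (fun n => cmean n (fun z => (z / (z - w)) *: H z) s).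

Variables (a b : R).
Hypotheses (a0 : 0 < a) (ab : a < b).

Definition annulus : set C := [set w | a < cmod w < b].

(** The radius varies with [w] only to keep the circle inside the annulus and beyond [w]; by
    [cauchy_transform_indep] the value does not depend on it, and near a given point one radius may
    be fixed. *)
Definition laurent_in H w := cauchy_transform ((Num.max a (cmod w) + b) / 2) H w.
Definition laurent_out H w := - cauchy_transform ((a + Num.min (cmod w) b) / 2) H w.

Section Fixed.
Variables (H : C -> X) (K : R).
Hypotheses (dH : holo annulus H) (bH : bounded_by annulus H K).

Lemma annulus_ge0 : 0 <= K.
Proof.
have [a0' ab'] := conj a0 ab.
have A : annulus ((a + b) / 2)%:C by rewrite /annulus /= cmodRp; lra.
by apply: le_trans (bH A); exact: vnorm_ge0.
Qed.

Let cH z : annulus z -> ccont H z.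
Proof. by move=> Az; apply: cdiff_cont; exact: dH. Qed.

Lemma kernel_cont z w : z != w -> annulus z -> ccont (fun z => (z / (z - w)) *: H z) z.
Proof. by move=> zw Az; apply: ccontM; [apply: cdiff_cont; exact: cdiff_kernel|exact: cH]. Qed.

Lemma cauchy_transform_lim s w : a < s < b -> cmod w != s ->
  vlim (fun n => cmean n (fun z => (z / (z - w)) *: H z) s) (cauchy_transform s H w).
Proof.
have [a0' ab'] := conj a0 ab.
move=> sab ws; apply: limn_cmean => [|z zs]; first by lra.
apply: kernel_cont; first by apply: cmod_neq; rewrite zs eq_sym.
by rewrite /annulus /= zs.
Qed.

Lemma cauchy_transform_indep s1 s2 w : a < s1 -> s1 < s2 -> s2 < b ->
  cmod w < s1 \/ s2 < cmod w -> cauchy_transform s1 H w = cauchy_transform s2 H w.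
Proof.
have [a0' ab'] := conj a0 ab.
move=> as1 s12 s2b hw.
have n1 : cmod w != s1 by rewrite neq_lt; case: hw => ?; apply/orP; [left|right]; lra.
have n2 : cmod w != s2 by rewrite neq_lt; case: hw => ?; apply/orP; [left|right]; lra.
have L1 : vlim (fun n => cmean n (fun z => (z / (z - w)) *: H z) s1) (cauchy_transform s1 H w).
  by apply: cauchy_transform_lim => //; lra.
have L2 : vlim (fun n => cmean n (fun z => (z / (z - w)) *: H z) s2) (cauchy_transform s2 H w).
  by apply: cauchy_transform_lim => //; lra.
have A : vlim (fun n => cmean n (fun z => (z / (z - w)) *: H z) s2 -
    cmean n (fun z => (z / (z - w)) *: H z) s1) 0.
  apply: (@cmean_annulus R X _ s1 s2 (s2 + 1)); try by lra.
    move=> z hz _; apply: cdiffM; last by apply: dH; rewrite /annulus /=; lra.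
    apply: cdiff_kernel; apply: cmod_neq; case: hw => ?; [rewrite gt_eqF//|rewrite lt_eqF//]; lra.
  by move=> z hz ?; lra.
have := vlim_unique A (vlimB L2 L1) => /esym/eqP; rewrite subr_eq0 => /eqP -> //.
Qed.

Lemma laurent_inE s w : a < s -> s < b -> cmod w < s -> laurent_in H w = cauchy_transform s H w.
Proof.
have [a0' ab'] := conj a0 ab.
move=> as_ sb ws; rewrite /laurent_in.
have M : Num.max a (cmod w) < s by rewrite gt_max as_.
have Ma : a <= Num.max a (cmod w) by rewrite le_max lexx.
have Mw : cmod w <= Num.max a (cmod w) by rewrite le_max lexx orbT.
set m := Num.max _ _ in M Ma Mw *.
have [h|h|->//] := ltgtP ((m + b) / 2) s.
  by apply: cauchy_transform_indep => //; [lra|left; lra].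
by symmetry; apply: cauchy_transform_indep => //; [lra|left; lra].
Qed.

Lemma laurent_outE s w : a < s -> s < b -> s < cmod w -> laurent_out H w = - cauchy_transform s H w.
Proof.
have [a0' ab'] := conj a0 ab.
move=> as_ sb ws; rewrite /laurent_out; congr (- _).
have M : s < Num.min (cmod w) b by rewrite lt_min ws.
have Ma : Num.min (cmod w) b <= b by rewrite ge_min lexx orbT.
have Mw : Num.min (cmod w) b <= cmod w by rewrite ge_min lexx.
set m := Num.min _ _ in M Ma Mw *.
have [h|h|->//] := ltgtP ((a + m) / 2) s.
  by apply: cauchy_transform_indep => //; [lra|right; lra].
by symmetry; apply: cauchy_transform_indep => //; [lra|right; lra].
Qed.

Lemma laurent_sum w : annulus w -> laurent_in H w + laurent_out H w = H w.
Proof.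
have [a0' ab'] := conj a0 ab.
move=> /andP[aw wb].
pose s1 := (a + cmod w) / 2; pose s2 := (cmod w + b) / 2.
have [h1 h2 h3 h4] : [/\ a < s1, s1 < cmod w, cmod w < s2 & s2 < b] by rewrite /s1 /s2; split; lra.
rewrite (@laurent_inE s2)//; last by lra.
rewrite (@laurent_outE s1)//; last by lra.
have C0 := @cauchy_annulus R X H s1 s2 w _ h2 h3.
apply/esym; apply: vlim_unique (C0 _ _) _; first by lra.
  by move=> z hz; apply: dH; rewrite /annulus /=; lra.
apply: vlimB; apply: cauchy_transform_lim.
- by apply/andP; split; lra.
- by rewrite neq_lt; apply/orP; left; lra.
- by apply/andP; split; lra.
- by rewrite neq_lt; apply/orP; right; lra.
Qed.

Lemma laurent_in_cdiff w : cmod w < b -> cdiff (laurent_in H) w.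
Proof.
have [a0' ab'] := conj a0 ab.
move=> wb; pose m := Num.max a (cmod w).
have mb : m < b by rewrite gt_max ab.
have am : a <= m by rewrite le_max lexx.
have wm : cmod w <= m by rewrite le_max lexx orbT.
pose s := (m + b) / 2; pose rho := (b - m) / 4.
have rho0 : 0 < rho by rewrite /rho; lra.
have su u : cmod (u - w) <= rho -> cmod u < s - rho / 2.
  by move=> hu; have := cmodD (u - w) w; rewrite subrK /s /rho in hu *; lra.
apply: (@cdiff_ext _ X (fun u => limn (fun n => cmean n (fun z => (z / (z - u)) *: H z) s))).
  exists rho => // h hh; rewrite (@laurent_inE s)//; [rewrite /s; lra|rewrite /s; lra|].
  by apply: lt_trans (su _ _) _; [rewrite addrC addKr ltW|lra].
apply: (@limn_cmean_cdiff (fun z u => (z / (z - u)) *: H z) s w rho (s / (rho / 2) * K)) => //.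
  by rewrite /s; lra.
move=> u z hu zs; have us := su u hu.
have zu : z != u by apply: cmod_neq; rewrite gt_eqF// zs; lra.
have Az : annulus z by rewrite /annulus /= zs /s; lra.
split; first exact: kernel_cont.
  apply: cdiffM; last exact: cdiff_cst.
  apply: cdiff_div; [exact: cdiff_cst|by apply: cdiffB; [exact: cdiff_cst|exact: cdiff_id]|by rewrite subr_eq0].
rewrite vnormZ; apply: ler_pM; rewrite ?cmod_ge0 ?vnorm_ge0 ?bH//.
apply: le_trans (kernel_bound _) _; first by rewrite zs; lra.
rewrite zs; apply: ler_wpM2l; first by rewrite /s; lra.
by rewrite lef_pV2 ?posrE; lra.
Qed.

Lemma laurent_in_bound1 w s : a < s < b -> cmod w < s -> vnorm (laurent_in H w) <= s / (s - cmod w) * K.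
Proof.
have [a0' ab'] := conj a0 ab.
move=> sab ws; rewrite (@laurent_inE s)//; [|lra|lra].
apply: (@vlim_le _ _ _ _ _ 0%N _ (@cauchy_transform_lim s w sab _)); last by rewrite lt_eqF.
move=> n _; apply: cmean_le => [|z zs]; first by lra.
rewrite vnormZ; apply: ler_pM; rewrite ?cmod_ge0 ?vnorm_ge0//.
  by rewrite -zs; apply: kernel_bound; rewrite zs.
by apply: bH; rewrite /annulus /= zs.
Qed.

Lemma laurent_out_bound1 w s : a < s < b -> s < cmod w -> vnorm (laurent_out H w) <= s / (cmod w - s) * K.
Proof.
have [a0' ab'] := conj a0 ab.
move=> sab ws; rewrite (@laurent_outE s)// ?vnormN; [|lra|lra].
apply: (@vlim_le _ _ _ _ _ 0%N _ (@cauchy_transform_lim s w sab _)); last by rewrite gt_eqF.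
move=> n _; apply: cmean_le => [|z zs]; first by lra.
rewrite vnormZ; apply: ler_pM; rewrite ?cmod_ge0 ?vnorm_ge0//.
  by rewrite -zs; apply: kernel_bound_out; rewrite zs.
by apply: bH; rewrite /annulus /= zs.
Qed.

(* In the coordinate [1 / u] at infinity the outer part is given by a kernel
   that is regular at [u = 0]. *)
Definition laurent_inv s u := limn (fun n => cmean n (fun z => (z * u / (1 - z * u)) *: H z) s).

Lemma laurent_invE s u : a < s < b -> u != 0 -> cmod u < s^-1 -> laurent_inv s u = laurent_out H u^-1.
Proof.
have [a0' ab'] := conj a0 ab.
move=> sab u0 us; have s0 : 0 < s by lra.
have up : 0 < cmod u by rewrite cmod_gt0.
have su : s < cmod u^-1 by rewrite cmodV -[s]invrK ltf_pV2 ?posrE// invr_gt0.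
rewrite (@laurent_outE s)//; [|lra|lra].
have /vlimN L := @cauchy_transform_lim s u^-1 sab (negbT (gt_eqF su)).
apply: vlim_limn; apply: vlim_ext L => n; rewrite -scaleN1r -cmeanZ; apply: cmean_ext => // z zs.
have zu : z - u^-1 != 0 by rewrite subr_eq0; apply: cmod_neq; rewrite zs lt_eqF.
rewrite scalerA; congr (_ *: _).
have zu' : 1 - z * u != 0.
  by apply: contraNneq zu => /eqP; rewrite subr_eq0 => /eqP E; rewrite -[z](mulfK u0) -E mul1r subrr.
have zu2 : u * z - 1 != 0 by rewrite -opprB oppr_eq0 mulrC.
have zu3 : z * u - 1 != 0 by rewrite mulrC.
by field; rewrite ?zu' ?u0 ?zu2 ?zu3.
Qed.

Lemma laurent_inv_cdiff s u : a < s < b -> cmod u < s^-1 -> cdiff (laurent_inv s) u.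
Proof.
have [a0' ab'] := conj a0 ab.
move=> sab us; have s0 : 0 < s by lra.
have u0 := cmod_ge0 u.
have us1 : cmod u * s < 1 by rewrite -ltr_pdivlMr// div1r.
pose rho := (1 - cmod u * s) / (2 * s).
have rho0 : 0 < rho by rewrite divr_gt0//; lra.
have key v : cmod (v - u) <= rho -> s * cmod v <= 1 - (1 - cmod u * s) / 2.
  move=> hv; have := cmodD (v - u) u; rewrite subrK => h.
  have : s * cmod v <= s * (rho + cmod u) by apply: ler_wpM2l; [exact: ltW|lra].
  by rewrite mulrDr /rho (_ : s * (_ / (2 * s)) = (1 - cmod u * s) / 2); [lra|field; rewrite gt_eqF].
apply: (@limn_cmean_cdiff (fun z u => (z * u / (1 - z * u)) *: H z) s u rho (1 / ((1 - cmod u * s) / 2) * K)) => //.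
move=> v z hv zs; have kv := key v hv.
have Az : annulus z by rewrite /annulus /= zs.
have zv : cmod (z * v) <= 1 - (1 - cmod u * s) / 2 by rewrite cmodM zs.
have nz : 1 - z * v != 0.
  rewrite -cmod_gt0; have := cmod_lbB 1 (z * v); rewrite cmod1; lra.
split.
- apply: ccontM; last exact: cH.
  apply: cdiff_cont; apply: cdiff_div => //.
    by apply: cdiffMs; [exact: cdiff_id|exact: cdiff_cst].
  by apply: cdiffB; [exact: cdiff_cst|apply: cdiffMs; [exact: cdiff_id|exact: cdiff_cst]].
- apply: cdiffM; last exact: cdiff_cst.
  apply: cdiff_div => //.
    by apply: cdiffMs; [exact: cdiff_cst|exact: cdiff_id].
  by apply: cdiffB; [exact: cdiff_cst|apply: cdiffMs; [exact: cdiff_cst|exact: cdiff_id]].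
rewrite vnormZ; apply: ler_pM; rewrite ?cmod_ge0 ?vnorm_ge0 ?bH//.
rewrite cmodf; apply: ler_pM; rewrite ?cmod_ge0 ?invr_ge0 ?cmod_ge0//; first by lra.
rewrite lef_pV2 ?posrE ?cmod_gt0//; last by lra.
by have := cmod_lbB 1 (z * v); rewrite cmod1; lra.
Qed.

Lemma laurent_out_cdiff w : a < cmod w -> cdiff (laurent_out H) w.
Proof.
have [a0' ab'] := conj a0 ab.
move=> aw; pose m := Num.min (cmod w) b.
have mb : m <= b by rewrite ge_min lexx orbT.
have am : a < m by rewrite lt_min aw.
have wm : m <= cmod w by rewrite ge_min lexx.
pose s := (a + m) / 2; have sab : a < s < b by rewrite /s; lra.
have sw : s < cmod w by rewrite /s; lra.
have w0 : w != 0 by rewrite -cmod_gt0; lra.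
have ws : cmod w^-1 < s^-1 by rewrite cmodV ltf_pV2 ?posrE//; lra.
have : cdiff (fun u => laurent_inv s u^-1) w.
  apply: (@cdiff_comp R X (fun u => u^-1) (laurent_inv s)); last exact: laurent_inv_cdiff.
  by apply: cdiffV => //; exact: cdiff_id.
apply: cdiff_ext; exists (cmod w - s); first by lra.
move=> h hh; have hw : s < cmod (w + h) by have := cmod_lbD w h; lra.
have wh0 : w + h != 0 by rewrite -cmod_gt0; lra.
by rewrite laurent_invE ?invrK ?invr_neq0// cmodV ltf_pV2 ?posrE//; lra.
Qed.

(** By the maximum principle only circles close to [cmod z = b] matter. There the inner part is [H]
    minus the outer part, and the latter is bounded by nearly [a / (b - a) = 1] times [K]. *)
Lemma laurent_in_bound w : b = 2 * a -> cmod w < b -> vnorm (laurent_in H w) <= 2 * K.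
Proof.
have [a0' ab'] := conj a0 ab.
move=> ba wb; apply/ler_addgt0Pr => e e0; have K0 := annulus_ge0.
pose e' := e / (K + 1); have e'0 : 0 < e' by rewrite divr_gt0//; lra.
have e'K : e' * K <= e by rewrite /e' mulrAC ler_pdivrMr; nra.
(* The last entry is [(a + eta) / (a - 2 * eta) <= 1 + e'], solved for [eta]. *)
pose eta := Num.min (Num.min (a / 4) ((b - cmod w) / 2)) (e' * a / (3 + 2 * e')).
have eta0 : 0 < eta.
  by rewrite !lt_min; apply/andP; split; [apply/andP; split; lra|apply: divr_gt0; [exact: mulr_gt0|lra]].
have eta1 : eta <= a / 4 by rewrite !ge_min lexx.
have eta2 : eta <= (b - cmod w) / 2 by rewrite !ge_min lexx orbT.
have eta3 : eta * (3 + 2 * e') <= e' * a by rewrite -ler_pdivlMr ?ge_min ?lexx ?orbT//; lra.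
apply: (@max_modulus R X _ (b - eta)); last by lra.
  by move=> z hz; apply: laurent_in_cdiff; lra.
move=> z zs; have Az : annulus z by rewrite /annulus /= zs; lra.
have -> : laurent_in H z = H z - laurent_out H z by rewrite -(laurent_sum Az) addrK.
apply: le_trans (vnormB _ _) _; have := bH Az.
have := @laurent_out_bound1 z (a + eta); rewrite zs => /(_ _ _) A.
have : (a + eta) / (b - eta - (a + eta)) <= 1 + e'.
  have -> : b - eta - (a + eta) = a - 2 * eta by lra.
  by rewrite ler_pdivrMr; lra.
move=> L; have : (a + eta) / (b - eta - (a + eta)) * K <= (1 + e') * K by rewrite ler_wpM2r.
have [h1 h2] : a < a + eta < b /\ a + eta < b - eta by lra.
by have := A h1 h2; lra.
Qed.

(** The maximum principle in the coordinate at infinity leads to circles close to [cmod z = a].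
    There the outer part is [H] minus the inner part, and the latter is bounded by nearly
    [b / (b - a) = 2] times [K]. *)
Lemma laurent_out_bound w : b = 2 * a -> a < cmod w -> vnorm (laurent_out H w) <= 3 * K.
Proof.
have [a0' ab'] := conj a0 ab.
move=> ba aw; apply/ler_addgt0Pr => e e0; have K0 := annulus_ge0.
pose e' := e / (K + 1); have e'0 : 0 < e' by rewrite divr_gt0//; lra.
have e'K : e' * K <= e by rewrite /e' mulrAC ler_pdivrMr; nra.
pose eta := Num.min (Num.min (a / 4) ((cmod w - a) / 2)) (e' * a / (3 + 2 * e')).
have eta0 : 0 < eta.
  by rewrite !lt_min; apply/andP; split; [apply/andP; split; lra|apply: divr_gt0; [exact: mulr_gt0|lra]].
have eta1 : eta <= a / 4 by rewrite !ge_min lexx.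
have eta2 : eta <= (cmod w - a) / 2 by rewrite !ge_min lexx orbT.
have eta3 : eta * (3 + 2 * e') <= e' * a by rewrite -ler_pdivlMr ?ge_min ?lexx ?orbT//; lra.
pose t := a + eta; pose s := a + eta / 2.
have sab : a < s < b by rewrite /s; lra.
have w0 : w != 0 by rewrite -cmod_gt0; lra.
have t0 : 0 < t by rewrite /t; lra.
have [wt ts] : t < cmod w /\ s < t by rewrite /t /s; lra.
rewrite -[w]invrK -(@laurent_invE s) ?invr_neq0//; last by rewrite cmodV ltf_pV2 ?posrE//; lra.
have tsV : t^-1 < s^-1 by rewrite ltf_pV2 ?posrE//; lra.
apply: (@max_modulus R X _ t^-1); last by rewrite cmodV ltf_pV2 ?posrE//; lra.
  by move=> z hz; apply: laurent_inv_cdiff => //; lra.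
move=> u ut; have u0 : u != 0 by rewrite -cmod_gt0 ut invr_gt0.
rewrite laurent_invE// ?ut//; have zs : cmod u^-1 = t by rewrite cmodV ut invrK.
set z := u^-1 in zs *.
have Az : annulus z by rewrite /annulus /= zs /t; lra.
have -> : laurent_out H z = H z - laurent_in H z by rewrite -(laurent_sum Az) addrC addKr.
apply: le_trans (vnormB _ _) _; have := bH Az.
have := @laurent_in_bound1 z (b - eta); rewrite zs => /(_ _ _) A.
have : (b - eta) / (b - eta - t) <= 2 + e'.
  have -> : b - eta - t = a - 2 * eta by rewrite /t; lra.
  by rewrite ler_pdivrMr; lra.
move=> L; have : (b - eta) / (b - eta - t) * K <= (2 + e') * K by rewrite ler_wpM2r.
have [h1 h2] : a < b - eta < b /\ t < b - eta by rewrite /t; lra.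
by have := A h1 h2; lra.
Qed.

End Fixed.

Lemma cauchy_transform_linear s (k l : C) f g w : holo annulus f -> holo annulus g -> a < s < b ->
  cmod w != s -> cauchy_transform s (fun z => k *: f z + l *: g z) w =
  k *: cauchy_transform s f w + l *: cauchy_transform s g w.
Proof.
have [a0' ab'] := conj a0 ab.
move=> df dg sab ws; have s0 : 0 < s by lra.
have := vlimD (vlimZ k (cauchy_transform_lim df sab ws)) (vlimZ l (cauchy_transform_lim dg sab ws)).
move=> L; apply: vlim_limn; apply: vlim_ext L => n.
rewrite -!cmeanZ -cmeanD; apply: cmean_ext => // z _; lmodule R[i] X.
Qed.

Lemma cauchy_transform_local s f g w : a < s < b -> (forall z, annulus z -> f z = g z) ->
  cauchy_transform s f w = cauchy_transform s g w.
Proof.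
have [a0' ab'] := conj a0 ab.
move=> sab fg; congr (limn _); apply/funext => n; apply: cmean_ext; first by lra.
by move=> z zs; rewrite fg// /annulus /= zs.
Qed.

Lemma laurent_in_radius w : cmod w < b -> a < (Num.max a (cmod w) + b) / 2 < b /\ cmod w != (Num.max a (cmod w) + b) / 2.
Proof.
have [a0' ab'] := conj a0 ab.
move=> wb; have M : Num.max a (cmod w) < b by rewrite gt_max ab.
have Ma : a <= Num.max a (cmod w) by rewrite le_max lexx.
have Mw : cmod w <= Num.max a (cmod w) by rewrite le_max lexx orbT.
by split; [lra|rewrite lt_eqF//; lra].
Qed.

Lemma laurent_out_radius w : a < cmod w -> a < (a + Num.min (cmod w) b) / 2 < b /\ cmod w != (a + Num.min (cmod w) b) / 2.
Proof.
have [a0' ab'] := conj a0 ab.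
move=> aw; have M : a < Num.min (cmod w) b by rewrite lt_min aw.
have Ma : Num.min (cmod w) b <= b by rewrite ge_min lexx orbT.
have Mw : Num.min (cmod w) b <= cmod w by rewrite ge_min lexx.
by split; [lra|rewrite gt_eqF//; lra].
Qed.

Lemma bop_laurent_in : b = 2 * a -> bop annulus [set w | cmod w < b] laurent_in 2.
Proof.
have [a0' ab'] := conj a0 ab.
move=> ba; split=> [f [df [B HB]] w wb|f B [df _] HB w wb|f g _ _ fg w wb|k l f g [df _] [dg _] w wb].
- exact: laurent_in_cdiff df HB _ wb.
- exact: laurent_in_bound.
- by apply: cauchy_transform_local => //; case: (laurent_in_radius wb).
- by case: (laurent_in_radius wb) => ? ?; exact: cauchy_transform_linear.
Qed.

Lemma bop_laurent_out : b = 2 * a -> bop annulus [set w | a < cmod w] laurent_out 3.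
Proof.
have [a0' ab'] := conj a0 ab.
move=> ba; split=> [f [df [B HB]] w wb|f B [df _] HB w wb|f g _ _ fg w wb|k l f g [df _] [dg _] w wb].
- exact: laurent_out_cdiff df HB _ wb.
- exact: laurent_out_bound.
- by congr (- _); apply: cauchy_transform_local => //; case: (laurent_out_radius wb).
- case: (laurent_out_radius wb) => ? ?; rewrite /laurent_out cauchy_transform_linear//.
  by lmodule R[i] X.
Qed.

End Laurent.

(** * Branches of the inverse of a Blaschke product *)

Section FixedPoints.
Variable R : realType.
Local Notation C := R[i].
Notation V := (R[i])^o.
Implicit Types a z w u v c : C.

Lemma geometric_small (t : R) : 0 <= t -> t < 1 -> forall e, 0 < e ->
  exists N, forall n, (N <= n)%N -> t ^+ n <= e.
Proof.
move=> t0 t1 e e0.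
have /cvgrPdist_le/(_ e e0)[N _ HN] : (fun n => t ^+ n) @ \oo --> (0 : R).
  by apply: cvg_expr; rewrite ger0_norm.
exists N => n /HN /=; rewrite sub0r normrN ger0_norm ?exprn_ge0//.
Qed.

(** For [x = conjc q * p] this compares the denominators of the pseudo-hyperbolic distances before
    and after multiplication of [p], [q] by a number of modulus [k], and so gives the contraction
    factor [2 * k / (1 + k ^+ 2)]. Equality holds at [x = -1]. *)
Lemma contraction_factor (x : C) (k : R) : cmod x <= 1 -> 0 <= k -> k < 1 ->
  cmod (1 - x) * (1 + k ^+ 2) <= 2 * cmod (1 - (k ^+ 2)%:C * x).
Proof.
move=> x1 k0 k1.
have a0 : 0 <= 1 + k ^+ 2 by rewrite addr_ge0 ?sqr_ge0.
rewrite -ler_sqr ?nnegrE ?mulr_ge0 ?cmod_ge0//.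
have [hp _] := normReIm x; have t0 := cmod_ge0 x.
have tp : - cmod x <= complex.Re x by have := ler_norm (- complex.Re x); rewrite normrN; lra.
rewrite !exprMn [cmod (1 - x) ^+ 2]cmod_sqE [cmod (1 - _ * x) ^+ 2]cmod_sqE.
have := cmod_sqE x; move: (cmod x) t0 x1 tp => t t0 t1 tp E.
case: x E tp {hp} => p q /= E tp.
have s1 : k ^+ 2 <= 1 by rewrite expr2; nra.
have s0 := sqr_ge0 k; move: (k ^+ 2) s0 s1 => s s0 s1.
(* The difference of the squares as a sum of nonnegative terms, with [s] the square of [k], [t] the
   modulus and [p] the real part of [x]. *)
rewrite -subr_ge0 (_ : _ - _ = 2 * (p + t) * (1 - s) ^+ 2 +
   (1 - t) * ((1 - s) * (3 + s) + t * ((1 - s) * (1 + 3 * s)))).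
  apply: addr_ge0; first by rewrite !mulr_ge0 ?sqr_ge0//; lra.
  have A : 0 <= (1 - s) * (3 + s) by rewrite mulr_ge0//; lra.
  have B : 0 <= (1 - s) * (1 + 3 * s) by rewrite mulr_ge0//; lra.
  by apply: mulr_ge0; [lra|apply: addr_ge0 => //; exact: mulr_ge0].
have Eq : q ^+ 2 = t ^+ 2 - p ^+ 2 by rewrite E; ring.
rewrite (_ : _ - _ = 4 * ((1 - s * p) ^+ 2 + s ^+ 2 * q ^+ 2) - ((1 - p) ^+ 2 + q ^+ 2) * (1 + s) ^+ 2); last by ring.
by rewrite Eq; ring.
Qed.

(* Earle-Hamilton in the disc: [u |-> c * psi u] contracts the
   pseudo-hyperbolic distance, so its iterates converge. *)
Lemma disk_fixpoint (psi : C -> V) : (forall z, cmod z < 1 -> cdiff psi z) ->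
  (forall z, cmod z < 1 -> cmod (psi z) <= 1) ->
  exists Z : C -> V, forall c, cmod c < 1 ->
    [/\ cmod (Z c) <= cmod c, Z c = c * psi (Z c), cdiff Z c &
      forall u, cmod u < 1 -> u = c * psi u -> u = Z c].
Proof.
move=> Hd HB.
pose it c n := iter n (fun u => c * psi u) 0.
have it1 c n : cmod c < 1 -> cmod (it c n) <= cmod c /\ cmod (it c n) < 1.
  move=> c1; have c0 := cmod_ge0 c; elim: n => [|n [IH1 IH2]]; first by rewrite /it /= cmod0; split; lra.
  rewrite /it iterS -/(it c n) cmodM; have := HB _ IH2; have := cmod_ge0 (psi (it c n)).
  by split; nra.
(* The pseudo-hyperbolic distance between [c] and [- c]; Schwarz-Pick for [psi] followed by
   [contraction_factor] makes it a contraction constant. *)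
pose th c : R := 2 * cmod c / (1 + cmod c ^+ 2).
have thE c : cmod c < 1 -> 0 <= th c /\ th c < 1.
  move=> c1; have c0 := cmod_ge0 c; have D : 0 < 1 + cmod c ^+ 2 by rewrite ltr_pwDl ?sqr_ge0.
  rewrite /th divr_ge0 ?mulr_ge0// ?(ltW D)// ltr_pdivrMr//; split => //.
  by have := sqr_ge0 (1 - cmod c); rewrite expr2 => ?; have : 0 < (1 - cmod c) * (1 - cmod c); [nra|rewrite expr2; lra].
have contr c u v : cmod c < 1 -> cmod u < 1 -> cmod v < 1 ->
    cmod (blf (c * psi v) (c * psi u)) <= th c * cmod (blf v u).
  move=> c1 u1 v1; have c0 := cmod_ge0 c.
  have S := schwarz_pick Hd HB u1 v1.
  have pu := HB u u1; have pv := HB v v1.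
  have D : 0 < 1 + cmod c ^+ 2 by rewrite ltr_pwDl ?sqr_ge0.
  have d2 : 0 < cmod (1 - conjc v * u) by rewrite cmod_gt0 blf_den// cmod_mul_lt1// ltW.
  have cE : conjc (c * psi v) * (c * psi u) = (cmod c ^+ 2)%:C * (conjc (psi v) * psi u).
    by rewrite conjcM sqr_cmod; ring.
  have d1 : 0 < cmod (1 - conjc (c * psi v) * (c * psi u)).
    rewrite cmod_gt0 blf_den// !cmodM; have := cmod_ge0 (psi u); have := cmod_ge0 (psi v).
    by move=> p0 q0; have h1 : cmod c * cmod (psi v) <= cmod c; [nra|]; have h2 : cmod c * cmod (psi u) <= cmod c; [nra|]; have : 0 <= cmod c * cmod (psi v); [nra|]; have : 0 <= cmod c * cmod (psi u); [nra|]; nra.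
  rewrite /blf !cmodf ler_pdivrMr// -mulrBr cmodM.
  have x1 : cmod (conjc (psi v) * psi u) <= 1.
    by rewrite cmodM cmodJ; have := cmod_ge0 (psi u); have := cmod_ge0 (psi v); nra.
  have := contraction_factor x1 c0 c1; rewrite -cE.
  set M := cmod (1 - _ * (c * psi u)) in d1 *; set N := cmod (1 - conjc (psi v) * psi u) in S * => F.
  rewrite /th; set E := cmod (psi u - psi v) in S *; set G := cmod (u - v) in S *.
  set H := cmod (1 - conjc v * u) in d2 S *.
  rewrite (_ : _ * (G / H) * M = cmod c * ((G * (2 * M)) / ((1 + cmod c ^+ 2) * H))); last first.
    by field; rewrite !gt_eqF.
  rewrite ler_wpM2l// ler_pdivlMr ?mulr_gt0//.
  have : G * (N * (1 + cmod c ^+ 2)) <= G * (2 * M) by rewrite ler_wpM2l ?cmod_ge0.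
  have : E * H * (1 + cmod c ^+ 2) <= G * N * (1 + cmod c ^+ 2) by rewrite ler_wpM2r ?(ltW D).
  by lra.
have itn c n m : cmod c < 1 -> cmod (blf (it c n) (it c (n + m)%N)) <= th c ^+ n.
  move=> c1; have [t0 t1] := thE c c1; elim: n => [|n IH].
    rewrite add0n expr0 /it /= -/(it c m) /blf rmorph0 mul0r !subr0 divr1.
    by apply: ltW; case: (it1 c m c1).
  rewrite addSn /it !iterS -/(it c n) -/(it c (n + m)%N) exprS.
  apply: le_trans (contr c _ _ c1 _ _) _; [by case: (it1 c (n + m)%N c1)|by case: (it1 c n c1)|].
  by rewrite ler_wpM2l.
have eucl a z : cmod a < 1 -> cmod z < 1 -> cmod (z - a) <= 2 * cmod (blf a z).
  move=> a1 z1; have d2 : 0 < cmod (1 - conjc a * z) by rewrite cmod_gt0 blf_den// cmod_mul_lt1// ltW.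
  rewrite /blf cmodf mulrA ler_pdivlMr// mulrC.
  have : cmod (1 - conjc a * z) <= 2.
    apply: le_trans (cmodB _ _) _; rewrite cmod1 cmodM cmodJ.
    by have := cmod_ge0 a; have := cmod_ge0 z; nra.
  by have := cmod_ge0 (z - a); nra.
have itc c : cmod c < 1 -> exists l : V, vlim (fun n => it c n : V) l.
  move=> c1; apply: scalar_complete => e e0; have [t0 t1] := thE c c1.
  have e2 : 0 < e / 4 by lra.
  have [N HN] := geometric_small t0 t1 e2.
  have key n : (N <= n)%N -> cmod (it c n - it c N) <= e / 2.
    move=> Nn; rewrite -(subnKC Nn).
    have [_ a1] := it1 c N c1; have [_ b1] := it1 c (N + (n - N))%N c1.
    have := eucl _ _ a1 b1; have := itn c N (n - N)%N c1; have := HN N (leqnn _); lra.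
  exists N => n m /key A /key B; rewrite vnorm_scal.
  by have := @vnorm_tri R V (it c n) (it c N) (it c m); rewrite !vnorm_scal (cmodC (it c N)); lra.
pose Z c : V := limn (fun n => it c n : V).
have ZL c : cmod c < 1 -> vlim (fun n => it c n : V) (Z c).
  by move=> c1; have [l Hl] := itc c c1; rewrite /Z (vlim_limn Hl).
have Zb c : cmod c < 1 -> cmod (Z c) <= cmod c.
  move=> c1; rewrite -vnorm_scal; apply: (@vlim_le _ _ _ _ _ 0%N _ (ZL c c1)) => n _.
  by case: (it1 c n c1).
exists Z => c c1; have Zc1 : cmod (Z c) < 1 by have := Zb c c1; lra.
have Zfix : Z c = c * psi (Z c).
  have L1 : vlim (fun n => it c n.+1 : V) (Z c).
    by move=> e /(ZL c c1)[N HN]; exists N => n Nn; apply: HN; exact: leqW.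
  apply: vlim_unique L1 _; apply: (@vlimZ R V c (fun n => psi (it c n)) (psi (Z c))) => e e0.
  have [eta eta0 He] := cdiff_cont (Hd _ Zc1) e0.
  have eta2 : 0 < eta / 2 by lra.
  have [N HN] := ZL c c1 _ eta2; exists N => n /HN; rewrite vnorm_scal => A.
  have := He (it c n - Z c); rewrite [Z c + _]addrC subrK; apply; lra.
split=> //; first exact: Zb.
- apply: (@cdiff_closure R V nat (fun n c => it c n : V) _ c ((1 - cmod c) / 2) 1).
  + exact: scalar_complete.
  + by lra.
  + move=> n z hz; have z1 : cmod z < 1 by have := cmodD (z - c) c; rewrite subrK; lra.
    elim: n => [|n IH]; first exact: cdiff_cst.
    apply: (@cdiff_ext _ V (fun z => z * psi (it z n))); first by exists 1.
    apply: cdiffMs; first exact: cdiff_id.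
    apply: (@cdiff_comp R V (fun z => it z n) psi) => //.
    by apply: Hd; case: (it1 z n z1).
  + move=> n z hz; have z1 : cmod z < 1 by have := cmodD (z - c) c; rewrite subrK; lra.
    by rewrite vnorm_scal; apply: ltW; case: (it1 z n z1).
  have W z : cmod (z - c) <= (1 - cmod c) / 2 -> cmod z < 1.
    by move=> hz; have := cmodD (z - c) c; rewrite subrK; lra.
  move=> p q r /W hp /W hq /W hr e e0.
  have [N1 H1] := ZL p hp e e0; have [N2 H2] := ZL q hq e e0; have [N3 H3] := ZL r hr e e0.
  exists (maxn N1 (maxn N2 N3)); split; [apply: H1|apply: H2|apply: H3].
  + by rewrite leq_maxl.
  + by rewrite leq_max leq_maxl orbT.
  + by rewrite leq_max leq_maxr orbT.
move=> u u1 Eu; have [t0 t1] := thE c c1.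
have := contr c u (Z c) c1 u1 Zc1; rewrite -Eu -Zfix => A.
have B0 := cmod_ge0 (blf (Z c) u).
have E := eucl (Z c) u Zc1 u1.
have : cmod (blf (Z c) u) <= 0 by nra.
move=> B1; apply/eqP; rewrite -subr_eq0 -cmod_eq0 eq_le cmod_ge0 andbT; lra.
Qed.

(** Schwarz-Pick keeps [h z] within pseudo-hyperbolic distance [l] of [h a]. The point of such a
    disc closest to 0 has modulus [(p - l) / (1 - l * p)] with [p = cmod (h a)], which increases
    with [p]. *)
Lemma schwarz_pick_lower (h : C -> V) a z (d l : R) : (forall z, cmod z < 1 -> cdiff h z) ->
  (forall z, cmod z < 1 -> cmod (h z) <= 1) -> cmod a < 1 -> cmod z < 1 ->
  0 <= l < 1 -> 0 <= d <= 1 -> d <= cmod (h a) -> cmod (blf a z) <= l ->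
  (d - l) / (1 - l * d) <= cmod (h z).
Proof.
move=> Hd HB a1 z1 hl hd dh bl.
have d2 : 0 < cmod (1 - conjc a * z) by rewrite cmod_gt0 blf_den// cmod_mul_lt1// ltW.
have S := schwarz_pick Hd HB z1 a1.
have zl : cmod (z - a) <= l * cmod (1 - conjc a * z).
  by move: bl; rewrite /blf cmodf ler_pdivrMr.
have pa := HB a a1; have pz := HB z z1; have z0 := cmod_ge0 (h z).
have ld : 0 < 1 - l * d by nra.
rewrite ler_pdivrMr//.
have S1 : cmod (h z - h a) <= l * cmod (1 - conjc (h a) * h z).
  have : cmod (h z - h a) * cmod (1 - conjc a * z) <= l * cmod (1 - conjc (h a) * h z) * cmod (1 - conjc a * z).
    apply: le_trans S _; rewrite mulrAC; apply: ler_wpM2r => //; exact: cmod_ge0.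
  by rewrite ler_pM2r.
have I := blf_identity (h a) (h z).
set p := cmod (h a) in pa dh I *; set q := cmod (h z) in pz z0 I *.
have pq : p - q <= cmod (h z - h a) by rewrite cmodC; exact: cmod_lbB.
set x := cmod (h z - h a) in S1 I pq; set y := cmod (1 - _) in S1 I.
have x0 : 0 <= x := cmod_ge0 _. have y0 : 0 <= y := cmod_ge0 _.
have key : p - q <= l * (1 - p * q).
  have [pq0|pq0] := leP (p - q) 0.
    by apply: le_trans pq0 _; rewrite mulr_ge0//; [lra|nra].
  have L : 0 <= l * (1 - p * q) by rewrite mulr_ge0//; [lra|nra].
  rewrite -ler_sqr ?nnegrE ?(ltW pq0)// exprMn.
  have X2 : x ^+ 2 <= l ^+ 2 * y ^+ 2 by rewrite -exprMn ler_sqr ?nnegrE// mulr_ge0//; lra.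
  have P2 : (p - q) ^+ 2 <= x ^+ 2 by rewrite ler_sqr ?nnegrE// ltW.
  have l2 : 0 < 1 - l ^+ 2 by rewrite expr2; nra.
  have E1 : x ^+ 2 * (1 - l ^+ 2) <= l ^+ 2 * ((1 - p ^+ 2) * (1 - q ^+ 2)) by rewrite -I; lra.
  have : (p - q) ^+ 2 * (1 - l ^+ 2) <= x ^+ 2 * (1 - l ^+ 2) by rewrite ler_wpM2r// ltW.
  have -> : (1 - p * q) ^+ 2 = (1 - p ^+ 2) * (1 - q ^+ 2) + (p - q) ^+ 2 by ring.
  by lra.
have l0 : 0 <= l by lra.
have : d * (1 + l * q) <= p * (1 + l * q) by rewrite ler_wpM2r// addr_ge0 ?mulr_ge0.
by lra.
Qed.

(** The origin of [r]. In the coordinate [blf a z = l * u] the equation [blf a z * h z = w] reads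
    [u = w / r * psi u] with [psi u = mu / h (ze u)]. Here [mu] is the lower bound of
    [schwarz_pick_lower] for [h], so [psi] has modulus at most 1 and [disk_fixpoint] applies exactly
    when [cmod w < r = mu * l]. *)
Lemma local_inverse (h : C -> V) a (d l : R) : (forall z, cmod z < 1 -> cdiff h z) ->
  (forall z, cmod z < 1 -> cmod (h z) <= 1) -> cmod a < 1 -> 0 < l -> l < d -> d < 1 ->
  d <= cmod (h a) -> let r := (d - l) / (1 - l * d) * l in
  exists b : C -> V, forall w, cmod w < r ->
    [/\ cmod (b w) < 1, cmod (blf a (b w)) < l, blf a (b w) * h (b w) = w, cdiff b w &
      forall z, cmod z < 1 -> cmod (blf a z) < l -> blf a z * h z = w -> z = b w].
Proof.
move=> Hd HB a1 l0 ld d1 dh r.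
pose mu := (d - l) / (1 - l * d).
have ld0 : 0 < 1 - l * d by nra.
have mu0 : 0 < mu by rewrite divr_gt0//; lra.
have r0 : 0 < r by rewrite mulr_gt0.
have Na1 : cmod (- a) < 1 by rewrite cmodN.
have rC : r%:C = mu%:C * l%:C by rewrite -rmorphM.
have l0C : l%:C != 0 :> C by rewrite -cmod_gt0 cmodRp ?ltW.
have mu0C : mu%:C != 0 :> C by rewrite -cmod_gt0 cmodRp ?ltW.
have lz z : cmod z < 1 -> cmod (l%:C * z) < l.
  by move=> z1; rewrite cmodM cmodRp ?(ltW l0)// -[ltRHS]mulr1 ltr_pM2l.
have lz1 z : cmod z < 1 -> cmod (l%:C * z) < 1 by move=> /lz; lra.
pose ze u := blf (- a) (l%:C * u).
have ze1 u : cmod u < 1 -> cmod (ze u) < 1 by move=> /lz1; exact: blf_lt1.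
have zeK u : cmod u < 1 -> blf a (ze u) = l%:C * u.
  by move=> /lz1/ltW; exact: blfNK.
have hmu u : cmod u < 1 -> mu <= cmod (h (ze u)).
  move=> u1; apply: (@schwarz_pick_lower h a) => //; [exact: ze1|lra|lra|].
  by rewrite zeK// ltW// lz.
have hn0 u : cmod u < 1 -> h (ze u) != 0.
  by move=> /hmu; rewrite -cmod_gt0; apply: lt_le_trans.
pose psi u : V := mu%:C / h (ze u).
have psid u : cmod u < 1 -> cdiff psi u.
  move=> u1; apply: cdiff_div; [exact: cdiff_cst| |exact: hn0].
  apply: (@cdiff_comp R V ze h); last by apply: Hd; exact: ze1.
  apply: (@cdiff_comp R V (fun u => l%:C * u) (blf (- a))).
    by apply: cdiffMs; [exact: cdiff_cst|exact: cdiff_id].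
  by apply: cdiff_blf; apply: cmod_mul_lt1 => //; apply: ltW; exact: lz1.
have psi1 u : cmod u < 1 -> cmod (psi u) <= 1.
  move=> u1; rewrite /psi cmodf cmodRp ?(ltW mu0)// ler_pdivrMr ?mul1r ?hmu//.
  by apply: lt_le_trans mu0 (hmu u u1).
have [Z HZ] := disk_fixpoint psid psi1.
have rc w : cmod w < r -> cmod (w / r%:C) < 1.
  by move=> wr; rewrite cmodf cmodRp ?(ltW r0)// ltr_pdivrMr// mul1r.
exists (fun w => ze (Z (w / r%:C))) => w wr.
have [Z1 Z2 Z3 Z4] := HZ _ (rc w wr).
set u := Z (w / r%:C) in Z1 Z2 Z4 *; have u1 : cmod u < 1 by have := rc w wr; lra.
have fixE v : cmod v < 1 -> (v = w / r%:C * psi v) <-> (l%:C * v * h (ze v) = w).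
  move=> v1; have := hn0 v v1; rewrite /psi rC; set H := h _ => H0; split=> [->|<-].
    by field; rewrite H0 l0C mu0C.
  by field; rewrite H0 l0C mu0C.
split.
- exact: ze1.
- by rewrite zeK// lz.
- by rewrite zeK//; apply/(fixE u u1).
- apply: (@cdiff_comp R V (fun w => l%:C * Z (w / r%:C)) (blf (- a))); last first.
    by apply: cdiff_blf; apply: cmod_mul_lt1 => //; apply: ltW; exact: lz1.
  apply: cdiffMs; first exact: cdiff_cst.
  apply: (@cdiff_comp R V (fun w => w / r%:C) Z) => //.
  by apply: cdiffMs; [exact: cdiff_id|exact: cdiff_cst].
move=> z z1 zl Ez; pose v := blf a z / l%:C.
have v1 : cmod v < 1 by rewrite /v cmodf cmodRp ?(ltW l0)// ltr_pdivrMr// mul1r.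
have lv : l%:C * v = blf a z by rewrite /v mulrC divfK.
have zev : ze v = z by rewrite /ze lv blfK// ltW.
by rewrite -(Z4 v v1)// fixE// lv zev.
Qed.

End FixedPoints.

(** * Blaschke products and their level sets *)

Section BlaschkeProducts.
Variable R : realType.
Local Notation C := R[i].
Notation V := (R[i])^o.
Implicit Types a w u v c : C.

Lemma size_prod_linear (F : nat -> {poly C}) n : (forall i, (size (F i) <= 2)%N) ->
  (size (\prod_(i < n) F i)%R <= n.+1)%N.
Proof.
move=> HF; elim: n => [|n IH]; first by rewrite big_ord0 size_poly1.
rewrite big_ord_recr /=; apply: leq_trans (size_polyMleq _ _) _.
rewrite -subn1 leq_subLR add1n; apply: leq_trans (leq_add IH (HF n)) _.
by rewrite addn2.
Qed.

Definition blphase a : C := if a == 0 then 1 else - ((cmod a)%:C / a).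

Lemma bfactorE a w : bfactor a w = blphase a * blf a w.
Proof.
rewrite /bfactor /blphase /blf; have [->|a0] := eqVneq a 0.
  by rewrite rmorph0 mul0r !subr0 divr1 mul1r.
by rewrite mulNr -mulrN -[- (_ / _)]mulNr opprB mulrA.
Qed.

Lemma cmod_blphase a : cmod (blphase a) = 1.
Proof.
rewrite /blphase; case: eqVneq => [_|a0]; first exact: cmod1.
by rewrite cmodN cmodf cmodRp ?cmod_ge0// divff// cmod_eq0.
Qed.

Lemma cmod_bfactor a w : cmod (bfactor a w) = cmod (blf a w).
Proof. by rewrite bfactorE cmodM cmod_blphase mul1r. Qed.

(** The phase of [bfactor] makes [1 - cmod a] split off; with the Blaschke condition this gives
    convergence of the product. *)
Lemma bfactor_near1 a w : cmod a < 1 -> cmod w < 1 ->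
  cmod (1 - bfactor a w) <= (1 - cmod a) * (2 / (1 - cmod w)).
Proof.
move=> a1 w1; have w0 := cmod_ge0 w; have a0 := cmod_ge0 a.
rewrite /bfactor; have [->|an0] := eqVneq a 0.
  rewrite cmod0 subr0 mul1r ler_pdivlMr; last by lra.
  by have := cmodB 1 w; rewrite cmod1; have := cmod_ge0 (1 - w); nra.
have d0 : 1 - conjc a * w != 0 by rewrite blf_den// cmod_mul_lt1// ltW.
have aa : a * conjc a = (cmod a)%:C * (cmod a)%:C by rewrite -sqr_cmod rmorphXn.
rewrite (_ : 1 - _ = (1 - (cmod a)%:C) * ((a + (cmod a)%:C * w) / (a * (1 - conjc a * w)))); last first.
  have e : (1 - (cmod a)%:C) * (a + (cmod a)%:C * w) = a * (1 - conjc a * w) - (cmod a)%:C * (a - w).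
    rewrite mulrBr mulr1 mulrA aa; ring.
  rewrite mulrA e; field; by rewrite d0 an0.
have -> : 1 - (cmod a)%:C = (1 - cmod a)%:C :> C by rewrite rmorphB.
rewrite cmodM cmodRp; last by lra.
rewrite ler_wpM2l//; first by lra.
rewrite cmodf cmodM.
have h1 : cmod (a + (cmod a)%:C * w) <= cmod a * 2.
  apply: le_trans (cmodD _ _) _; rewrite cmodM cmodRp//; nra.
have h2 : 1 - cmod w <= cmod (1 - conjc a * w).
  have := cmod_lbB 1 (conjc a * w); rewrite cmod1 cmodM cmodJ; nra.
have ap : 0 < cmod a by rewrite cmod_gt0.
have dp : 0 < cmod (1 - conjc a * w) by rewrite cmod_gt0.
rewrite ler_pdivrMr ?mulr_gt0//.
apply: le_trans h1 _; rewrite mulrCA ler_pM2l// mulrAC ler_pdivlMr; last by lra.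
by rewrite ler_pM2l.
Qed.

(** Turns the lower bound [delta] for the separation products into the upper bound [delta^-1] for
    the sums of [1 - rho]. *)
Lemma prod_sum_bound (n : nat) (f : nat -> R) : (forall i, 0 <= f i <= 1) ->
  (\prod_(i < n) f i) * (1 + \sum_(i < n) (1 - f i)) <= 1.
Proof.
move=> Hf; elim: n => [|n IH]; first by rewrite !big_ord0; lra.
rewrite !big_ord_recr /=.
have P0 : 0 <= \prod_(i < n) f i by apply: prodr_ge0 => i _; case/andP: (Hf i).
have S0 : 0 <= \sum_(i < n) (1 - f i) by apply: sumr_ge0 => i _; case/andP: (Hf i); lra.
move: (\prod_(i < n) _) (\sum_(i < n) _) IH P0 S0 => P S IH P0 S0.
have /andP[f0 f1] := Hf n; move: (f n) f0 f1 => t t0 t1.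
have PS : 0 <= P * S by rewrite mulr_ge0.
have P1 : P <= 1 by lra.
have : P * t * (1 + (S + (1 - t))) = P * (1 + S) * t + P * (t * (1 - t)) by ring.
move=> ->; have tt : 0 <= t * (1 - t) by rewrite mulr_ge0//; lra.
have : P * (1 + S) * t <= 1 * t by rewrite ler_wpM2r.
have : P * (t * (1 - t)) <= 1 * (t * (1 - t)) by rewrite ler_wpM2r.
by nra.
Qed.

Lemma bounded_variation_cvg (X : normedModType R[i]) (u : nat -> X) (e : nat -> R) (S : R) :
  seqcomplete X -> (forall n, vnorm (u n.+1 - u n) <= e n) ->
  (forall n, \sum_(i < n) e i <= S) -> exists l, vlim u l.
Proof.
move=> cX Hu HS; have e0 n : 0 <= e n by apply: le_trans (Hu n); exact: vnorm_ge0.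
pose E n := \sum_(i < n) e i.
have EN : nondecreasing_seq E.
  by apply/nondecreasing_seqP => n; rewrite /E big_ord_recr /= lerDl.
have /cvg_ex[l /= /cvgrPdist_le Hl] : cvgn E.
  apply: nondecreasing_is_cvgn => //; exists S => _ [n _ <-]; exact: HS.
apply: cX => d d0; have d2 : 0 < d / 4 by lra.
have [N _ HN] := Hl _ d2.
have key n : (N <= n)%N -> vnorm (u n - u N) <= d / 2.
  move=> Nn; have step m : vnorm (u (N + m)%N - u N) <= E (N + m)%N - E N.
    elim: m => [|m IH]; first by rewrite addn0 !subrr vnorm0.
    rewrite addnS; have := vnorm_tri (u (N + m).+1) (u (N + m)%N) (u N); have := Hu (N + m)%N.
    by rewrite /E big_ord_recr /=; move: IH; rewrite /E; lra.
  have := step (n - N)%N; rewrite subnKC// => /le_trans; apply.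
  have := HN n Nn; have := HN N (leqnn _); rewrite /= !ler_distlC; lra.
exists N => n m /key A /key B.
by have := vnorm_tri (u n) (u N) (u m); rewrite (vnormC (u N)); lra.
Qed.

Lemma cdiff_bfactor a w : cmod a < 1 -> cmod w < 1 -> @cdiff R V (bfactor a) w.
Proof.
move=> a1 w1; apply: (@cdiff_ext _ V (fun w => blphase a * blf a w)).
  by exists 1 => // h _; rewrite bfactorE.
apply: cdiffMs; first exact: cdiff_cst.
by apply: cdiff_blf; rewrite cmod_mul_lt1// ltW.
Qed.

Lemma cmod_blf_sym a c : cmod (blf a c) = cmod (blf c a).
Proof.
rewrite /blf !cmodf cmodC; congr (_ / _); rewrite -cmodJ; congr (cmod _).
by rewrite conjcB conjcM conjcK rmorph1 mulrC.
Qed.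

(** The strong triangle inequality of the pseudo-hyperbolic metric, after [u] has been moved to 0.
    It is the source of the condition on [lambda]: pseudo-discs of radius [lambda] about points
    [delta] apart are disjoint. *)
Lemma mobius_triangle u a c (l : R) : cmod u < 1 -> cmod a < 1 -> cmod c < 1 -> 0 < l < 1 ->
  cmod (blf a u) < l -> cmod (blf c u) < l -> cmod (blf c a) <= 2 * l / (1 + l ^+ 2).
Proof.
move=> u1 a1 c1 l01 au cu.
pose al := blf u a; pose be := blf u c.
have pl : cmod al < l by rewrite /al cmod_blf_sym.
have ql : cmod be < l by rewrite /be cmod_blf_sym.
have al1 : cmod al < 1 by lra. have be1 : cmod be < 1 by lra.
have Nu1 : cmod (- u) < 1 by rewrite cmodN.
have HB z : cmod z < 1 -> cmod (blf (- u) z) <= 1 by move=> /ltW z1; exact: blf_le1.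
have Hd z : cmod z < 1 -> @cdiff R V (blf (- u)) z.
  by move=> /ltW z1; apply: cdiff_blf; exact: cmod_mul_lt1.
have := schwarz_pick Hd HB al1 be1; rewrite !blfK ?(ltW a1) ?(ltW c1)// => S.
have D : 0 < 1 + l ^+ 2 by rewrite ltr_pwDl ?sqr_ge0.
have d1 : 0 < cmod (1 - conjc be * al) by rewrite cmod_gt0 blf_den// cmod_mul_lt1// ltW.
have d2 : 0 < cmod (1 - conjc c * a) by rewrite cmod_gt0 blf_den// cmod_mul_lt1// ltW.
have I := blf_identity be al.
have p0 := cmod_ge0 al; have q0 := cmod_ge0 be.
have tri := cmodB al be.
set p := cmod al in pl al1 p0 I tri; set q := cmod be in ql be1 q0 I tri.
set y := cmod (1 - conjc be * al) in d1 S I; set x := cmod (al - be) in S I tri.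
have x0 : 0 <= x := cmod_ge0 _.
have key : x * (1 + l ^+ 2) <= 2 * l * y.
  rewrite -ler_sqr ?nnegrE ?mulr_ge0 ?(ltW D) ?(ltW d1)//; last by lra.
  have -> : (2 * l * y) ^+ 2 = 4 * l ^+ 2 * (y ^+ 2 - x ^+ 2) + 4 * l ^+ 2 * x ^+ 2 by ring.
  have -> : (x * (1 + l ^+ 2)) ^+ 2 = x ^+ 2 * (1 - l ^+ 2) ^+ 2 + 4 * l ^+ 2 * x ^+ 2 by ring.
  rewrite lerD2r I.
  have A : x ^+ 2 <= 4 * l ^+ 2 by have -> : 4 * l ^+ 2 = (2 * l) ^+ 2; [ring|rewrite ler_sqr ?nnegrE//; lra].
  have l2 : 0 < 1 - l ^+ 2 by rewrite expr2; nra.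
  have pp : 1 - l ^+ 2 <= 1 - p ^+ 2 by rewrite lerD2l lerN2 ler_sqr ?nnegrE//; lra.
  have qq : 1 - l ^+ 2 <= 1 - q ^+ 2 by rewrite lerD2l lerN2 ler_sqr ?nnegrE//; lra.
  apply: ler_pM; rewrite ?sqr_ge0//.
  by rewrite [(1 - l ^+ 2) ^+ 2]expr2 mulrC; apply: ler_pM => //; exact: ltW.
rewrite /blf cmodf ler_pdivrMr// mulrAC ler_pdivlMr//.
set A := cmod (a - c) in S *; set E := cmod (1 - _ * a) in d2 S *.
have A0 : 0 <= A := cmod_ge0 _.
have : A * y * (1 + l ^+ 2) <= x * E * (1 + l ^+ 2) by rewrite ler_wpM2r// ltW.
have : x * (1 + l ^+ 2) * E <= 2 * l * y * E by rewrite ler_wpM2r// ltW.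
move=> h1 h2; rewrite -(ler_pM2l d1); lra.
Qed.

Section Sequence.
Variables (z : nat -> C) (delta lambda : R).
Hypothesis z1 : forall n, cmod (z n) < 1.
Hypothesis delta0 : 0 < delta.
Hypothesis sep : delta <= sep_const z.

Definition sepprod k N : R := \prod_(j < N | (j : nat) != k) rho (z j) (z k).

Let rho01 j k : 0 <= rho (z j) (z k) <= 1.
Proof. by rewrite rhoE cmod_ge0 /= blf_le1// ltW. Qed.

Lemma sepprod_ge k N : delta <= sepprod k N.
Proof.
have pos n : 0 <= sepprod k n by apply: prodr_ge0 => j _; case/andP: (rho01 j k).
have dec : nonincreasing_seq (sepprod k).
  apply/nonincreasing_seqP => n; rewrite /sepprod big_mkcond big_ord_recr /= -big_mkcond /=.
  case: ifP => _; last by rewrite mulr1.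
  by rewrite ler_piMr//; [exact: pos|case/andP: (rho01 n k)].
have cv : cvgn (sepprod k).
  by apply: nonincreasing_is_cvgn => //; exists 0 => _ [n _ <-]; exact: pos.
apply: le_trans (nonincreasing_cvgn_ge dec cv N).
apply: le_trans sep _; apply: ge_inf; last by exists k.
exists 0 => _ [j _ <-].
have posj n : 0 <= sepprod j n by apply: prodr_ge0 => i _; case/andP: (rho01 i j).
have decj : nonincreasing_seq (sepprod j).
  apply/nonincreasing_seqP => n; rewrite /sepprod big_mkcond big_ord_recr /= -big_mkcond /=.
  case: ifP => _; last by rewrite mulr1.
  by rewrite ler_piMr//; [exact: posj|case/andP: (rho01 n j)].
apply: limr_ge; last by apply: nearW => n; exact: posj.
by apply: nonincreasing_is_cvgn => //; exists 0 => _ [n _ <-]; exact: posj.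
Qed.

Lemma sep_le_rho j k : j != k -> delta <= rho (z j) (z k).
Proof.
move=> jk; apply: le_trans (sepprod_ge k j.+1) _.
rewrite /sepprod (bigD1 ord_max)//= ler_piMr//; first by case/andP: (rho01 j k).
by apply: prodr_ile1 => i _; exact: rho01.
Qed.

Lemma delta_lt1 : delta < 1.
Proof.
have := @sep_le_rho 1 0 isT; rewrite rhoE => /le_lt_trans; apply.
exact: blf_lt1.
Qed.

(** By [blf_identity] the gap [1 - cmod (z i)] is at most a constant times [1 - rho (z i) (z 0)],
    and these sums are bounded by [delta^-1]. The index 0 itself is counted separately, by 1. *)
Lemma blaschke_sum : exists S, forall n, \sum_(i < n) (1 - cmod (z i)) <= S.
Proof.
pose c0 := (1 - cmod (z 0%N) ^+ 2) / 4.
have q0 := cmod_ge0 (z 0%N); have q1 := z1 0.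
have c00 : 0 < c0 by rewrite /c0 expr2; nra.
pose f i := if (i == 0)%N then 1 else rho (z i) (z 0%N).
have f01 i : 0 <= f i <= 1 by rewrite /f; case: ifP => _; [rewrite ler01 lexx|exact: rho01].
have fE n : \prod_(i < n) f i = sepprod 0 n.
  by rewrite /sepprod [RHS]big_mkcond; apply: eq_bigr => i _; rewrite /f; case: ifP.
have Sf n : \sum_(i < n) (1 - f i) <= delta^-1.
  have := prod_sum_bound n f01; rewrite fE; have := sepprod_ge 0 n.
  set P := sepprod _ _; set S := \sum_(i < n) _ => h1 h2.
  have S0 : 0 <= S by apply: sumr_ge0 => i _; have := f01 i; lra.
  rewrite -div1r ler_pdivlMr//; nra.
exists (1 + 2 / c0 * delta^-1) => n.
have term i : 1 - cmod (z i) <= (i == 0)%N%:R + 2 / c0 * (1 - f i).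
  rewrite /f; case: eqP => [->|_] /=; first by rewrite subrr mulr0 addr0; lra.
  rewrite add0r mulrAC ler_pdivlMr// rhoE.
  have I := blf_identity (z 0%N) (z i); have t0 := cmod_ge0 (z i); have t1 := z1 i.
  have d2 : 0 < cmod (1 - conjc (z 0%N) * z i) by rewrite cmod_gt0 blf_den// cmod_mul_lt1// ltW.
  have d3 : cmod (1 - conjc (z 0%N) * z i) <= 2.
    by apply: le_trans (cmodB _ _) _; rewrite cmod1 cmodM cmodJ; nra.
  have r0 := cmod_ge0 (blf (z 0%N) (z i)); have r1 := blf_le1 q1 (ltW t1).
  have E : cmod (z i - z 0%N) = cmod (blf (z 0%N) (z i)) * cmod (1 - conjc (z 0%N) * z i).
    by rewrite /blf cmodf divfK// gt_eqF.
  rewrite E exprMn in I; move: (cmod (blf _ _)) r0 r1 I => rr r0 r1.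
  move: (cmod (1 - _)) d2 d3 => y d2 d3 I.
  have : (1 - cmod (z i)) * (4 * c0) <= (1 - rr ^+ 2) * y ^+ 2.
    rewrite (_ : (1 - rr ^+ 2) * y ^+ 2 = (1 - cmod (z 0%N) ^+ 2) * (1 - cmod (z i) ^+ 2)); last by rewrite -I; ring.
    rewrite /c0; have : 0 < 1 - cmod (z 0%N) ^+ 2 by rewrite expr2; nra.
    move: (1 - cmod (z 0%N) ^+ 2) => g g0.
    have : (1 - cmod (z i)) <= 1 - cmod (z i) ^+ 2 by rewrite expr2; nra.
    move: (1 - cmod (z i) ^+ 2) (1 - cmod (z i)) => s t st; nra.
  have : (1 - rr ^+ 2) * y ^+ 2 <= (2 * (1 - rr)) * 4.
    apply: ler_pM; rewrite ?sqr_ge0//; rewrite ?expr2; nra.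
  by lra.
apply: (@le_trans _ _ (\sum_(i < n) (((i : nat) == 0)%N%:R + 2 / c0 * (1 - f i)))).
  by apply: ler_sum => i _; exact: term.
rewrite big_split /= -mulr_sumr lerD//.
  case: n => [|n]; first by rewrite big_ord0.
  by rewrite big_ord_recl big1//= addr0.
by apply: ler_wpM2l; [apply: divr_ge0 => //; exact: ltW|exact: Sf].
Qed.

Definition bprod N w : C := \prod_(n < N) bfactor (z n) w.
Definition bprod' k N w : C := \prod_(n < N | (n : nat) != k) bfactor (z n) w.

Lemma bprod_split k N w : (k < N)%N -> bprod N w = bfactor (z k) w * bprod' k N w.
Proof. by move=> kN; rewrite /bprod (bigD1 (Ordinal kN)). Qed.

Lemma cmod_bprod_le1 N w (P : pred nat) : cmod w < 1 -> cmod (\prod_(n < N | P n) bfactor (z n) w) <= 1.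
Proof.
move=> w1; rewrite cmod_prod; apply: prodr_ile1 => i _.
by rewrite cmod_ge0 cmod_bfactor blf_le1// ltW.
Qed.

Lemma cdiff_bprod N w (P : pred nat) : cmod w < 1 -> @cdiff R V (fun w => \prod_(n < N | P n) bfactor (z n) w) w.
Proof. by move=> w1; apply: cdiff_prod => i _; exact: cdiff_bfactor. Qed.

Lemma bprod_cvg w (P : pred nat) : cmod w < 1 ->
  exists l : V, vlim (fun N => \prod_(n < N | P n) bfactor (z n) w : V) l.
Proof.
move=> w1; have [S HS] := blaschke_sum.
apply: (@bounded_variation_cvg V _ (fun n => (1 - cmod (z n)) * (2 / (1 - cmod w))) (S * (2 / (1 - cmod w)))); first exact: scalar_complete.
  2: by move=> n; rewrite -mulr_suml ler_wpM2r// divr_ge0//; lra.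
move=> n; rewrite vnorm_scal; have A := bfactor_near1 (z1 n) w1.
rewrite [\prod_(_ < n.+1 | _) _]big_mkcond big_ord_recr /= -big_mkcond /=.
case: ifP => _; last first.
  by rewrite mulr1 subrr cmod0; apply: le_trans A; exact: cmod_ge0.
apply: le_trans A; set p := \prod_(_ < n | _) _.
have -> : p * bfactor (z n) w - p = - (p * (1 - bfactor (z n) w)) by ring.
rewrite cmodN cmodM ler_piMl ?cmod_ge0//; exact: cmod_bprod_le1.
Qed.

(** The predicate serves the full product ([predT]) and the product without the factor [k]. *)
Definition bprod_lim (P : pred nat) w : V := limn (fun N => \prod_(n < N | P n) bfactor (z n) w : V).

Lemma bprod_limP w (P : pred nat) : cmod w < 1 ->
  vlim (fun N => \prod_(n < N | P n) bfactor (z n) w : V) (bprod_lim P w).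
Proof. by move=> w1; have [l Hl] := bprod_cvg P w1; rewrite /bprod_lim (vlim_limn Hl). Qed.

Lemma cmod_bprod_lim w (P : pred nat) : cmod w < 1 -> cmod (bprod_lim P w) <= 1.
Proof.
move=> w1; rewrite -vnorm_scal; apply: (@vlim_le _ _ _ _ _ 0%N _ (bprod_limP P w1)) => n _.
exact: cmod_bprod_le1.
Qed.

Lemma cdiff_bprod_lim w (P : pred nat) : cmod w < 1 -> cdiff (bprod_lim P) w.
Proof.
move=> w1; have W v : cmod (v - w) <= (1 - cmod w) / 2 -> cmod v < 1.
  by move=> hz; have := cmodD (v - w) w; rewrite subrK; lra.
apply: (@cdiff_closure R V nat (fun N w => \prod_(n < N | P n) bfactor (z n) w : V) _ w ((1 - cmod w) / 2) 1).
- exact: scalar_complete.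
- by lra.
- by move=> N v /W; exact: cdiff_bprod.
- by move=> N v /W; exact: cmod_bprod_le1.
move=> p q r /W hp /W hq /W hr e e0.
have [N1 H1] := bprod_limP P hp e0; have [N2 H2] := bprod_limP P hq e0; have [N3 H3] := bprod_limP P hr e0.
exists (maxn N1 (maxn N2 N3)); split; [apply: H1|apply: H2|apply: H3].
+ by rewrite leq_maxl.
+ by rewrite leq_max leq_maxl orbT.
+ by rewrite leq_max leq_maxr orbT.
Qed.

Lemma blaschke_lim : blaschke z = bprod_lim predT.
Proof. by []. Qed.

Lemma blaschke_split k w : cmod w < 1 -> blaschke z w = bfactor (z k) w * bprod_lim (fun n => n != k) w.
Proof.
move=> w1; rewrite blaschke_lim.
have L1 : vlim (fun N => bprod (N + k.+1) w : V) (bprod_lim predT w).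
  by move=> e /(bprod_limP predT w1)[N HN]; exists N => n Nn; apply: HN; rewrite ltn_addr || exact: leq_trans Nn (leq_addr _ _).
have L2 : vlim (fun N => bprod' k (N + k.+1) w : V) (bprod_lim (fun n => n != k) w).
  by move=> e /(bprod_limP (fun n => n != k) w1)[N HN]; exists N => n Nn; apply: HN; exact: leq_trans Nn (leq_addr _ _).
apply: vlim_unique L1 _.
apply: vlim_ext (vlimZ (bfactor (z k) w) L2) => N.
by rewrite (@bprod_split k)// addnS ltnS leq_addl.
Qed.

Lemma bprod'_ge k N : delta <= cmod (bprod' k N (z k)).
Proof.
apply: le_trans (sepprod_ge k N) _; rewrite /sepprod /bprod' cmod_prod le_eqVlt.
by apply/orP; left; apply/eqP; apply: eq_bigr => i _; rewrite cmod_bfactor rhoE cmod_blf_sym.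
Qed.

Lemma bprod_lim'_ge k : delta <= cmod (bprod_lim (fun n => n != k) (z k)).
Proof.
apply/ler_addgt0Pr => e e0.
have [N HN] := bprod_limP (fun n => n != k) (z1 k) e0.
have := HN N (leqnn _); rewrite vnorm_scal; have := bprod'_ge k N; rewrite /bprod' => A B.
by have := cmod_lbB (\prod_(n < N | (n : nat) != k) bfactor (z n) (z k)) (bprod_lim (fun n => n != k) (z k)); lra.
Qed.

Hypothesis lambda01 : 0 < lambda < 1.
Hypothesis lambda_delta : 2 * lambda / (1 + lambda ^+ 2) < delta.

Lemma lambda_lt_delta : lambda < delta.
Proof.
have l01 := lambda01; apply: le_lt_trans lambda_delta.
by rewrite ler_pdivlMr ?ltr_pwDl ?sqr_ge0// expr2; nra.
Qed.

Let r := (delta - lambda) / (1 - lambda * delta) * lambda.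

Lemma radius_gt0 : 0 < r.
Proof.
have l01 := lambda01; have d1 := delta_lt1; have ld := lambda_lt_delta.
by rewrite /r mulr_gt0 ?divr_gt0//; [lra|nra|lra].
Qed.

Lemma radius_lt1 : r < 1.
Proof.
have l01 := lambda01; have d1 := delta_lt1; have ld := lambda_lt_delta.
have h : (delta - lambda) / (1 - lambda * delta) <= 1 by rewrite ler_pdivrMr; nra.
have h0 : 0 <= (delta - lambda) / (1 - lambda * delta) by rewrite divr_ge0; nra.
by rewrite /r; nra.
Qed.

Lemma pseudodisks_disjoint j k w : cmod w < 1 -> cmod (blf (z j) w) < lambda ->
  cmod (blf (z k) w) < lambda -> j = k.
Proof.
move=> w1 hj hk; apply/eqP; apply: contraT => jk.
have := mobius_triangle w1 (z1 j) (z1 k) lambda01 hj hk.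
by rewrite -rhoE => A; have := sep_le_rho jk; have := lambda_delta; lra.
Qed.

(** [Q k] stands for the product without the factor [k], finite in [finite_blaschke_level] and
    infinite in [blaschke_branches]; both need branches in the same pseudo-discs. *)
Lemma branch_exists (Q : nat -> C -> V) :
  (forall k w, cmod w < 1 -> cdiff (Q k) w) -> (forall k w, cmod w < 1 -> cmod (Q k w) <= 1) ->
  (forall k, delta <= cmod (Q k (z k))) ->
  exists b : nat -> C -> V, forall k w, cmod w < r ->
   [/\ cmod (b k w) < 1, cmod (blf (z k) (b k w)) < lambda, bfactor (z k) (b k w) * Q k (b k w) = w, cdiff (b k) w &
      forall v, cmod v < 1 -> cmod (blf (z k) v) < lambda -> bfactor (z k) v * Q k v = w -> v = b k w].
Proof.
move=> Hd HB Hq.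
suff /choice[b Hb] : forall k, exists b : C -> V, forall w, cmod w < r ->
   [/\ cmod (b w) < 1, cmod (blf (z k) (b w)) < lambda, bfactor (z k) (b w) * Q k (b w) = w, cdiff b w &
      forall v, cmod v < 1 -> cmod (blf (z k) v) < lambda -> bfactor (z k) v * Q k v = w -> v = b w] by exists b.
move=> k; have l01 := lambda01.
have dh w : cmod w < 1 -> @cdiff R V (fun w => blphase (z k) * Q k w) w.
  by move=> w1; apply: cdiffMs; [exact: cdiff_cst|exact: Hd].
have [|||||b Hb] := @local_inverse R (fun w => blphase (z k) * Q k w) (z k) delta lambda dh _ (z1 k).
- by move=> w w1; rewrite cmodM cmod_blphase mul1r HB.
- by lra.
- exact: lambda_lt_delta.
- exact: delta_lt1.
- by rewrite cmodM cmod_blphase mul1r.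
exists b => w wr; have [b1 b2 b3 b4 b5] := Hb w wr; split=> //.
  by rewrite bfactorE -[RHS]b3; ring.
by move=> v v1 v2 v3; apply: b5 => //; rewrite -v3 bfactorE; ring.
Qed.

(** A count of roots: [bprod N x = w] is a polynomial equation of degree at most [N], and the
    branches already provide [N] roots, distinct because their pseudo-discs are disjoint. A solution
    outside all pseudo-discs would be one too many. *)
Lemma finite_blaschke_level N w v : cmod v < 1 -> cmod w < r -> bprod N v = w ->
  exists2 k, (k < N)%N & cmod (blf (z k) v) < lambda.
Proof.
move=> v1 wr Ev; have l01 := lambda01; apply: contrapT => Hn.
have Hk k : (k < N)%N -> lambda <= cmod (blf (z k) v).
  by move=> kN; rewrite leNgt; apply/negP => ?; apply: Hn; exists k.
have [b Hb] := @branch_exists (fun k => bprod' k N)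
  (fun k w hw => cdiff_bprod N (fun n => n != k) hw)
  (fun k w hw => cmod_bprod_le1 N (fun n => n != k) hw)
  (fun k => bprod'_ge k N).
have N0 : (0 < N)%N.
  by rewrite lt0n; apply: contraTneq wr => N0; rewrite -Ev N0 /bprod big_ord0 cmod1 -leNgt; have := radius_lt1; lra.
pose num : {poly C} := \prod_(n < N) (blphase (z n) *: ('X - (z n)%:P)).
pose den : {poly C} := \prod_(n < N) (1 - conjc (z n) *: 'X).
pose p := num - w *: den.
have numE x : num.[x] = \prod_(n < N) (blphase (z n) * (x - z n)).
  by rewrite horner_prod; apply: eq_bigr => i _; rewrite !hornerE.
have denE x : den.[x] = \prod_(n < N) (1 - conjc (z n) * x).
  by rewrite horner_prod; apply: eq_bigr => i _; rewrite !hornerE.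
have den0 x : cmod x < 1 -> den.[x] != 0.
  move=> x1; rewrite denE; apply/prodf_neq0 => i _.
  by rewrite blf_den// cmod_mul_lt1// ltW.
have bE x : cmod x < 1 -> num.[x] = bprod N x * den.[x].
  move=> x1; rewrite numE denE /bprod -big_split /=; apply: eq_bigr => i _.
  rewrite bfactorE /blf -!mulrA mulVf ?mulr1//.
  by rewrite blf_den// cmod_mul_lt1// ltW.
have rootE x : cmod x < 1 -> bprod N x = w -> root p x.
  by move=> x1 Ex; rewrite /root /p !hornerE bE// Ex subrr.
(* A zero of a finite product is some [z i] and lies in its own pseudo-disc. With [w] nonzero, [p]
   does not vanish at [z 0] and is not the zero polynomial. *)
have w0 : w != 0.
  apply/eqP => w0; move: Ev; rewrite w0 /bprod => /eqP; rewrite prodf_seq_eq0 => /hasP[i _ /= /eqP Ei].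
  have := Hk i (ltn_ord i); rewrite -cmod_bfactor Ei cmod0; lra.
have p0 : p != 0.
  apply/eqP => p0; have : p.[z 0%N] = 0 by rewrite p0 horner0.
  rewrite /p !hornerE bE// /bprod (bigD1 (Ordinal N0))//= bfactorE blf_self mulr0 !mul0r sub0r.
  by move=> /eqP; rewrite oppr_eq0 mulf_eq0 (negPf w0) (negPf (den0 _ (z1 0))).
pose rs := v :: [seq b k w | k <- iota 0 N].
have sz : (size p <= N.+1)%N.
  have sn : (size num <= N.+1)%N.
    apply: (@size_prod_linear (fun i => blphase (z i) *: ('X - (z i)%:P))) => i.
    by apply: leq_trans (size_scale_leq _ _) _; rewrite size_XsubC.
  have sd : (size den <= N.+1)%N.
    apply: (@size_prod_linear (fun i => 1 - conjc (z i) *: 'X)) => i.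
    apply: leq_trans (size_polyD _ _) _; rewrite geq_max size_poly1 size_polyN /=.
    by apply: leq_trans (size_scale_leq _ _) _; rewrite size_polyX.
  apply: leq_trans (size_polyD _ _) _; rewrite geq_max sn size_polyN.
  by apply: leq_trans (size_scale_leq _ _) sd.
have := @max_poly_roots _ p rs p0.
have -> : all (root p) rs.
  rewrite /= rootE//=; apply/allP => _ /mapP[k + ->]; rewrite mem_iota add0n => kN.
  have [b1 b2 b3 _ _] := Hb k w wr; apply: rootE => //.
  by rewrite (@bprod_split k).
have -> : uniq rs.
  rewrite /=; apply/andP; split.
    apply/negP => /mapP[k]; rewrite mem_iota add0n => kN Evk.
    have [b1 b2 _ _ _] := Hb k w wr; have := Hk k kN; rewrite Evk leNgt b2 //.
  rewrite map_inj_in_uniq ?iota_uniq// => j k; rewrite !mem_iota !add0n => jN kN Ejk.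
  have [b1 b2 _ _ _] := Hb j w wr; have [c1 c2 _ _ _] := Hb k w wr.
  by apply: (pseudodisks_disjoint b1 b2); rewrite Ejk.
rewrite /= size_map size_iota => /(_ isT isT); rewrite ltnNge sz //.
Qed.

(** For the last clause, [bprod N v] also has modulus below [r] when [N] is large, so [v] lies in
    one of the pseudo-discs. These do not depend on [N], and uniqueness of the branch of the
    infinite product there identifies [v]. *)
Lemma blaschke_branches : exists b : nat -> C -> V,
  [/\ forall k w, cmod w < r -> [/\ cmod (b k w) < 1, blaschke z (b k w) = w & cdiff (b k) w],
      forall k, b k 0 = z k &
      forall v, cmod v < 1 -> cmod (blaschke z v) < r -> exists k, v = b k (blaschke z v)].
Proof.
have [b Hb] := @branch_exists (fun k => bprod_lim (fun n => n != k))
  (fun k w hw => cdiff_bprod_lim (fun n => n != k) hw)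
  (fun k w hw => cmod_bprod_lim (fun n => n != k) hw) bprod_lim'_ge.
have l01 := lambda01.
exists b; split.
- move=> k w wr; have [b1 _ b3 b4 _] := Hb k w wr; split=> //.
  by rewrite (blaschke_split k).
- move=> k; have [|_ _ _ _ b5] := Hb k 0; first by rewrite cmod0 radius_gt0.
  by apply/esym; apply: b5; rewrite ?blf_self ?cmod0 ?bfactorE ?blf_self ?mulr0 ?mul0r//; lra.
move=> v v1 Bv.
have e0 : 0 < (r - cmod (blaschke z v)) / 2 by lra.
have [N HN] := bprod_limP predT v1 e0.
have := HN N (leqnn _); rewrite vnorm_scal -blaschke_lim -/(bprod N v) => A.
have Nr : cmod (bprod N v) < r.
  by have := cmodD (bprod N v - blaschke z v) (blaschke z v); rewrite subrK; lra.
have [k kN kl] := finite_blaschke_level v1 Nr erefl.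
exists k; have [_ _ _ _ b5] := Hb k _ Bv; apply: b5 => //.
by rewrite -blaschke_split.
Qed.

End Sequence.
End BlaschkeProducts.

(** * Beurling functions *)

Section TopEigenvector.
Variable R : realType.
Local Notation C := R[i].

Lemma rCM (a b : R) : (a * b)%:C = a%:C * b%:C :> C.
Proof. exact: rmorphM. Qed.

Lemma rCB (a b : R) : (a - b)%:C = a%:C - b%:C :> C.
Proof. exact: rmorphB. Qed.

Lemma rCV (a : R) : (a^-1)%:C = (a%:C)^-1 :> C.
Proof. exact: fmorphV. Qed.

Lemma mulC_conj (z : C) : conjc z * z = (cmod z ^+ 2)%:C.
Proof. by rewrite mulrC -sqr_cmod. Qed.

(** Unitary diagonalisation: [m] is the largest diagonal entry, [x] the matching column of the
    adjoint unitary matrix, and in the coordinates [u] the form is a weighted sum of squares. *)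
Lemma top_eigenvector n (T : 'I_n.+1 -> 'I_n.+1 -> C) :
  (forall j k, conjc (T j k) = T k j) ->
  exists (m : R) (x : 'I_n.+1 -> C), [/\ exists i, x i != 0,
    forall j, \sum_k T j k * x k = m%:C * x j &
    forall v : 'I_n.+1 -> C,
      complex.Re (\sum_j \sum_k conjc (v j) * T j k * v k) <= m * \sum_j cmod (v j) ^+ 2].
Proof.
move=> hT; pose A : 'M[C]_n.+1 := \matrix_(j, k) T j k.
have Ah : A \is hermitianmx _ false (@Num.conj C).
  apply/is_hermitianmxP; rewrite expr0 scale1r; apply/matrixP => j k.
  by rewrite !mxE -hT.
have /orthomx_spectralP := hermitian_normalmx Ah.
have Dr := hermitian_spectral_diag_real Ah.
have Pu := spectral_unitarymx A.
set P := spectralmx A in Pu *; set D := spectral_diag A in Dr *.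
rewrite invmx_unitary// => AE.
pose dR i := complex.Re (D 0 i).
have DE i : D 0 i = (dR i)%:C.
  by rewrite /dR RRe_real//; move/mxOverP: Dr; apply.
pose i0 := [arg max_(i > ord0) dR i]%O.
have Hi0 i : dR i <= dR i0.
  by rewrite /i0; case: arg_maxP => // j _ H; exact: H.
pose m := dR i0.
pose Ps : 'M[C]_n.+1 := map_mx (@Num.conj C) P^T.
have PPs : P *m Ps = 1%:M by apply/unitarymxP.
have PsP : Ps *m P = 1%:M by apply: mulmx1C.
pose x k := conjc (P i0 k).
exists m, x; split.
- apply/existsP; rewrite -[[exists _, _]]negbK negb_exists; apply/negP => /forallP H.
  have : (P *m Ps) i0 i0 = 0.
    rewrite mxE big1// => k _; have := H k; rewrite negbK /x conjc_eq0 => /eqP ->.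
    by rewrite mul0r.
  by rewrite PPs mxE eqxx => /eqP; rewrite oner_eq0.
- move=> j; have : (A *m Ps) j i0 = m%:C * x j.
    have -> : A *m Ps = Ps *m diag_mx D by rewrite [in LHS]AE -[LHS]mulmxA PPs mulmx1.
    by rewrite mul_mx_diag !mxE DE mulrC.
  by move=> <-; rewrite mxE; apply: eq_bigr => k _; rewrite !mxE.
move=> v; pose u i := \sum_k P i k * v k.
have -> : \sum_j \sum_k conjc (v j) * T j k * v k = \sum_i D 0 i * (cmod (u i) ^+ 2)%:C.
  transitivity (\sum_j \sum_k \sum_i (conjc (v j) * conjc (P i j)) * D 0 i * (P i k * v k)).
    apply: eq_bigr => j _; apply: eq_bigr => k _.
    have -> : T j k = \sum_i conjc (P i j) * D 0 i * P i k.
      have := congr1 (fun B : 'M[C]_n.+1 => B j k) AE; rewrite !mxE => ->.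
      by apply: eq_bigr => i _; rewrite mul_mx_diag !mxE.
    rewrite mulr_sumr mulr_suml; apply: eq_bigr => i _; ring.
  under eq_bigr do rewrite exchange_big /=.
  rewrite exchange_big /=; apply: eq_bigr => i _.
  rewrite sqr_cmod /u conjc_sum mulr_suml mulr_sumr exchange_big /=.
  apply: eq_bigr => j _; rewrite mulr_sumr mulr_sumr; apply: eq_bigr => k _.
  by rewrite conjcM; ring.
have <- : \sum_i cmod (u i) ^+ 2 = \sum_j cmod (v j) ^+ 2.
  apply: (@complexI R); rewrite !rmorph_sum /=.
  transitivity (\sum_i \sum_j \sum_k (conjc (v j) * conjc (P i j)) * (P i k * v k)).
    apply: eq_bigr => i _; rewrite sqr_cmod mulrC /u conjc_sum mulr_suml.
    by apply: eq_bigr => j _; rewrite mulr_sumr; apply: eq_bigr => k _; rewrite conjcM; ring.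
  rewrite exchange_big /=; apply: eq_bigr => j _.
  rewrite exchange_big /= (bigD1 j)//= [X in _ + X]big1 ?addr0 => [|k kj].
    have := congr1 (fun B : 'M[C]_n.+1 => B j j) PsP; rewrite !mxE eqxx => E.
    transitivity (conjc (v j) * v j * \sum_i Ps j i * P i j).
      by rewrite mulr_sumr; apply: eq_bigr => i _; rewrite !mxE; ring.
    by rewrite E mulr1 mulC_conj.
  have := congr1 (fun B : 'M[C]_n.+1 => B j k) PsP; rewrite !mxE eq_sym (negPf kj) => E.
  transitivity (conjc (v j) * v k * \sum_i Ps j i * P i k).
    by rewrite mulr_sumr; apply: eq_bigr => i _; rewrite !mxE; ring.
  by rewrite E mulr0.
have -> : complex.Re (\sum_i D 0 i * (cmod (u i) ^+ 2)%:C) = \sum_i dR i * cmod (u i) ^+ 2.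
  have -> : \sum_i D 0 i * (cmod (u i) ^+ 2)%:C = (\sum_i dR i * cmod (u i) ^+ 2)%:C.
    by rewrite rmorph_sum; apply: eq_bigr => i _; rewrite DE -rmorphM.
  by [].
rewrite mulr_sumr; apply: ler_sum => i _; rewrite ler_wpM2r ?sqr_ge0//; exact: Hi0.
Qed.

End TopEigenvector.

(** * Comparison of means and common roots *)

Section MeanComparison.
Variable R : realType.
Local Notation C := R[i].
Notation V := (R[i])^o.

Lemma Re_half (c : C) : complex.Re (2^-1 * c) = 2^-1 * complex.Re c.
Proof.
have -> : 2^-1 = (2^-1)%:C :> C by rewrite fmorphV /= rmorph_nat.
by case: c => x y /=; rewrite mul0r subr0.
Qed.

(** The trapezoidal rule has nonnegative weights, so the domination holds at each level. *)
Lemma cmean_domination (X : normedModType R[i]) n (f : C -> X) (h : C -> V) s : 0 < s ->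
  (forall z, cmod z = s -> vnorm (f z) <= complex.Re (h z)) ->
  vnorm (cmean n f s) <= complex.Re (cmean n h s).
Proof.
move=> s0 H; rewrite /cmean.
have : forall t : R, 0 <= t <= 1 -> vnorm (f (cexp ((ln s)%:C + t%:C * ('i * (2 * pi)%:C)))) <=
    complex.Re (h (cexp ((ln s)%:C + t%:C * ('i * (2 * pi)%:C)))).
  by move=> t _; apply: H; exact: circle_pt.
move: (_%:C) ('i * _) => p v.
have aux (x y : X) (a b : C) : vnorm x <= complex.Re a -> vnorm y <= complex.Re b ->
    vnorm (2^-1 *: (x + y)) <= complex.Re (2^-1 *: ((a : V) + b)).
  move=> hx hy; rewrite vnormZ [_ *: (_ + b)]/GRing.scale /= Re_half (_ : cmod 2^-1 = 2^-1); last by rewrite -[2^-1]mul1r cmod_half cmod1 mul1r.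
  by rewrite raddfD /=; have := vnormD x y; lra.
elim: n p v => [|n IH] p v K /=.
  apply: aux; first by have := K 0; rewrite rmorph0 mul0r addr0; apply; rewrite lexx ler01.
  by have := K 1; rewrite rmorph1 mul1r; apply; rewrite lexx ler01.
apply: aux; apply: IH => t t01; first by rewrite seg_left; apply: K; lra.
by rewrite seg_right; apply: K; lra.
Qed.

Lemma cmean_conj n (f : C -> V) s : cmean n (fun w => conjc (f w) : V) s = conjc (cmean n f s).
Proof.
rewrite /cmean; move: (_%:C) ('i * _) => p v.
have aux (a b : C) : 2^-1 * (conjc a + conjc b) = conjc (2^-1 * (a + b)).
  by rewrite conjcM conjcV conjcD rmorph_nat.
by elim: n p v => [|n IH] p v /=; rewrite ?IH; exact: aux.
Qed.

Lemma vlim_conj (u : nat -> V) (l : C) : vlim u l -> vlim (fun n => conjc (u n) : V) (conjc l).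
Proof.
move=> H e e0; have [N HN] := H e e0; exists N => n /HN.
by rewrite !vnorm_scal -conjcB cmodJ.
Qed.

Lemma vlim_sum (X : normedModType R[i]) (I : Type) (r : seq I) (u : I -> nat -> X) (l : I -> X) :
  (forall i, vlim (u i) (l i)) -> vlim (fun n => \sum_(i <- r) u i n) (\sum_(i <- r) l i).
Proof.
move=> H; elim: r => [|i r IH].
  by rewrite big_nil; apply: (vlim_ext _ (vlim_cst 0)) => n; rewrite big_nil.
by rewrite big_cons; apply: (vlim_ext _ (vlimD (H i) IH)) => n; rewrite big_cons.
Qed.

Lemma vlim_Re_le (X : normedModType R[i]) (u : nat -> X) (v : nat -> V) (l : X) (k : C) :
  (forall n, vnorm (u n) <= complex.Re (v n)) -> vlim u l -> vlim v k -> vnorm l <= complex.Re k.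
Proof.
move=> H Hu Hv; rewrite leNgt; apply/negP => lt.
pose e := (vnorm l - complex.Re k) / 4; have e0 : 0 < e by rewrite /e; lra.
have [N1 H1] := Hu e e0; have [N2 H2] := Hv e e0.
pose n := maxn N1 N2.
have := H1 n (leq_maxl _ _); have := H2 n (leq_maxr _ _); have := H n.
have := vnormD (u n) (l - u n); rewrite [u n + _]addrC subrK (vnormC l) vnorm_scal.
have [A _] := normReIm (v n - k); move: A; rewrite raddfB /= => A.
have := ler_norm (complex.Re (v n) - complex.Re k); rewrite /e; lra.
Qed.

Lemma factor_roots (h : C -> V) (s : seq C) : uniq s -> (forall a, a \in s -> cmod a < 1) ->
  (forall z, cmod z < 1 -> cdiff h z) -> (forall a, a \in s -> h a = 0) ->
  exists2 k : C -> V, (forall z, cmod z < 1 -> cdiff k z) &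
    forall z, h z = (\prod_(a <- s) (z - a)) * k z.
Proof.
elim: s h => [|a s IH] h /=; first by move=> _ _ hd _; exists h => // z; rewrite big_nil mul1r.
move=> /andP[as' us] s1 hd h0.
have [|k kd kE] := factor_root _ hd (h0 a (mem_head _ _)); first by apply: s1; rewrite mem_head.
have [|b bs|k' k'd k'E] := IH k us _ kd.
- by move=> b bs; apply: s1; rewrite inE bs orbT.
- have := h0 b; rewrite inE bs orbT => /(_ isT); rewrite kE => /eqP; rewrite mulf_eq0 subr_eq0.
  by case/orP => [/eqP ba|/eqP//]; rewrite -ba bs in as'.
by exists k' => // z; rewrite big_cons kE k'E mulrA.
Qed.

(** On the circle of radius [s] the factor is smallest in the direction of [a]. The minimum is
    written as a value of [blf] at the real point [s], so that it depends holomorphically on [s] and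
    tends to 1 with it. *)
Lemma blf_lower (a w : C) (s : R) : cmod a < s -> s < 1 -> cmod w = s ->
  [/\ 0 <= complex.Re (blf (cmod a)%:C s%:C),
  complex.Re (blf (cmod a)%:C s%:C) <= cmod (blf a w) &
  blf (cmod a)%:C s%:C = (complex.Re (blf (cmod a)%:C s%:C))%:C].
Proof.
move=> as' s1 ws; have a0 := cmod_ge0 a.
have e : blf (cmod a)%:C s%:C = ((s - cmod a) / (1 - cmod a * s))%:C.
  by rewrite /blf conjc_real rCM rCV !rCB rCM.
have d0 : 0 < 1 - cmod a * s by nra.
rewrite e; split=> //=; first by rewrite divr_ge0 ?subr_ge0 ?ltW// -subr_gt0.
have a1 : cmod a < 1 by lra.
have dp : 0 < cmod (1 - conjc a * w).
  by rewrite cmod_gt0 blf_den// cmod_mul_lt1// ws ltW.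
rewrite /blf cmodf ler_pdivrMr// mulrAC ler_pdivlMr//.
have I := blf_identity a w; rewrite ws in I.
have dd : 1 - cmod a * s <= cmod (1 - conjc a * w).
  by have := cmod_lbB 1 (conjc a * w); rewrite cmod1 cmodM cmodJ ws.
rewrite -ler_sqr ?nnegrE; first last.
- by rewrite mulr_ge0 ?cmod_ge0// ltW.
- by rewrite mulr_ge0 ?cmod_ge0//; lra.
have := ler_pM (ltW d0) (ltW d0) dd dd.
move: (cmod (1 - _)) (cmod (w - a)) (cmod a) I dp a0 d0 a1 as' => d n b I dp a0 d0 a1 as'.
rewrite !exprMn !expr2 in I * => D.
have c0 : 0 <= (1 - b * b) * (1 - s * s) by rewrite mulr_ge0//; nra.
have -> : (s - b) * (s - b) = (1 - b * s) * (1 - b * s) - (1 - b * b) * (1 - s * s) by ring.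
have -> : n * n = d * d - (1 - b * b) * (1 - s * s) by lra.
by have := ler_wpM2l c0 D; nra.
Qed.

End MeanComparison.

(** * Beurling functions for finitely many points *)

Section FiniteBeurling.
Variable R : realType.
Local Notation C := R[i].
Notation V := (R[i])^o.
Variables (n : nat) (z : 'I_n.+1 -> C).
Hypothesis z1 : forall i, cmod (z i) < 1.
Hypothesis zinj : injective z.
Implicit Types (i j k : 'I_n.+1) (w : C).

Definition szego k w : C := (1 - conjc (z k) * w)^-1.
Definition cofac j w : C := \prod_(k | k != j) blf (z k) w.
Definition gap j : R := 1 - cmod (z j) ^+ 2.
(** The modulus of the residue at [z j] of the reciprocal of the finite Blaschke product. *)
Definition wt j : R := gap j / cmod (cofac j (z j)).

Lemma gap_gt0 j : 0 < gap j.
Proof. by rewrite /gap expr2; have := z1 j; have := cmod_ge0 (z j); nra. Qed.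

Lemma gapE j : (gap j)%:C = 1 - conjc (z j) * z j.
Proof. by rewrite /gap rmorphB mulC_conj. Qed.

Lemma szego_den k w : cmod w <= 1 -> 1 - conjc (z k) * w != 0.
Proof. by move=> w1; apply: blf_den; exact: cmod_mul_lt1. Qed.

Lemma szego_self j : szego j (z j) = ((gap j)%:C)^-1.
Proof. by rewrite gapE. Qed.

Lemma conj_szego j k : conjc (szego k (z j)) = szego j (z k).
Proof. by rewrite /szego conjcV conjcB conjcM conjcK rmorph1 mulrC. Qed.

Lemma cofac_neq0 j : cofac j (z j) != 0.
Proof.
apply/prodf_neq0 => k kj; rewrite /blf mulf_neq0 ?invr_eq0 ?szego_den ?ltW//.
by rewrite subr_eq0; apply: contraNneq kj => /zinj ->.
Qed.

Lemma cofac_root j k : j != k -> cofac j (z k) = 0.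
Proof. by move=> jk; rewrite /cofac (bigD1 k) 1?eq_sym//= blf_self mul0r. Qed.

Lemma cmod_cofac_gt0 j : 0 < cmod (cofac j (z j)).
Proof. by rewrite cmod_gt0 cofac_neq0. Qed.

Lemma wt_gt0 j : 0 < wt j.
Proof. by rewrite divr_gt0 ?gap_gt0 ?cmod_cofac_gt0. Qed.

Let s j : R := Num.sqrt (wt j).

Let s_gt0 j : 0 < s j.
Proof. by rewrite sqrtr_gt0 wt_gt0. Qed.

Let ss j : s j * s j = wt j.
Proof. by rewrite -expr2 sqr_sqrtr// ltW// wt_gt0. Qed.

Let T j k : C := (s j)%:C * szego k (z j) * (s k)%:C.

Section Eigen.
Variables (m : R) (x : 'I_n.+1 -> C).
Hypothesis x0 : exists i, x i != 0.
Hypothesis eig : forall j, \sum_k T j k * x k = m%:C * x j.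
Hypothesis top : forall v : 'I_n.+1 -> C,
  complex.Re (\sum_j \sum_k conjc (v j) * T j k * v k) <= m * \sum_j cmod (v j) ^+ 2.

Let y k : C := (s k)%:C * x k.
Let Q w : C := \sum_k y k * szego k w.

(** The eigenvalue equation, read as a relation between the values of the eigenfunction [Q] and its
    coefficients. *)
Let Qz j : (wt j)%:C * Q (z j) = m%:C * y j.
Proof.
rewrite /y mulrCA -eig -ss rCM -mulrA; congr (_ * _).
by rewrite /Q mulr_sumr; apply: eq_bigr => k _; rewrite /T /y; ring.
Qed.

Lemma eigen_gt0 : 0 < m.
Proof.
have := top (fun i => (i == ord0)%:R).
rewrite (bigD1 ord0)//= [X in _ + X]big1 ?addr0; last first.
  by move=> j /negPf ->; rewrite big1// => k _; rewrite rmorph0 !mul0r.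
rewrite (bigD1 ord0)//= [X in _ + X]big1 ?addr0; last first.
  by move=> k /negPf ->; rewrite mulr0.
rewrite [X in _ <= m * X](bigD1 ord0)//= [X in _ <= m * (_ + X)]big1 ?addr0; last first.
  by move=> j /negPf ->; rewrite cmod0 expr0n.
rewrite (_ : (1 -i* 0)%C = 1 :> C) ?oppr0// cmod1 expr1n !mulr1 mul1r; apply: lt_le_trans.
rewrite /T szego_self -fmorphV -!rmorphM /= !mulr_gt0 ?invr_gt0 ?gap_gt0 ?s_gt0//.
Qed.

Let hermE (v : 'I_n.+1 -> C) : \sum_j \sum_k conjc (v j) * T j k * v k = \sum_j conjc (v j) * \sum_k T j k * v k.
Proof. by apply: eq_bigr => j _; rewrite mulr_sumr; apply: eq_bigr => k _; rewrite mulrA. Qed.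

(* Dividing out a zero [a] of the top eigenfunction would increase the
   Rayleigh quotient. *)
Lemma eigenfun_neq0_disk a : cmod a < 1 -> Q a != 0.
Proof.
move=> a1; apply/eqP => Qa.
(* The adjoint of multiplication by [blf a] acts on the kernels at the nodes by these conjugate
   values. *)
pose v k := conjc (blf a (z k)) * x k.
have E1 : \sum_j \sum_k conjc (x j) * T j k * x k = (m * \sum_j cmod (x j) ^+ 2)%:C.
  rewrite hermE rmorphM rmorph_sum /= mulr_sumr; apply: eq_bigr => j _.
  by rewrite eig -mulC_conj; ring.
(* At a zero [a] of [Q] the two forms agree, while [v] is strictly shorter than [x]; so the Rayleigh
   quotient of [v] exceeds the top eigenvalue. *)
have E2 : \sum_j \sum_k conjc (x j) * T j k * x k - \sum_j \sum_k conjc (v j) * T j k * v k =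
    (1 - conjc a * a) * (conjc (Q a) * Q a).
  rewrite -sumrB /Q conjc_sum mulr_suml mulr_sumr; apply: eq_bigr => j _.
  rewrite -sumrB mulr_sumr mulr_sumr; apply: eq_bigr => k _.
  rewrite /v /y !conjcM conjcK /T !conjc_real /szego /blf.
  rewrite !(conjcM, conjcV, conjcB, conjcK, conjc1, conjc_real).
  have d1 := szego_den k (ltW (z1 j)).
  have d2 := szego_den k (ltW a1).
  have d3 : 1 - z j * conjc a != 0 by rewrite mulrC blf_den// cmod_mul_lt1// ltW.
  have d4 : 1 - conjc a * z j != 0 by rewrite mulrC.
  have d5 : 1 - a * conjc (z k) != 0 by rewrite mulrC.
  by field; rewrite ?d1 ?d2 ?d3 ?d5 ?d4.
rewrite Qa rmorph0 !mul0r !mulr0 in E2; move/eqP: E2; rewrite subr_eq0 => /eqP E2.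
have := top v; rewrite -E2 E1 /= ler_pM2l ?eigen_gt0// leNgt => /negP; apply.
have [i xi] := x0.
have lt1 j : cmod (blf a (z j)) < 1 by exact: blf_lt1.
have vE j : cmod (v j) ^+ 2 = cmod (blf a (z j)) ^+ 2 * cmod (x j) ^+ 2.
  by rewrite /v cmodM cmodJ exprMn.
have b1 j : cmod (blf a (z j)) ^+ 2 < 1.
  by rewrite expr2; have := lt1 j; have := cmod_ge0 (blf a (z j)); nra.
rewrite (bigD1 i)//= [ltRHS](bigD1 i)//= ltr_leD//.
  by rewrite vE -[ltRHS]mul1r ltr_pM2r ?exprn_gt0 ?cmod_gt0.
by apply: ler_sum => j _; rewrite vE -[leRHS]mul1r ler_wpM2r ?sqr_ge0// ltW.
Qed.

(* On [|w| = t], [K_k(w) conj(K_j(w))] is linear in [K_k(w)] and [conj(K_j(w))]. *)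
Lemma szego_product j k w (t : R) : cmod w = t -> t <= 1 -> szego k w * conjc (szego j w) =
  (1 - (t ^+ 2)%:C * (conjc (z k) * z j))^-1 * (szego k w + conjc (szego j w) - 1).
Proof.
move=> wt t1; have t0 : 0 <= t by rewrite -wt cmod_ge0.
have ww : (t ^+ 2)%:C = w * conjc w by rewrite -sqr_cmod wt.
have w1 : cmod w <= 1 by rewrite wt.
have d1 := szego_den k w1.
have d2 : 1 - z j * conjc w != 0.
  by rewrite -conjc_eq0 conjcB conjcM conjcK rmorph1 szego_den.
have d3 : 1 - (w * conjc w) * (conjc (z k) * z j) != 0.
  have -> : 1 - w * conjc w * (conjc (z k) * z j) = 1 - conjc (z k * (w * conjc w)) * z j.
    by rewrite !conjcM conjcK; ring.
  apply: blf_den; rewrite !cmodM cmodJ wt; have := z1 k; have := z1 j.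
  have := cmod_ge0 (z k); have := cmod_ge0 (z j) => a0 b0 a1 b1.
  have : t * t <= 1 by nra.
  have tt0 : 0 <= t * t by nra.
  by move=> tt1; have : cmod (z k) * (t * t) <= cmod (z k); nra.
rewrite ww /szego conjcV conjcB conjcM conjcK rmorph1.
by field; rewrite d1 d2 d3.
Qed.

(** On the unit circle, the Poisson kernel at [z j]. *)
Let P j w : R := gap j * cmod (szego j w) ^+ 2.

Let PE j w : cmod w = 1 -> szego j w + conjc (szego j w) - 1 = (P j w)%:C.
Proof.
move=> w1; have w1' : cmod w <= 1 by rewrite w1.
have d := szego_den j w1'.
have E := szego_product j j w1 (lexx 1); rewrite expr1n mul1r -gapE in E.
have g0 : (gap j)%:C != 0 :> C by rewrite -cmod_gt0 cmodRp ?gap_gt0// ltW// gap_gt0.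
by rewrite /P rCM sqr_cmod E mulrA divff// mul1r.
Qed.

(** [szego_product] makes each product of kernels linear, the inner sums become values of [Q] at the
    nodes, and the eigenvalue equation collapses the double sum to a sum of Poisson kernels. This is
    the reason why the moduli of the Beurling functions add up to a constant. *)
Lemma eigenfun_circle w : cmod w = 1 ->
  m * cmod (Q w) ^+ 2 = \sum_j wt j * cmod (Q (z j)) ^+ 2 * P j w.
Proof.
move=> w1; apply: (@complexI R); rewrite rCM sqr_cmod [RHS]rmorph_sum /=.
have E j k : szego k w * conjc (szego j w) = szego k (z j) * (szego k w + conjc (szego j w) - 1).
  by rewrite (szego_product j k w1)// expr1n mul1r.
have mQ j : m%:C * conjc (y j) = (wt j)%:C * conjc (Q (z j)).
  by have := congr1 (@conjc R) (Qz j); rewrite !conjcM !conjc_real.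
have QE j : Q (z j) = \sum_k y k * szego k (z j) by [].
have QcE j : conjc (Q (z j)) = \sum_k conjc (y k) * szego j (z k).
  by rewrite /Q conjc_sum; apply: eq_bigr => k _; rewrite conjcM conj_szego.
transitivity (\sum_j (m%:C * conjc (y j)) * Q (z j) * (conjc (szego j w) - 1) +
    \sum_k (m%:C * y k) * conjc (Q (z k)) * szego k w).
  rewrite /Q conjc_sum mulr_suml mulr_sumr.
  transitivity (\sum_k \sum_j ((m%:C * y k * conjc (y j) * szego k (z j)) * (conjc (szego j w) - 1) +
     (m%:C * y k * conjc (y j) * szego k (z j)) * szego k w)).
    apply: eq_bigr => k _; rewrite mulr_sumr mulr_sumr; apply: eq_bigr => j _.
    rewrite conjcM -mulrDr addrC addrA -[_ * _ * conjc _ * _ * _]mulrA [szego k (z j) * _]mulrC.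
    rewrite (_ : m%:C * (y k * szego k w * (conjc (y j) * conjc (szego j w))) =
      m%:C * y k * conjc (y j) * (szego k w * conjc (szego j w))); last by ring.
    by rewrite E; ring.
  under eq_bigr do rewrite big_split /=.
  rewrite big_split /=; congr (_ + _).
    rewrite exchange_big /=; apply: eq_bigr => j _; rewrite -/(Q _) QE mulr_sumr mulr_suml.
    by apply: eq_bigr => k _; ring.
  apply: eq_bigr => k _; rewrite -/(Q _) QcE mulr_sumr mulr_suml.
  by apply: eq_bigr => j _; ring.
rewrite -big_split /=; apply: eq_bigr => j _.
by rewrite mQ -Qz (rCM _ (P j w)) rCM sqr_cmod -PE//; ring.
Qed.

Let Qz_neq0 : exists j, Q (z j) != 0.
Proof.
have [i xi] := x0; exists i; apply/eqP => Qi.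
have := Qz i; rewrite Qi mulr0 => /esym/eqP; rewrite !mulf_eq0 (negPf xi).
rewrite -!cmod_eq0 !cmodRp ?(ltW eigen_gt0) ?(ltW (s_gt0 i))//.
by rewrite !gt_eqF ?eigen_gt0.
Qed.

(** On the circle [eigenfun_circle] writes the squared modulus as a combination of positive Poisson
    kernels with nonnegative weights, not all zero. *)
Lemma eigenfun_neq0 w : cmod w <= 1 -> Q w != 0.
Proof.
rewrite le_eqVlt => /orP[/eqP w1|]; last exact: eigenfun_neq0_disk.
apply/eqP => Qw; have := eigenfun_circle w1; rewrite Qw cmod0 expr0n mulr0 => /esym/eqP.
have [i Qi] := Qz_neq0.
have Pp j : 0 < P j w.
  by rewrite /P mulr_gt0 ?gap_gt0// exprn_gt0// cmod_gt0 invr_eq0 szego_den// w1.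
rewrite gt_eqF// (bigD1 i)//= ltr_pwDl//.
  apply: mulr_gt0 (Pp _); apply: mulr_gt0 (wt_gt0 _) _.
  by rewrite exprn_gt0// cmod_gt0.
apply: sumr_ge0 => j _; apply: mulr_ge0 (ltW (Pp _)).
by apply: mulr_ge0 (ltW (wt_gt0 _)) _; exact: sqr_ge0.
Qed.

Lemma cdiff_szego j w : cmod w <= 1 -> @cdiff R V (szego j) w.
Proof.
move=> w1; apply: cdiffV; last exact: szego_den.
apply: cdiffB; first exact: cdiff_cst.
by apply: cdiffMs; [exact: cdiff_cst|exact: cdiff_id].
Qed.

Lemma cdiff_eigenfun w : cmod w <= 1 -> @cdiff R V Q w.
Proof.
move=> w1; apply: (@cdiff_sum R V) => k.
by apply: cdiffMs; [exact: cdiff_cst|exact: cdiff_szego].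
Qed.

Lemma cdiff_cofac j w : cmod w <= 1 -> @cdiff R V (cofac j) w.
Proof. by move=> w1; apply: cdiff_prod => k _; apply: cdiff_blf; exact: cmod_mul_lt1. Qed.

(* The squares make [cmod (beurling j w)], for [cmod w = 1], proportional to the
   Poisson kernel at [z j]. *)
Definition beurling j w : V :=
  (Q (z j) / Q w) ^+ 2 * (cofac j w / cofac j (z j)) * ((gap j)%:C * szego j w) ^+ 2.

Lemma beurling_interp j k : beurling j (z k) = (j == k)%:R.
Proof.
rewrite /beurling; have [<-|jk] := eqVneq j k; last by rewrite (cofac_root jk) mul0r mulr0 mul0r.
rewrite !divff ?cofac_neq0 ?eigenfun_neq0 ?(ltW (z1 j))// szego_self divff ?expr1n ?mulr1//.
by rewrite -cmod_gt0 cmodRp ?gap_gt0// ltW// gap_gt0.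
Qed.

Lemma cdiff_beurling j w : cmod w <= 1 -> cdiff (beurling j) w.
Proof.
move=> w1; apply: cdiffMs; last first.
  by apply: cdiffX; apply: cdiffMs; [exact: cdiff_cst|exact: cdiff_szego].
apply: cdiffMs; last by apply: cdiffMs; [exact: cdiff_cofac|exact: cdiff_cst].
apply: cdiffX; apply: cdiff_div; [exact: cdiff_cst|exact: cdiff_eigenfun|exact: eigenfun_neq0].
Qed.

(** On the circle [cofac j] is unimodular, and what remains of [cmod (beurling j w)] is the [j]-th
    term of [eigenfun_circle] divided by [cmod (Q w) ^+ 2]. *)
Lemma beurling_circle w : cmod w = 1 -> \sum_j cmod (beurling j w) = m.
Proof.
move=> w1; have Q0 : 0 < cmod (Q w) ^+ 2 by rewrite exprn_gt0// cmod_gt0 eigenfun_neq0// w1.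
have -> : m = (\sum_j wt j * cmod (Q (z j)) ^+ 2 * P j w) / cmod (Q w) ^+ 2.
  by rewrite -eigenfun_circle// mulfK// gt_eqF.
rewrite mulr_suml; apply: eq_bigr => j _.
have cw : cmod (cofac j w) = 1.
  by rewrite cmod_prod big1// => k _; exact: blf_eq1.
have g0 := cmodRp (ltW (gap_gt0 j)); rewrite /beurling /wt /P.
move: (szego j w) => K; rewrite !(cmodM, cmodX, cmodV) cw g0.
by field; rewrite !gt_eqF ?cmod_cofac_gt0// cmod_gt0 eigenfun_neq0// w1.
Qed.

Lemma beurling_bound w : cmod w < 1 -> \sum_j cmod (beurling j w) <= m.
Proof.
move=> w1.
(* Phases frozen at the given [w] turn the sum of moduli into the value of one holomorphic function,
   open to the maximum principle. *)
pose ph j : C := if beurling j w == 0 then 0 else (cmod (beurling j w))%:C / beurling j w.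
have ph1 j : cmod (ph j) <= 1.
  rewrite /ph; case: eqVneq => [_|b0]; first by rewrite cmod0.
  by rewrite cmodf cmodRp ?cmod_ge0// divff// cmod_eq0.
have phE j : ph j * beurling j w = (cmod (beurling j w))%:C.
  rewrite /ph; case: eqVneq => [->|b0]; first by rewrite mulr0 cmod0.
  by rewrite divfK.
have -> : \sum_j cmod (beurling j w) = cmod (\sum_j ph j * beurling j w).
  have -> : \sum_j ph j * beurling j w = (\sum_j cmod (beurling j w))%:C.
    by rewrite rmorph_sum; apply: eq_bigr => j _; exact: phE.
  by rewrite cmodRp// sumr_ge0// => j _; exact: cmod_ge0.
rewrite -vnorm_scal; apply: (@max_modulus R V (fun u => \sum_j ph j * beurling j u) 1) => // u u1.
  apply: (@cdiff_sum R V) => j.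
  by apply: cdiffMs; [exact: cdiff_cst|exact: cdiff_beurling].
rewrite -(beurling_circle u1) vnorm_scal; apply: le_trans (cmod_sum _ _ _) _.
by apply: ler_sum => j _; rewrite cmodM ler_piMl ?cmod_ge0.
Qed.

(** For real [t] in [(0, 1)] the mean of the squared modulus of [Q] on the circle of radius [t].
    Interpolating functions are given only inside the disc, so [t < 1] is needed; the complex
    variable gives continuity at 1 from differentiability. *)
Let gram (t : C) : C := \sum_k \sum_j y k * conjc (y j) / (1 - t ^+ 2 * (conjc (z k) * z j)).

Let szego0 k : szego k 0 = 1.
Proof. by rewrite /szego mulr0 subr0 invr1. Qed.

Let mean_szego k (t : R) : 0 < t -> t < 1 -> vlim (fun n => cmean n (szego k : C -> V) t) (1 : V).
Proof.
move=> t0 t1; rewrite -(szego0 k); apply: (@mean_value R V) => // [w /andP[_ wt]|].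
  by apply: cdiff_szego; lra.
by apply: cdiff_cont; apply: cdiff_szego; rewrite cmod0.
Qed.

Let mean_gram (t : R) : 0 < t -> t < 1 ->
  vlim (fun n => cmean n (fun w => Q w * conjc (Q w) : V) t) (gram t%:C : V).
Proof.
move=> t0 t1.
pose c k j : C := y k * conjc (y j) / (1 - t%:C ^+ 2 * (conjc (z k) * z j)).
have L k j : vlim (fun n => c k j *: (cmean n (szego k : C -> V) t +
    conjc (cmean n (szego j : C -> V) t) - 1) : V) (c k j : V).
  have := vlimZ (c k j) (vlimB (vlimD (mean_szego k t0 t1) (vlim_conj (mean_szego j t0 t1))) (vlim_cst (1 : V))).
  by rewrite conjc1 addrK /GRing.scale /= mulr1.
have := vlim_sum (index_enum 'I_n.+1) (fun k => vlim_sum (index_enum 'I_n.+1) (L k)).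
apply: vlim_ext => N'.
rewrite (@cmean_ext R V N' (fun w => Q w * conjc (Q w)) (fun w => \sum_k \sum_j c k j *: ((szego k w : V) + (conjc (szego j w) : V) - (1 : V)))) //; last first.
  move=> w wt; rewrite /Q conjc_sum mulr_suml; apply: eq_bigr => k _.
  rewrite mulr_sumr; apply: eq_bigr => j _; rewrite conjcM mulrACA (szego_product j k wt) ?(ltW t1)//.
  have t2 : (t ^+ 2)%:C = t%:C ^+ 2 :> C by exact: rmorphXn.
  by rewrite t2 /c /GRing.scale /= [LHS]mulrA; exact: erefl.
rewrite cmean_sum; apply: eq_bigr => k _; rewrite cmean_sum; apply: eq_bigr => j _.
by rewrite cmeanZ cmeanB cmeanD cmean_cst cmean_conj.
Qed.

Let S : R := \sum_j wt j * cmod (Q (z j)) ^+ 2.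

(* Cauchy's formula on [|w| = t], applied to [w Q(w)^2 g(w) / \prod_i blf (z i) w]. *)
Lemma eigenvalue_le_circle (K : R) (g : C -> V) (t b : R) :
  (forall w, cmod w < 1 -> cdiff g w) -> (forall w, cmod w < 1 -> cmod (g w) <= K) ->
  (forall j, (g (z j) : C) * Q (z j) ^+ 2 * (cmod (cofac j (z j)))%:C =
    (cmod (Q (z j)) ^+ 2)%:C * cofac j (z j)) ->
  0 < t -> t < 1 -> (forall j, cmod (z j) < t) -> 0 < b ->
  (forall w, cmod w = t -> b <= cmod (\prod_j blf (z j) w)) ->
  S * b <= K * complex.Re (gram t%:C).
Proof.
move=> gd gK gz t0 t1 zt b0 Hb.
have K0 : 0 <= K by apply: le_trans (gK 0 _); rewrite ?cmod_ge0 ?cmod0.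
have gapn j : (gap j)%:C != 0 :> C by rewrite -cmod_gt0 cmodRp ?gap_gt0// ltW// gap_gt0.
pose cf j : C := (wt j * cmod (Q (z j)) ^+ 2)%:C.
(* The subtracted sum agrees with [Q ^+ 2 * g] at the nodes by the choice of the data, so [G] is
   divisible by the product of all [w - z i]. *)
pose G w : C := Q w ^+ 2 * g w - \sum_j cf j * (gap j)%:C * cofac j w * szego j w ^+ 2.
pose D w : C := \prod_i (1 - conjc (z i) * w).
pose bl w : C := \prod_i blf (z i) w.
have Gz i : G (z i) = 0.
  rewrite /G (bigD1 i)//= big1 ?addr0 => [|j ji]; last by rewrite cofac_root// mulr0 mul0r.
  apply/eqP; rewrite subr_eq0; apply/eqP.
  have cn : (cmod (cofac i (z i)))%:C != 0 :> C.
    by rewrite -cmod_gt0 cmodRp ?cmod_cofac_gt0// cmod_ge0.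
  apply: (mulIf cn); rewrite [_ * g _]mulrC gz /cf /wt !rCM fmorphV /= szego_self.
  by field; rewrite gapn cn.
have Gd w : cmod w < 1 -> @cdiff R V G w.
  move=> w1; apply: cdiffB.
    apply: cdiffMs (gd _ w1); apply: cdiffX; exact: cdiff_eigenfun (ltW w1).
  apply: (@cdiff_sum R V) => j; apply: cdiffMs; last by apply: cdiffX; exact: cdiff_szego (ltW w1).
  by apply: cdiffMs; [exact: cdiff_cst|exact: cdiff_cofac (ltW w1)].
have [||a|k kd kE] := @factor_roots R G [seq z i | i : 'I_n.+1] _ _ Gd.
- by rewrite map_inj_uniq ?enum_uniq.
- by move=> a /mapP[i _ ->].
- by case/mapP => i _ ->.
pose f1 w : C := w * (k w * D w).
pose f2 j w : C := (w / (w - z j)) * ((gap j)%:C * szego j w).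
(* [L] is the sum of [f1], holomorphic with value 0 at 0 and hence of mean 0, and of the Cauchy
   kernels [f2 j] with coefficients [cf j] and mean 1. So its mean is [S]. *)
pose L w : C := w * (Q w ^+ 2 * g w) / bl w.
have bln w : cmod w = t -> bl w != 0.
  by move=> wt; rewrite -cmod_gt0; apply: lt_le_trans b0 (Hb _ wt).
have LE w : cmod w = t -> L w = f1 w + \sum_j cf j * f2 j w.
  move=> wt; have b1 := bln _ wt.
  have wd j : 1 - conjc (z j) * w != 0 by rewrite szego_den// wt ltW.
  have wz j : w - z j != 0.
    by rewrite subr_eq0; apply: contraTneq (zt j) => <-; rewrite wt ltxx.
  have E1 : bl w * D w = \prod_(a <- [seq z i | i : 'I_n.+1]) (w - a).
    rewrite big_map big_enum -big_split /=; apply: eq_bigr => i _.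
    by rewrite /blf divfK.
  rewrite /L -[Q w ^+ 2 * g w](subrK (\sum_j cf j * (gap j)%:C * cofac j w * szego j w ^+ 2)).
  rewrite -/(G w) kE -E1 mulrDr mulrDl; congr (_ + _); first by rewrite /f1; field.
  rewrite mulr_sumr mulr_suml; apply: eq_bigr => j _.
  have E2 : bl w = blf (z j) w * cofac j w by rewrite /bl (bigD1 j).
  rewrite E2 in b1 *; have cn : cofac j w != 0 by apply: contraNneq b1 => ->; rewrite mulr0.
  rewrite /f2 /szego /blf; move: (cofac j w) cn => cc cn.
  by field; rewrite cn wd wz.
have lim1 : vlim (fun N' => cmean N' (f1 : C -> V) t) (0 : V).
  have -> : (0 : V) = f1 0 by rewrite /f1 mul0r.
  have f1d w : cmod w < 1 -> @cdiff R V f1 w.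
    move=> w1; apply: cdiffMs; first exact: cdiff_id.
    apply: cdiffMs; first exact: kd.
    apply: cdiff_prod => i _; apply: cdiffB; first exact: cdiff_cst.
    by apply: cdiffMs; [exact: cdiff_cst|exact: cdiff_id].
  apply: (@mean_value R V) => // [w /andP[_ wt]|]; first by apply: f1d; lra.
  by apply: cdiff_cont; apply: f1d; rewrite cmod0.
have f2d j w : cmod w < 1 -> @cdiff R V (fun w => (gap j)%:C * szego j w) w.
  by move=> w1; apply: cdiffMs; [exact: cdiff_cst|exact: cdiff_szego (ltW w1)].
have lim2 j : vlim (fun N' => cmean N' (f2 j : C -> V) t) (1 : V).
  have -> : (1 : V) = (gap j)%:C * szego j (z j) by rewrite szego_self divff.
  apply: (@cauchy_disk R V (fun w => (gap j)%:C * szego j w : V) t (z j)) => // [w /andP[_ wt]|].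
    by apply: f2d; lra.
  by apply: cdiff_cont; apply: f2d; rewrite cmod0.
have lim3 : vlim (fun N' => cmean N' (L : C -> V) t) (S%:C : V).
  have -> : S%:C = 0 + \sum_j cf j *: (1 : V).
    rewrite add0r /S rmorph_sum /=; apply: eq_bigr => j _.
    by rewrite /GRing.scale /= mulr1.
  have := vlimD lim1 (vlim_sum (index_enum 'I_n.+1) (fun j => vlimZ (cf j) (lim2 j))).
  apply: vlim_ext => N'.
  rewrite (@cmean_ext R V N' L (fun w => f1 w + \sum_j cf j *: (f2 j w : V)) t t0 LE).
  by rewrite cmeanD cmean_sum; congr (_ + _); apply: eq_bigr => j _; rewrite cmeanZ.
have := vlim_Re_le _ lim3 (vlimZ (K / b)%:C (mean_gram t0 t1)).
rewrite vnorm_scal cmodRp; last first.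
  by apply: sumr_ge0 => j _; apply: mulr_ge0 (ltW (wt_gt0 _)) _; exact: sqr_ge0.
have ReZ (u : R) (v : C) : complex.Re (u%:C * v) = u * complex.Re v.
  by case: v => v1 v2 /=; rewrite mul0r subr0.
move=> W; suff {W} : forall N', vnorm (cmean N' (L : C -> V) t) <=
    complex.Re ((K / b)%:C *: (cmean N' (fun w => Q w * conjc (Q w) : V) t)).
  by move=> /W; rewrite /GRing.scale /= ReZ mulrAC ler_pdivlMr.
move=> N'; rewrite -cmeanZ.
apply: cmean_domination => // w wt; rewrite vnorm_scal /GRing.scale /= -sqr_cmod ReZ /=.
rewrite /L cmodf (cmodM w) (cmodM (_ ^+ 2)) cmodX wt ler_pdivrMr ?cmod_gt0 ?bln//.
have := Hb _ wt; have := gK w; rewrite wt => /(_ t1); rewrite -/(bl w).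
move: (cmod (bl w)) (cmod (g w)) (cmod_ge0 (g w)) (sqr_ge0 (cmod (Q w))) => B' g' g0.
move: (cmod (Q w) ^+ 2) => q q0 gK' bB.
have : K / b * q * b <= K / b * q * B'.
  by rewrite ler_wpM2l// mulr_ge0// divr_ge0// ltW.
have -> : K / b * q * b = K * q by field; rewrite gt_eqF.
apply: le_trans; apply: le_trans (_ : 1 * (q * g') <= _).
  by rewrite ler_wpM2r ?mulr_ge0// ltW.
by rewrite mul1r mulrC ler_wpM2r.
Qed.

(** At [t = 1] the coefficients of [gram] are Szego kernels at the nodes, so one summation gives a
    value of [Q] and the eigenvalue equation the rest. *)
Let gram1 : m * complex.Re (gram 1) = S.
Proof.
have E : m%:C * gram 1 = S%:C.
  rewrite /gram exchange_big /= mulr_sumr rmorph_sum /=; apply: eq_bigr => j _.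
  have -> : \sum_k y k * conjc (y j) / (1 - 1 ^+ 2 * (conjc (z k) * z j)) = conjc (y j) * Q (z j).
    by rewrite /Q mulr_sumr; apply: eq_bigr => k _; rewrite expr1n mul1r /szego mulrCA mulrA.
  have mQ : m%:C * conjc (y j) = (wt j)%:C * conjc (Q (z j)).
    by have := congr1 (@conjc R) (Qz j); rewrite !conjcM !conjc_real.
  by rewrite mulrA mQ -mulrA mulC_conj -rCM.
have -> : m * complex.Re (gram 1) = complex.Re (m%:C * gram 1).
  by case: (gram 1) => u v /=; rewrite mul0r subr0.
by rewrite E.
Qed.

(** As [t] tends to 1, [eigenvalue_le_circle] becomes [S <= K * Re (gram 1)], while
    [S = m * Re (gram 1)]. The unimodular data [p j * q j] are chosen so that all residues are
    nonnegative and nothing cancels. *)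
Lemma eigenvalue_le (K : R) : 0 <= K ->
  (forall a : 'I_n.+1 -> C, (forall j, cmod (a j) <= 1) -> exists g : C -> V,
    [/\ forall w, cmod w < 1 -> cdiff g w, forall w, cmod w < 1 -> cmod (g w) <= K &
    forall j, g (z j) = a j]) -> m <= K.
Proof.
move=> K0 Hg; pose q j : C := cofac j (z j) / (cmod (cofac j (z j)))%:C.
pose p j : C := if Q (z j) == 0 then 1 else (cmod (Q (z j)) ^+ 2)%:C / Q (z j) ^+ 2.
have cn j : (cmod (cofac j (z j)))%:C != 0 :> C.
  by rewrite -cmod_gt0 cmodRp ?cmod_cofac_gt0// cmod_ge0.
have [|g [gd gK gz]] := Hg (fun j => p j * q j).
  move=> j; rewrite cmodM /q cmodf cmodRp ?cmod_ge0// divff ?gt_eqF ?cmod_cofac_gt0// mulr1.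
  rewrite /p; case: eqVneq => [_|Qn]; first by rewrite cmod1.
  by rewrite cmodf cmodX cmodRp ?sqr_ge0// divff// expf_neq0// cmod_eq0.
have gz' j : (g (z j) : C) * Q (z j) ^+ 2 * (cmod (cofac j (z j)))%:C =
    (cmod (Q (z j)) ^+ 2)%:C * cofac j (z j).
  rewrite gz /p /q; have [->|Qn] := eqVneq (Q (z j)) 0.
    by rewrite cmod0 !expr0n /= !(rmorph0, mulr0, mul0r).
  by move: (cofac j _) (cn j) => c c0; field; rewrite c0 Qn.
have S0 : 0 < S.
  have [i Qi] := Qz_neq0; rewrite /S (bigD1 i)//= ltr_pwDl//.
    by rewrite mulr_gt0 ?wt_gt0// exprn_gt0// cmod_gt0.
  by apply: sumr_ge0 => j _; apply: mulr_ge0 (ltW (wt_gt0 _)) _; exact: sqr_ge0.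
have m0 := eigen_gt0.
have E0 : 0 < complex.Re (gram 1) by rewrite -(pmulr_rgt0 _ m0) gram1.
suff : S <= K * complex.Re (gram 1) by rewrite -gram1 ler_pM2r.
apply/ler_addgt0Pr => e e0.
pose d := Num.min (2^-1) (e / (S + K)).
have SK : 0 < S + K by lra.
have d0 : 0 < d by rewrite lt_min divr_gt0// andbT; lra.
have d2 : d <= 2^-1 by rewrite ge_min lexx.
(* The lower bound of [blf_lower] for the whole Blaschke product on the circle of radius [t]; it
   equals 1 at [t = 1]. *)
pose bt (t : C) : C := \prod_i blf (cmod (z i))%:C t.
have bt1 : bt 1 = 1.
  rewrite /bt big1// => i _; rewrite /blf conjc_real mulr1 divff//.
  by rewrite -(rmorph1 (real_complex R)) -rmorphB -cmod_gt0 cmodRp ?subr_gt0// subr_ge0 ltW.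
have btd : @cdiff R V bt 1.
  apply: cdiff_prod => i _; apply: cdiff_blf.
  by rewrite cmod1 mulr1 cmodRp ?cmod_ge0.
have grd : @cdiff R V gram 1.
  apply: (@cdiff_sum R V) => k; apply: (@cdiff_sum R V) => j.
  apply: cdiff_div; first exact: cdiff_cst.
    apply: cdiffB; first exact: cdiff_cst.
    by apply: cdiffMs; [apply: cdiffX; exact: cdiff_id|exact: cdiff_cst].
  by rewrite expr1n mul1r szego_den// ltW.
have [e1 e10 H1] := cdiff_cont btd d0.
have [e2 e20 H2] := cdiff_cont grd d0.
pose mx := \big[Num.max/0]_i cmod (z i).
have mx1 : mx < 1.
  by apply: (big_ind (fun u : R => u < 1)) => // u v u1 v1; rewrite gt_max u1.
have zmx i : cmod (z i) <= mx by exact: le_bigmax_cond.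
have mx0 : 0 <= mx by apply: le_trans (zmx ord0); exact: cmod_ge0.
pose h := Num.min (Num.min (e1 / 2) (e2 / 2)) ((1 - mx) / 2).
have h0 : 0 < h by rewrite !lt_min; apply/andP; split; [apply/andP; split|]; lra.
have he1 : h <= e1 / 2 by rewrite !ge_min lexx.
have he2 : h <= e2 / 2 by rewrite !ge_min lexx orbT.
have hmx : h <= (1 - mx) / 2 by rewrite ge_min lexx orbT.
pose t := 1 - h.
have t0 : 0 < t by rewrite /t; lra.
have t1 : t < 1 by rewrite /t; lra.
have zt i : cmod (z i) < t by have := zmx i; rewrite /t; lra.
have tE : t%:C = 1 + - h%:C :> C by rewrite /t rmorphB.
have hE : cmod (- h%:C) = h by rewrite cmodN cmodRp ?ltW.
have B1 : cmod (bt t%:C - 1) <= d.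
  by have := H1 (- h%:C); rewrite -tE hE vnorm_scal bt1; apply; lra.
have G1 : cmod (gram t%:C - gram 1) <= d.
  by have := H2 (- h%:C); rewrite -tE hE vnorm_scal; apply; lra.
pose b := complex.Re (bt t%:C).
have btE : bt t%:C = (\prod_i complex.Re (blf (cmod (z i))%:C t%:C))%:C.
  rewrite /bt rmorph_prod; apply: eq_bigr => i _.
  by have [_ _] := @blf_lower R (z i) t%:C t (zt i) t1 (cmodRp (ltW t0)).
have [b1 _] := normReIm (bt t%:C - 1); rewrite raddfB /= in b1.
have b2 := ler_norm (-(complex.Re (bt t%:C) - 1)); rewrite normrN in b2.
have bb : 1 - d <= b by rewrite /b; lra.
have b0 : 0 < b by lra.
have [g1 _] := normReIm (gram t%:C - gram 1); rewrite raddfB /= in g1.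
have g2 := ler_norm (complex.Re (gram t%:C) - complex.Re (gram 1)).
have := eigenvalue_le_circle gd gK gz' t0 t1 zt b0.
have W w : cmod w = t -> b <= cmod (\prod_j blf (z j) w).
  move=> wt; rewrite cmod_prod /b btE /=; apply: ler_prod => i _.
  by have [W0 W1 _] := blf_lower (zt i) t1 wt; rewrite W1 andbT.
have dSK : d * (S + K) <= e by rewrite -ler_pdivlMr// ge_min lexx orbT.
move=> /(_ W).
have : S * (1 - d) <= S * b by rewrite ler_pM2l.
have : K * complex.Re (gram t%:C) <= K * (complex.Re (gram 1) + d).
  by rewrite ler_wpM2l//; lra.
by lra.
Qed.

End Eigen.
End FiniteBeurling.

(** Minimality of [m] is stated against every admissible [K], the form in which the infimum
    [interp_const] can use it. *)
Theorem finite_beurling (R : realType) n (z : 'I_n.+1 -> R[i]) :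
  (forall i, cmod (z i) < 1) -> injective z ->
  exists (f : 'I_n.+1 -> R[i] -> (R[i])^o) (m : R),
  [/\ forall j w, cmod w < 1 -> cdiff (f j) w,
      forall j k, f j (z k) = (j == k)%:R,
      forall w, cmod w < 1 -> \sum_j cmod (f j w) <= m &
      forall K : R, 0 <= K ->
        (forall a : 'I_n.+1 -> R[i], (forall j, cmod (a j) <= 1) -> exists g : R[i] -> (R[i])^o,
          [/\ forall w, cmod w < 1 -> cdiff g w, forall w, cmod w < 1 -> cmod (g w) <= K &
          forall j, g (z j) = a j]) -> m <= K].
Proof.
move=> z1 zi.
pose s j : R := Num.sqrt (wt z j).
pose T j k : R[i] := (s j)%:C * szego z k (z j) * (s k)%:C.
have [j k|m [x [x0 eig top]]] := @top_eigenvector R n T.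
  by rewrite /T !conjcM !conjc_real conj_szego; ring.
exists (beurling z x), m; split.
- by move=> j w w1; apply: (cdiff_beurling z1 zi x0 eig top); exact: ltW.
- exact: (beurling_interp z1 zi x0 eig top).
- by move=> w; exact: (beurling_bound z1 zi x0 eig top).
- by move=> K; exact: (eigenvalue_le z1 zi x0 eig top).
Qed.

(** * Beurling functions for a sequence *)

Section InfiniteBeurling.
Variable R : realType.
Local Notation C := R[i].
Notation V := (R[i])^o.

Lemma ultra_limit (U : set_system nat) (u : nat -> C) (B : R) : UltraFilter U ->
  (forall n, cmod (u n) <= B) -> exists l : C, forall e, 0 < e -> U [set n | cmod (u n - l) <= e].
Proof.
move=> UU uB.
have real (x : nat -> R) : (forall n, `|x n| <= B) -> exists l, forall e, 0 < e -> U [set n | `|l - x n| <= e].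
  move=> xB; have := @segment_compact R (- B) B (x @ U) _.
  have xU : U (x @^-1` `[(- B), B]%classic).
    by apply: filterS filterT => n _ /=; have := xB n; rewrite ler_norml in_itv.
  move=> /(_ _ xU)[l [_ cl]]; exists l => e e0.
  have [//|UC] := in_ultra_setVsetC [set n | `|l - x n| <= e] UU.
  have [] := cl (x @` ~` [set n | `|l - x n| <= e]) [set y | `|l - y| < e].
  - have : U (x @^-1` (x @` ~` [set n | `|l - x n| <= e])) by apply: filterS UC => n; exists n.
    by [].
  - by apply/nbhs_normP; exists e.
  by move=> _ [[n ? <-] /= /ltW].
have [n|a Ha] := real (fun n => complex.Re (u n)).
  by apply: le_trans (uB n); case: (normReIm (u n)).
have [n|b Hb] := real (fun n => complex.Im (u n)).
  by apply: le_trans (uB n); case: (normReIm (u n)).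
exists (a +i* b)%C => e e0; have e2 : 0 < e / 2 by lra.
apply: filterS (filterI (Ha _ e2) (Hb _ e2)) => n /= [h1 h2].
apply: le_trans (cmod_ReIm _) _; rewrite !raddfB /= distrC [X in _ + X]distrC; lra.
Qed.

Definition interp_bounds (z : nat -> C) : set R := [set M : R | 0 <= M /\
    forall (a : nat -> cplx R) (B : R), (forall n, cmod (a n) <= B) ->
      exists g : cplx R -> cplx R, [/\ Hinf (odisk 1) g,
        (forall n, g (z n) = a n) &
        (forall w, odisk 1 w -> cmod (g w) <= M * B)]].

Theorem beurling_functions (z : nat -> C) : (forall n, cmod (z n) < 1) -> injective z ->
  interp_bounds z !=set0 ->
  exists f : nat -> C -> V,
  [/\ forall j w, cmod w < 1 -> cdiff (f j) w,
      forall j k, f j (z k) = (j == k)%:R &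
      forall w n, cmod w < 1 -> \sum_(j < n) cmod (f j w) <= interp_const z].
Proof.
move=> z1 zinj ne; set M := interp_const z.
have fin N : exists f : nat -> C -> V, [/\ forall j w, cmod w < 1 -> cdiff (f j) w,
    forall j k, (j <= N)%N -> (k <= N)%N -> f j (z k) = (j == k)%:R &
    forall w n, cmod w < 1 -> \sum_(j < n) cmod (f j w) <= M].
  have [|i j /zinj/val_inj//|f [m [fd fz fm mK]]] := @finite_beurling R N (fun i => z i) => //.
  pose F j w : V := if (j <= N)%N then f (inord j) w else 0.
  exists F; split.
  - move=> j w w1; rewrite /F; case: (j <= N)%N; [exact: fd|exact: cdiff_cst].
  - move=> j k jN kN; rewrite /F jN -[k in z k](@inordK N)// fz; congr (_%:R).
    by rewrite -(inj_eq val_inj) /= !inordK.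
  (* A constant admissible for the sequence is admissible for its first [N + 1] points, the data
     being extended by 0. So [m] is a lower bound of the set whose infimum is [M]. *)
  move=> w n w1; apply: le_trans (_ : m <= M); last first.
    apply: lb_le_inf => // K [K0 HK]; apply: mK => // a a1.
    have [|g [[gd _] gz gK]] := HK (fun n => if (n <= N)%N then a (inord n) else 0) 1.
      by move=> k; case: ifP => _; rewrite ?cmod0.
    exists g; split=> [w' /gd/cder_derivable//|w' /gK|j]; first by rewrite mulr1.
    by rewrite gz -ltnS ltn_ord inord_val.
  apply: le_trans (fm w w1).
  have -> : \sum_j cmod (f j w) = \sum_(j < N.+1) cmod (F j w).
    by apply: eq_bigr => j _; rewrite /F -ltnS ltn_ord inord_val.
  have F0 j : ~~ (j < N.+1)%N -> cmod (F j w) = 0 by rewrite ltnS /F => /negPf ->; rewrite cmod0.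
  have [nN|nN] := leqP n N.+1.
    rewrite (big_ord_widen _ (fun j => cmod (F j w)) nN) [leRHS](bigID (fun j : 'I_N.+1 => (j < n)%N))/=.
    by rewrite lerDl sumr_ge0// => j _; exact: cmod_ge0.
  rewrite (big_ord_widen _ (fun j => cmod (F j w)) (ltnW nN)) (bigID (fun j : 'I_n => (j < N.+1)%N))/=.
  by rewrite [X in _ + X]big1 ?addr0// => j; exact: F0.
have [F HF] := choice fin.
(* [U] refines the filter at infinity, so what holds for all large [N] holds on a set of [U]; the
   limits then exist for all [j] and [w] at once, without subsequences. *)
have [U [UU oU]] := @ultraFilterLemma nat \oo _.
have UI A B : U A -> U B -> U (A `&` B) by exact: filterI.
have Uex A : U A -> exists N, A N by exact: filter_ex.
have Ub j w : cmod w < 1 -> exists l : C, forall e, 0 < e -> U [set N | cmod (F N j w - l) <= e].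
  move=> w1; apply: (@ultra_limit U _ M) => N.
  have [_ _ /(_ w j.+1 w1)] := HF N; apply: le_trans; rewrite big_ord_recr /= lerDr.
  by apply: sumr_ge0 => i _; exact: cmod_ge0.
have Uf jw : exists l : C, cmod jw.2 < 1 -> forall e, 0 < e -> U [set N | cmod (F N jw.1 jw.2 - l) <= e].
  have [w1|w1] := pselect (cmod jw.2 < 1); last by exists 0.
  by have [l Hl] := Ub jw.1 jw.2 w1; exists l.
have [f' Hf'] := choice Uf; pose f j w : V := f' (j, w).
have Hf j w : cmod w < 1 -> forall e, 0 < e -> U [set N | cmod (F N j w - f j w) <= e].
  exact: (Hf' (j, w)).
exists f; split.
- move=> j w w1; have s0 : 0 < (1 - cmod w) / 2 by lra.
  have D p : cmod (p - w) <= (1 - cmod w) / 2 -> cmod p < 1.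
    by move=> hp; have := cmodD (p - w) w; rewrite subrK; lra.
  (* Three points are approximated at a time, by an index in the intersection of three sets of
     [U]. *)
  apply: (@cdiff_closure R V nat (fun N => F N j) _ w ((1 - cmod w) / 2) M) => //.
  + exact: scalar_complete.
  + by move=> N p /D p1; have [+ _ _] := HF N; apply.
  + move=> N p /D p1; rewrite vnorm_scal.
    have [_ _ /(_ p j.+1 p1)] := HF N; apply: le_trans; rewrite big_ord_recr /= lerDr.
    by apply: sumr_ge0 => i _; exact: cmod_ge0.
  move=> p q r /D p1 /D q1 /D r1 e e0.
  have /Uex[N [h1 [h2 h3]]] := UI _ _ (Hf j p p1 e e0) (UI _ _ (Hf j q q1 e e0) (Hf j r r1 e e0)).
  by exists N; rewrite !vnorm_scal.
- move=> j k; apply/eqP; rewrite -subr_eq0 -cmod_eq0 eq_le cmod_ge0 andbT.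
  apply/ler_addgt0Pr => e e0; rewrite add0r.
  have J : U [set N | (maxn j k <= N)%N] by apply: oU; exists (maxn j k).
  have /Uex[N [h1 /=]] := UI _ _ (Hf j (z k) (z1 k) e e0) J.
  rewrite geq_max => /andP[jN kN]; have [_ /(_ j k jN kN) <- _] := HF N.
  by rewrite cmodC.
move=> w n w1; apply/ler_addgt0Pr => e e0; pose e' := e / n.+1%:R.
have e'0 : 0 < e' by rewrite divr_gt0.
(* A finite intersection: a single [N] serves for all [j < n]. *)
have : U [set N | forall j, (j < n)%N -> cmod (F N j w - f j w) <= e'].
  move: e' e'0; elim: n => [|n IH] d d0; first by apply: filterS filterT.
  apply: filterS (UI _ _ (IH d d0) (Hf n w w1 d d0)) => N [h1 h2] j.
  by rewrite ltnS leq_eqVlt => /orP[/eqP ->|/h1].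
move=> /Uex[N /= HN]; have [_ _ /(_ w n w1) S] := HF N.
have : \sum_(j < n) cmod (f j w) <= \sum_(j < n) cmod (F N j w) + \sum_(j < n) e'.
  rewrite -big_split /=; apply: ler_sum => j _.
  by have := HN j (ltn_ord j); have := cmod_lbB (f j w) (F N j w); rewrite (cmodC (f j w)); lra.
have : \sum_(j < n) e' <= e.
  rewrite sumr_const card_ord -[_ *+ _]mulr_natr /e' mulrAC ler_pdivrMr// ler_pM2l// ler_nat//.
by lra.
Qed.

End InfiniteBeurling.

(** * The splitting operators *)

Section OperatorCalculus.
Variables (R : realType) (X : completeNormedModType R[i]).
Local Notation C := R[i].
Notation V := (R[i])^o.
Implicit Types (U W : set C) (f g : C -> X) (T : (C -> X) -> (C -> X)).

Lemma bop_pullback U W (h : C -> V) : (forall z, W z -> U (h z) /\ cdiff h z) ->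
  bop U W (fun f z => f (h z) : X) 1.
Proof.
move=> Hh; split=> [f [df _] z Wz|f B _ HB z Wz|f g _ _ fg z Wz|//].
- by have [Uz hz] := Hh z Wz; apply: (@cdiff_comp R X h f) => //; exact: df.
- by rewrite mul1r; apply: HB; case: (Hh z Wz).
- by apply: fg; case: (Hh z Wz).
Qed.

Lemma bop_zero U W : bop U W (fun _ _ => 0 : X) 0.
Proof.
split=> // [f _ z _|f B _ _ z _|k l f g _ _ z _]; first exact: cdiff_cst.
  by rewrite vnorm0 mul0r.
by rewrite !scaler0 addr0.
Qed.

Lemma bounded_combination_cvg (g : nat -> C) (x : nat -> X) (M B : R) :
  (forall n, \sum_(m < n) cmod (g m) <= M) -> (forall m, vnorm (x m) <= B) ->
  exists l, vlim (fun n => \sum_(m < n) g m *: x m) l.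
Proof.
move=> gM xB; have B0 : 0 <= B by apply: le_trans (xB 0%N); exact: vnorm_ge0.
apply: (@bounded_variation_cvg R X _ (fun m => cmod (g m) * B) (M * B)).
- exact: complete_seqcomplete.
- move=> n; rewrite big_ord_recr /= [X in vnorm X]addrC addrA addNr add0r vnormZ.
  by rewrite ler_wpM2l ?cmod_ge0.
- by move=> n; rewrite -mulr_suml ler_wpM2r.
Qed.

(** The bound [M] on the sums of moduli gives both pointwise absolute convergence and the bound
    [M * K] for all partial sums, so [bop_lim] applies. *)
Lemma bop_series U W (g : nat -> C -> V) (T : nat -> (C -> X) -> (C -> X)) (K M : R) : copen W ->
  (forall m z, W z -> cdiff (g m) z) -> (forall n z, W z -> \sum_(m < n) cmod (g m z) <= M) ->
  (forall m, bop U W (T m) K) ->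
  bop U W (fun f z => limn (fun n => \sum_(m < n) (g m z : C) *: T m f z)) (M * K) /\
  forall f z, bhol U f -> W z -> vlim (fun n => \sum_(m < n) (g m z : C) *: T m f z)
    (limn (fun n => \sum_(m < n) (g m z : C) *: T m f z)).
Proof.
move=> oW gd gM HT.
have L f z : bhol U f -> W z -> exists l, vlim (fun n => \sum_(m < n) (g m z : C) *: T m f z) l.
  move=> Hf Wz; have [_ [B HB]] := Hf.
  apply: (@bounded_combination_cvg (fun m => g m z) (fun m => T m f z) M (K * B)); first by move=> n; exact: gM.
  by move=> m; exact: (bop_bound (HT m)).
split; last by move=> f z Hf Wz; have [l H] := L f z Hf Wz; rewrite (vlim_limn H).
apply: (@bop_lim R X U W (fun n f z => \sum_(m < n) (g m z : C) *: T m f z)) => // n.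
split=> [f Hf z Wz|f B Hf HB z Wz|f h Hf Hh fh z Wz|k l f h Hf Hh z Wz].
- apply: cdiff_sum => m; apply: cdiffM; first exact: gd.
  exact: (bop_holo (HT m)).
- have KB m : vnorm (T m f z) <= K * B by exact: (bop_bound (HT m)).
  have KB0 : 0 <= K * B by apply: le_trans (KB 0%N); exact: vnorm_ge0.
  apply: le_trans (vnorm_sum _ _ _) _; rewrite -mulrA.
  apply: le_trans (_ : \sum_(m < n) cmod (g m z) * (K * B) <= _).
    by apply: ler_sum => m _; rewrite vnormZ ler_wpM2l ?cmod_ge0.
  by rewrite -mulr_suml ler_wpM2r// gM.
- by apply: eq_bigr => m _; congr (_ *: _); exact: (bop_local (HT m)).
- rewrite !scaler_sumr -big_split /=; apply: eq_bigr => m _.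
  by rewrite (bop_linear (HT m))// scalerDr !scalerA mulrC [l * _]mulrC.
Qed.

Lemma bop_id_sub U T K K' : bop U U T K ->
  (forall f B, bhol U f -> bounded_by U f B -> bounded_by U (fun z => f z - T f z) (K' * B)) ->
  bop U U (fun f z => f z - T f z) K'.
Proof.
move=> [H1 H2 H3 H4] H5; split=> [f Hf z Uz|//|f g Hf Hg fg z Uz|k l f g Hf Hg z Uz].
- by apply: cdiffB; [case: Hf => + _; apply|exact: H1].
- by rewrite fg// (H3 f g).
- by rewrite H4//; lmodule R[i] X.
Qed.

(* [N] is the Neumann series of [(1 - D)^-1]. *)
Lemma bop_neumann U (D : (C -> X) -> (C -> X)) : copen U -> bop U U D (1 / 2) ->
  exists2 N : (C -> X) -> (C -> X), bop U U N 2 &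
    forall f z, bhol U f -> U z -> N f z - D (N f) z = f z.
Proof.
move=> oU HD.
(* Partial sums in Horner form; the norm bound 2 is reproduced by [1 + 1 / 2 * 2]. *)
pose S := fix S n f : C -> X := if n is n'.+1 then fun z => f z + D (S n' f) z else f.
have HS n : bop U U (S n) 2.
  elim: n => [|n IH] /=.
    split=> // [f [] //|f B Hf HB z Uz]; apply: le_trans (HB z Uz) _.
    by have := le_trans (vnorm_ge0 _) (HB z Uz); lra.
  have HDS := bop_comp IH HD.
  split=> [f Hf z Uz|f B Hf HB z Uz|f g Hf Hg fg z Uz|k l f g Hf Hg z Uz].
  - by apply: cdiffD; [case: Hf => + _; apply|exact: (bop_holo HDS)].
  - have := bop_bound HDS Hf HB Uz; have := HB z Uz; have := vnormD (f z) (D (S n f) z); lra.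
  - by rewrite fg// (bop_local HDS Hf Hg fg).
  - by rewrite (bop_linear HDS)//; lmodule R[i] X.
have Dsub f g B : bhol U f -> bhol U g -> bounded_by U (fun z => f z - g z) B ->
    bounded_by U (fun z => D f z - D g z) (1 / 2 * B).
  move=> Hf Hg HB z Uz.
  have E : D f z - D g z = D (fun w => 1 *: f w + (-1) *: g w) z.
    by rewrite (bop_linear HD)// scale1r scaleN1r.
  rewrite E; apply: (bop_bound HD) => //; first exact: bhol_lin.
  by move=> w Uw; rewrite scale1r scaleN1r; exact: HB.
have step f B n : bhol U f -> bounded_by U f B ->
    bounded_by U (fun z => S n.+1 f z - S n f z) (B * (1 / 2) ^+ n.+1).
  move=> Hf HB; elim: n => [|n IH].
    move=> z Uz /=; rewrite addrC addrA addNr add0r expr1 mulrC.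
    exact: (bop_bound HD).
  move=> z Uz; rewrite (_ : S n.+2 f z - S n.+1 f z = D (S n.+1 f) z - D (S n f) z).
    rewrite exprS mulrCA; apply: Dsub => //; exact: (bop_bhol (HS _)).
  by rewrite /=; lmodule R[i] X.
have geo (B : R) n : 0 <= B -> \sum_(i < n) B * (1 / 2) ^+ i.+1 <= B * (1 - (1 / 2) ^+ n).
  move=> B0; elim: n => [|n IH]; first by rewrite big_ord0 expr0 subrr mulr0.
  rewrite big_ord_recr /= exprS; move: ((1 / 2) ^+ n) IH => q IH; lra.
have L f z : bhol U f -> U z -> exists l, vlim (fun n => S n f z) l.
  move=> Hf Uz; have [_ [B HB]] := Hf.
  have B0 : 0 <= B by apply: le_trans (HB z Uz); exact: vnorm_ge0.
  apply: (@bounded_variation_cvg R X _ (fun n => B * (1 / 2) ^+ n.+1) B).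
  - exact: complete_seqcomplete.
  - by move=> n; exact: step.
  - by move=> n; apply: le_trans (geo B n B0) _; rewrite ler_piMr// lerBlDr lerDl exprn_ge0.
have Nb := bop_lim oU HS L; set N := (fun f z => limn _) in Nb.
exists N => // f z Hf Uz; have [_ [B HB]] := Hf.
have B0 : 0 <= B by apply: le_trans (HB z Uz); exact: vnorm_ge0.
have LN w : U w -> vlim (fun n => S n f w) (N f w).
  by move=> Uw; have [l Hl] := L f w Hf Uw; rewrite /N (vlim_limn Hl).
have tail n : bounded_by U (fun w => N f w - S n f w) (B * (1 / 2) ^+ n).
  move=> w Uw.
  have T m : vnorm (S (n + m)%N f w - S n f w) <= B * (1 / 2) ^+ n * (1 - (1 / 2) ^+ m).
    elim: m => [|m IH]; first by rewrite addn0 subrr vnorm0 expr0 subrr mulr0.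
    have := vnorm_tri (S (n + m).+1 f w) (S (n + m)%N f w) (S n f w).
    have := step f B (n + m)%N Hf HB w Uw; rewrite addnS exprS exprD exprS.
    by move: IH; move: ((1 / 2) ^+ n) ((1 / 2) ^+ m) => p q; lra.
  have p0 (m : nat) : 0 <= (1 / 2 : R) ^+ m by apply: exprn_ge0; lra.
  have A : vlim (fun m => S m f w - S n f w) (N f w - S n f w) by apply: vlimB (LN w Uw) (vlim_cst _).
  apply: (@vlim_le _ _ _ _ _ n _ A) => m nm; rewrite -(subnKC nm).
  by apply: le_trans (T _) _; rewrite ler_piMr ?mulr_ge0// lerBlDr lerDl.
apply/eqP; rewrite -subr_eq0; apply/eqP; apply: vnorm_small => e e0.
have e1 : 0 < e / (B + 1) by rewrite divr_gt0//; lra.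
have h0 : 0 <= 1 / 2 :> R by lra.
have [|n /(_ n (leqnn n)) qn] := geometric_small h0 _ e1; first by lra.
have t1 := tail n.+1 z Uz.
have t2 := Dsub (N f) (S n f) _ (bop_bhol Nb Hf) (bop_bhol (HS n) Hf) (tail n) z Uz.
(* The recursion of [S] leaves two remainders, both controlled by the uniform bound [tail]. *)
have E : N f z - D (N f) z - f z = (N f z - S n.+1 f z) - (D (N f) z - D (S n f) z).
  by rewrite /=; lmodule R[i] X.
rewrite E; apply: le_trans (vnormB _ _) _; rewrite exprS in t1.
have : (1 / 2) ^+ n * (B + 1) <= e by rewrite -ler_pdivlMr//; lra.
have p0 : 0 <= (1 / 2 : R) ^+ n by exact: exprn_ge0.
by move: ((1 / 2) ^+ n) p0 t1 t2 => q q0 t1 t2; lra.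
Qed.

End OperatorCalculus.

(** * Stability of the gluing functions along a branch *)

Section Splitting.
Variable R : realType.
Local Notation C := R[i].
Notation V := (R[i])^o.

Lemma copen_preimage_annulus (h : C -> V) (a b : R) : (forall w, cmod w < 1 -> cdiff h w) ->
  copen [set w : C | cmod w < 1 /\ annulus a b (h w)].
Proof.
move=> hd z [z1 /andP[az zb]].
have [e e0 He] : exists2 e, 0 < e & e <= (cmod (h z) - a) / 2 /\ e <= (b - cmod (h z)) / 2.
  exists (Num.min ((cmod (h z) - a) / 2) ((b - cmod (h z)) / 2)); last by rewrite !ge_min !lexx orbT.
  by rewrite lt_min; apply/andP; split; lra.
have d1 : 0 < 1 - cmod z by lra.
apply: near0_imp (near0_and (near0_small d1) (cdiff_cont (hd z z1) e0)) => k [k1].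
rewrite vnorm_scal => hk; split; first by have := cmodD z k; lra.
have A := cmodD (h (z + k) - h z) (h z); rewrite subrK in A.
have B := cmodD (h z - h (z + k)) (h (z + k)); rewrite subrK cmodC in B.
by apply/andP; split; lra.
Qed.

Lemma interp_bounds_ge1 (z : nat -> C) K : (forall n, cmod (z n) < 1) -> interp_bounds z K -> 1 <= K.
Proof.
move=> z1 [_ /(_ (fun=> 1) 1)[|g [_ gz gK]]]; first by move=> n; rewrite cmod1.
by have := gK _ (z1 0%N); rewrite gz cmod1 mulr1.
Qed.

(* Schwarz's lemma for [w |-> \sum_m eps m * f m (b w)] with unimodular [eps m]. *)
Lemma beurling_stability (f : nat -> C -> V) (M r : R) (b : C -> V) (k n : nat) (w : C) :
  1 <= M -> (forall m w, cmod w < 1 -> cdiff (f m) w) ->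
  (forall w n, cmod w < 1 -> \sum_(m < n) cmod (f m w) <= M) ->
  0 < r -> (forall w, cmod w < r -> cmod (b w) < 1 /\ cdiff b w) ->
  (forall m, f m (b 0) = (m == k)%:R) -> cmod w < r / (3 * M) ->
  \sum_(m < n) cmod (f m (b w) - (m == k :> nat)%:R) <= 1 / 2.
Proof.
move=> M1 fd fM r0 bd fb wr; have M0 : 0 < M by lra.
pose d m : C := f m (b w) - (m == k)%:R.
pose ep m : C := if d m == 0 then 0 else (cmod (d m))%:C / d m.
have ep1 m : cmod (ep m) <= 1.
  rewrite /ep; case: eqVneq => [_|d0]; first by rewrite cmod0.
  by rewrite cmodf cmodRp ?cmod_ge0// divff// cmod_eq0.
have epE m : ep m * d m = (cmod (d m))%:C.
  rewrite /ep; case: eqVneq => [->|d0]; first by rewrite mulr0 cmod0.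
  by rewrite divfK.
pose G v : C := \sum_(m < n) ep m * f m v.
have GM v : cmod v < 1 -> cmod (G v) <= M.
  move=> v1; apply: le_trans (fM v n v1); apply: le_trans (cmod_sum _ _ _) _.
  by apply: ler_sum => m _; rewrite cmodM ler_piMl ?cmod_ge0.
pose S := \sum_(m < n) cmod (f m (b w) - (m == k :> nat)%:R).
have GS : G (b w) - G (b 0) = S%:C.
  rewrite /G -sumrB /S rmorph_sum /=; apply: eq_bigr => m _.
  by rewrite fb -mulrBr epE.
(* Normalised to a map from the unit disc to the closed unit disc; the point in question becomes
   [u = w / r], of modulus at most [1 / (3 * M)]. *)
pose psi u : V := M^-1%:C * G (b (r%:C * u)).
have ru u : cmod u < 1 -> cmod (r%:C * u) < r.
  by move=> u1; rewrite cmodM cmodRp ?(ltW r0)// -[ltRHS]mulr1 ltr_pM2l.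
have psid u : cmod u < 1 -> cdiff psi u.
  move=> /ru u1; have [b1 b2] := bd _ u1.
  apply: cdiffMs; first exact: cdiff_cst.
  apply: (@cdiff_comp R V (fun u => b (r%:C * u)) G).
    apply: (@cdiff_comp R V (fun u => r%:C * u) b) => //.
    by apply: cdiffMs; [exact: cdiff_cst|exact: cdiff_id].
  apply: (@cdiff_sum R V) => m; apply: cdiffMs; [exact: cdiff_cst|exact: fd].
have psi1 u : cmod u < 1 -> cmod (psi u) <= 1.
  move=> /ru u1; have [b1 _] := bd _ u1.
  rewrite cmodM cmodRp ?invr_ge0 ?(ltW M0)// ler_pdivrMl// mulr1; exact: GM.
have rn : r%:C != 0 :> C by rewrite -cmod_gt0 cmodRp// ltW.
have M3 : 3 <= 3 * M by lra.
have wr' : cmod w < r by apply: lt_le_trans wr _; rewrite ler_pdivrMr; [nra|lra].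
pose u : C := w / r%:C.
have uE : cmod u = cmod w / r by rewrite cmodf cmodRp// ltW.
have u1 : cmod u < 1 by rewrite uE ltr_pdivrMr// mul1r.
have Mu : M * cmod u <= 1 / 3.
  rewrite uE mulrA ler_pdivrMr//; move: wr; rewrite ltr_pdivlMr; last by lra.
  by move=> ?; lra.
have c0 : cmod (0 : C) < 1 by rewrite cmod0.
have := schwarz_pick psid psi1 u1 c0.
rewrite rmorph0 mul0r !subr0 cmod1 mulr1.
have psiS : psi u - psi 0 = (M^-1 * S)%:C.
  by rewrite /psi mulr0 /u mulrCA divff// mulr1 -mulrBr GS -rCM.
have S0 : 0 <= M^-1 * S.
  rewrite mulr_ge0 ?invr_ge0 ?(ltW M0)//; apply: sumr_ge0 => m _; exact: cmod_ge0.
(* With [s = S / M], Schwarz-Pick becomes [s <= cmod u * (1 + s)], whence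
   [S <= M * cmod u / (1 - cmod u)]. Since [M * cmod u <= 1 / 3] and [cmod u <= 1 / 3], this is at
   most [(1 / 3) / (2 / 3) = 1 / 2]: the origin of the 3 in [r / (3 * M)]. *)
have : cmod (1 - conjc (psi 0) * psi u) <= 1 + M^-1 * S.
  rewrite (_ : 1 - _ = (1 - (cmod (psi 0) ^+ 2)%:C) - conjc (psi 0) * (psi u - psi 0)); last first.
    by rewrite sqr_cmod; ring.
  apply: le_trans (cmodB _ _) _; rewrite cmodM cmodJ psiS (cmodRp S0).
  have p1 := psi1 _ c0; have p0 := cmod_ge0 (psi 0).
  rewrite -(rmorph1 (real_complex R)) -rmorphB cmodRp; last by rewrite expr2; nra.
  have : cmod (psi 0) * (M^-1 * S) <= 1 * (M^-1 * S) by rewrite ler_wpM2r.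
  by have := sqr_ge0 (cmod (psi 0)); lra.
rewrite psiS (cmodRp S0).
have -> : M^-1 * S = S / M by rewrite mulrC.
move=> A B; have SM : S / M * M = S by rewrite divfK// gt_eqF.
move: (cmod (1 - _)) A B => q A B.
have h := ler_wpM2l (cmod_ge0 u) A.
have u0 := cmod_ge0 u.
have u3 : cmod u <= 1 / 3 by nra.
rewrite [M^-1 * S]mulrC in S0.
move: (S / M) SM S0 h B => s SM s0 h B.
have s1 : s * (1 - cmod u) <= cmod u by lra.
have s2 : s <= 1 / 2 by nra.
rewrite -/S -SM.
have : M * (s * (1 - cmod u)) <= M * cmod u by rewrite ler_pM2l.
have : 0 <= M * s by rewrite mulr_ge0// ltW.
by nra.
Qed.

End Splitting.

(** * The splitting on preimages of annuli *)

Section LayerSplitting.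
Variables (R : realType) (X : completeNormedModType R[i]).
Local Notation C := R[i].
Notation V := (R[i])^o.
Variables (f b : nat -> C -> V) (B : C -> V) (z : nat -> C) (r M : R).
Hypotheses (r0 : 0 < r) (r1 : r < 1) (M1 : 1 <= M).
Hypothesis Bd : forall w, cmod w < 1 -> cdiff B w.
Hypothesis fd : forall m w, cmod w < 1 -> cdiff (f m) w.
Hypothesis fz : forall m k, f m (z k) = (m == k)%:R.
Hypothesis fM : forall w n, cmod w < 1 -> \sum_(m < n) cmod (f m w) <= M.
Hypothesis b1 : forall k w, cmod w < r -> [/\ cmod (b k w) < 1, B (b k w) = w & cdiff (b k) w].
Hypothesis b0 : forall k, b k 0 = z k.
Hypothesis bB : forall v, cmod v < 1 -> cmod (B v) < r -> exists k, v = b k (B v).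

Let a := r / (6 * M).
Let a2 := r / (3 * M).
(** One form for all three domains: [s = -1] leaves only the upper bound, and [t = 1] gives the
    domain of the first operator. *)
Definition layer (s t : R) : set C := [set w | cmod w < 1 /\ annulus s t (B w)].

Let a_gt0 : 0 < a.
Proof. by have M1' := M1; rewrite divr_gt0//; lra. Qed.

Let a2E : a2 = 2 * a.
Proof. by have M1' := M1; rewrite /a /a2; field; rewrite gt_eqF//; lra. Qed.

Let a2r : a2 < r.
Proof. by have [M1' r0'] := conj M1 r0; rewrite ltr_pdivrMr; [nra|lra]. Qed.

Let copen_layer s t : copen (layer s t).
Proof. exact: copen_preimage_annulus. Qed.

Let pull_branch k : bop (layer a a2) (annulus a a2) (fun g w => g (b k w) : X) 1.
Proof.
apply: bop_pullback => w /[dup] aw /andP[_ wa2].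
have [|h1 h2 h3] := @b1 k w; first by apply: lt_trans a2r.
by split=> //; split=> //; rewrite h2.
Qed.

Let pull_B s t W : (forall w, annulus s t w -> W w) ->
  bop W (layer s t) (fun g w => g (B w) : X) 1.
Proof. by move=> H; apply: bop_pullback => w [w1 /H ?]; split=> //; exact: Bd. Qed.

Let fd' s t m w : layer s t w -> cdiff (f m) w.
Proof. by move=> [w1 _]; exact: fd. Qed.

Let fM' s t n w : layer s t w -> \sum_(m < n) cmod (f m w) <= M.
Proof. by move=> [w1 _]; exact: fM. Qed.

(* [P g] extrapolates [g] from the branch through [w] to a combination of all
   branches; it is a perturbation of the identity. *)
Let P (g : C -> X) w := limn (fun n => \sum_(m < n) (f m w : C) *: g (b m (B w))).

Let opP : bop (layer a a2) (layer a a2) P (M * (1 * 1)) /\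
  forall g w, bhol (layer a a2) g -> layer a a2 w ->
    vlim (fun n => \sum_(m < n) (f m w : C) *: g (b m (B w))) (P g w).
Proof.
apply: (@bop_series R X (layer a a2) (layer a a2) f (fun m g w => g (b m (B w))) (1 * 1) M).
- exact: copen_layer.
- by move=> m w; exact: fd'.
- by move=> n w; exact: fM'.
move=> m; exact: bop_comp (pull_branch m) (@pull_B a a2 (annulus a a2) (fun w h => h)).
Qed.

(** As [w = b k (B w)] for some [k], the value [g w] is the same series with coefficients 1 at [k]
    and 0 elsewhere; [beurling_stability] bounds the difference of the two coefficient sequences. *)
Let near_id : bop (layer a a2) (layer a a2) (fun g w => g w - P g w : X) (1 / 2).
Proof.
have [opP1 limP] := opP.
apply: bop_id_sub opP1 _ => g K Hg HK w Lw.
have [w1 /andP[_ Ba2]] := Lw.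
have Br : cmod (B w) < r by apply: lt_trans a2r.
have [k wE] := bB w1 Br.
have gK m : vnorm (g (b m (B w))) <= K.
  by have := bop_bound (pull_branch m) Hg HK; rewrite mul1r; apply; case: Lw.
have K0 : 0 <= K by apply: le_trans (gK 0%N); exact: vnorm_ge0.
have L := vlimB (vlim_cst (g w)) (limP g w Hg Lw).
(* Only partial sums of more than [k] terms contain the index [k]. *)
apply: (@vlim_le _ _ _ _ _ k.+1 _ L) => n kn.
have -> : g w = \sum_(m < n) ((m == k :> nat)%:R : C) *: g (b m (B w)).
  rewrite (bigD1 (Ordinal kn))//= eqxx scale1r big1 ?addr0 -?wE// => m mk.
  by rewrite (_ : (m == k :> nat) = false) ?scale0r//; apply/negbTE.
rewrite -sumrB; apply: le_trans (vnorm_sum _ _ _) _.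
apply: le_trans (_ : \sum_(m < n) cmod (f m w - (m == k :> nat)%:R) * K <= _).
  by apply: ler_sum => m _; rewrite -scalerBl vnormZ cmodC ler_wpM2l ?cmod_ge0.
rewrite -mulr_suml ler_wpM2r//.
have := @beurling_stability R f M r (b k) k n (B w) M1 fd fM r0 _ _ Ba2.
rewrite -wE; apply => [v vr|m]; first by have [] := @b1 k v vr.
by rewrite b0 fz.
Qed.

Theorem layer_splitting : exists T1 T2 : (C -> X) -> (C -> X),
  [/\ bop (layer a a2) (layer a 1) T1 (6 * M), bop (layer a a2) (layer (- 1) a2) T2 (4 * M) &
  forall g, bhol (layer a a2) g -> forall w, layer a a2 w -> T1 g w + T2 g w = g w].
Proof.
have [N opN NE] := bop_neumann (@copen_layer a a2) near_id.
have [_ limP] := opP.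
have a2a : a < a2 by rewrite a2E; have := a_gt0; lra.
have opb m := bop_comp opN (pull_branch m).
have op1 m := bop_comp (bop_comp (opb m) (bop_laurent_out X a_gt0 a2a a2E))
  (@pull_B a 1 [set w | a < cmod w] (fun w h => proj1 (andP h))).
have op2 m := bop_comp (bop_comp (opb m) (bop_laurent_in X a_gt0 a2a a2E))
  (@pull_B (- 1) a2 [set w | cmod w < a2] (fun w h => proj2 (andP h))).
have [S1 L1] := bop_series (@copen_layer a 1) (@fd' a 1) (@fM' a 1) op1.
have [S2 L2] := bop_series (@copen_layer (- 1) a2) (@fd' (- 1) a2) (@fM' (- 1) a2) op2.
(* From the right: inverse of [P], pullback by a branch, Laurent part, composition with [B],
   gluing. *)
have e1 : M * (1 * (3 * (1 * 2))) = 6 * M by ring.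
have e2 : M * (1 * (2 * (1 * 2))) = 4 * M by ring.
rewrite e1 in S1; rewrite e2 in S2.
eexists; eexists; split; [exact: S1|exact: S2|].
move=> g Hg w Lw; have HN := bop_bhol opN Hg.
(* With [D = 1 - P] the Neumann identity for [N] says that [N] is a right inverse of [P]; the
   splitting is therefore carried out on [N g]. *)
have PN : P (N g) w = g w by have := NE g w Hg Lw; rewrite opprB addrC subrK.
rewrite -PN; apply: vlim_unique (limP _ w HN Lw).
have Lw1 : layer a 1 w.
  case: Lw => w1 /andP[h1 h2]; split=> //; apply/andP; split=> //.
  by have := a2r; have := r1; lra.
have Lw2 : layer (- 1) a2 w.
  case: Lw => w1 /andP[h1 h2]; split=> //; apply/andP; split=> //.
  by have := cmod_ge0 (B w); lra.
apply: vlim_ext (vlimD (L1 g w Hg Lw1) (L2 g w Hg Lw2)) => n.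
rewrite -big_split /=; apply: eq_bigr => m _; rewrite -scalerDr addrC.
have [dm _] := bop_bhol (opb m) Hg.
congr (_ *: _); apply: (laurent_sum a_gt0 a2a dm).
by case: Lw.
Qed.

End LayerSplitting.

(** * Assembly for the Blaschke product of the sequence *)

Theorem theorem2p5 (R : realType) (X : completeNormedModType R[i])
  (z : nat -> cplx R) (delta lambda : R) :
  (forall n, odisk 1 (z n)) ->
  interpolating z ->
  0 < delta -> delta <= sep_const z ->
  0 < lambda < 1 -> 2 * lambda / (1 + lambda ^+ 2) < delta ->
  let r := (delta - lambda) / (1 - lambda * delta) * lambda in
  let M := interp_const z in
  let B := blaschke z in
  let A := odisk (r / (3 * M)) `\` cdisk (r / (6 * M)) in
  let Az := odisk 1 `&` B @^-1` A in
  let S1 := odisk 1 `&` B @^-1` (odisk 1 `\` cdisk (r / (6 * M))) in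
  let S2 := odisk 1 `&` B @^-1` odisk (r / (3 * M)) in
  exists T1 T2 : (cplx R -> X) -> (cplx R -> X),
    [/\ Hinf_linop Az S1 T1, Hinf_linop Az S2 T2,
        opnorm_le Az S1 T1 (6 * M), opnorm_le Az S2 T2 (4 * M) &
        forall f, Hinf Az f -> forall w, Az w -> T1 f w + T2 f w = f w].
Proof.
move=> z1 _ d0 dsep l01 ld r M B A Az S1 S2.
have r0 : 0 < r := radius_gt0 z1 dsep l01 ld.
have r1 : r < 1 := radius_lt1 z1 dsep l01 ld.
have [ne|/nonemptyPn empty] := pselect (interp_bounds z !=set0); last first.
  (* Here the junk value [inf set0 = 0] makes the disk of radius [r / (3 * M)] empty. *)
  have M0 : M = 0 by rewrite /M /interp_const -/(interp_bounds z) empty inf0.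
  have noAz w : ~ Az w.
    by move=> [_ []]; rewrite /odisk /= M0 mulr0 invr0 mulr0 ltNge cmod_ge0.
  have [lin1 bd1] := bop_Hinf (bop_zero X Az S1); have [lin2 bd2] := bop_Hinf (bop_zero X Az S2).
  exists (fun _ _ => 0), (fun _ _ => 0); split=> //; first by rewrite M0 mulr0.
    by rewrite M0 mulr0.
  by move=> f _ w /noAz.
have zinj : injective z.
  move=> j k jk; apply/eqP; apply: contraT => /(sep_le_rho z1 dsep).
  by rewrite jk rhoE blf_self cmod0 leNgt d0.
have M1 : 1 <= M by apply: lb_le_inf => // K; exact: interp_bounds_ge1.
have [b [b1 b0 bB]] := blaschke_branches z1 d0 dsep l01 ld.
have [f [fd fz fM]] := beurling_functions z1 zinj ne.
have Bd w : cmod w < 1 -> @cdiff R (cplx R) B w.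
  by rewrite /B blaschke_lim; exact: (cdiff_bprod_lim z1 d0 dsep predT).
have [T1 [T2 [op1 op2 T12]]] := @layer_splitting R X f b B z r M r0 r1 M1 Bd fd fz fM b1 b0 bB.
have AzE : layer B (r / (6 * M)) (r / (3 * M)) = Az.
  apply/seteqP; split=> w; rewrite /layer /Az /A /odisk /cdisk /annulus /=.
    by move=> [w1 /andP[h1 h2]]; split=> //; split=> //; apply/negP; rewrite -ltNge.
  by move=> [w1 [h2 /negP]]; rewrite -ltNge => h1; split=> //; rewrite h1.
have S1E : layer B (r / (6 * M)) 1 = S1.
  apply/seteqP; split=> w; rewrite /layer /S1 /odisk /cdisk /annulus /=.
    by move=> [w1 /andP[h1 h2]]; split=> //; split=> //; apply/negP; rewrite -ltNge.
  by move=> [w1 [h2 /negP]]; rewrite -ltNge => h1; split=> //; rewrite h1.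
have S2E : layer B (- 1) (r / (3 * M)) = S2.
  apply/seteqP; split=> w; rewrite /layer /S2 /odisk /annulus /=; first by move=> [w1 /andP[]].
  by move=> [w1 ->]; rewrite andbT; split=> //; apply: lt_le_trans (cmod_ge0 _); rewrite oppr_lt0.
rewrite AzE S1E in op1; rewrite AzE S2E in op2; rewrite AzE in T12.
have [lin1 bd1] := bop_Hinf op1; have [lin2 bd2] := bop_Hinf op2.
by exists T1, T2; split=> // g /Hinf_bhol; exact: T12.
Qed.
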